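(* Let $(C,D(C))$ be a (possibly unbounded) linear operator on $U$ such that: (1) $(C,D(C))$ is symmetric and nonnegative; (2) for all $n\in\mathbb N$, $B_U^n\subset D(C)$ and $C(B_U^n)\subset B_U^n$; (3) there is $\tau_1>0$ such that $(-Q_1^{-1}Cu,u)_U\le -\tau_1\|u\|_U^2$ for all $u\in D(Q_1^{-1}C)=\{u\in D(C): Cu\in D(Q_1^{-1})\}$. Suppose $\Phi:U\to(-\infty,\infty]$ is in $W^{1,2}(U,\mu_1,\mathbb R)$, convex, bounded from below and lower semicontinuous, and that $\int_U\|D\Phi\|_U^p\,d\mu_1<\infty$ for some $p\in(2,\infty)$. For $f\in\mathcal{F}C_b^\infty(B_U)$ let $$Nf=\mathrm{tr}[CD^2f]-(u,Q_1^{-1}CDf)_U-(D\Phi,CDf)_U .$$ Then for every $f\in\mathcal{F}C_b^\infty(B_U)$ and $\alpha\in(0,\infty)$, with $g=\alpha f-Nf$, $$\int_U\alpha f^2+(CDf,Df)_U\,d\mu_1^\Phi\le\frac1\alpha\int_Ug^2\,d\mu_1^\Phi,$$ $$\int_U\mathrm{tr}[(CD^2f)^2]+\|Q_1^{-\frac12}CDf\|_U^2\,d\mu_1^\Phi\le4\int_Ug^2\,d\mu_1^\Phi.$$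
   Context: $U$ is an infinite-dimensional real separable Hilbert space with inner product $(\cdot,\cdot)_U$ and norm $\|\cdot\|_U$. $\mu_1$ is a centered non-degenerate Gaussian measure on $(U,\mathcal B(U))$ with covariance operator $Q_1$ (symmetric, nonnegative, trace class, injective). $Q_1^{-1}$ is the inverse of $Q_1:U\to Q_1(U)$, with $D(Q_1^{-1})=Q_1(U)$. $B_U=(d_i)_{i\in\mathbb N}$ is an orthonormal basis of $U$ of eigenvectors of $Q_1$ with eigenvalues $(\lambda_i)_{i\in\mathbb N}\subset(0,\infty)$ decreasing to zero. $B_U^n=\mathrm{span}\{d_1,\dots,d_n\}$ and $P_n(u)=((u,d_1)_U,\dots,(u,d_n)_U)\in\mathbb R^n$. On $\bigcup_nB_U^n$, $Q_1^{-\frac12}$ is the linear operator with $Q_1^{-\frac12}d_i=\lambda_i^{-\frac12}d_i$. $C_b^\infty(\mathbb R^m)$ is the space of smooth real functions on $\mathbb R^m$ bounded together with all their derivatives, and $\mathcal{F}C_b^\infty(B_U)=\{u\mapsto\varphi(P_m(u)): m\in\mathbb N,\ \varphi\in C_b^\infty(\mathbb R^m)\}$. For such $f$, $Df(u)\in U$ is the gradient and $D^2f(u)\in\mathcal L(U)$ the second Fréchet derivative. The operator $D:\mathcal{F}C_b^\infty(B_U)\to L^2(U,\mu_1,U)$ is closable in $L^2(U,\mu_1,\mathbb R)$; $W^{1,2}(U,\mu_1,\mathbb R)$ is the domain of its closure, still denoted $D$. For measurable $\Phi:U\to(-\infty,\infty]$ bounded from below, $\rho_\Phi=\frac1{c_\Phi}e^{-\Phi}$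 with $c_\Phi=\int_Ue^{-\Phi}d\mu_1$, and $\mu_1^\Phi=\rho_\Phi\mu_1$. In the formula for $N$, the letter $u$ denotes the variable in $U$. *)

(* Defs.v *)
From HB Require Import structures.
From mathcomp Require Import all_boot all_order all_algebra sesquilinear.
From mathcomp Require Import all_classical all_reals all_analysis
  measurable_realfun measurable_fun_approximation.

Set Implicit Arguments.
Unset Strict Implicit.
Unset Printing Implicit Defensive.

Import Order.TTheory GRing.Theory Num.Theory.
Import numFieldNormedType.Exports.

Local Open Scope classical_set_scope.
Local Open Scope ring_scope.

(* A real Hilbert space is a complete normed module [U] over [R : realType]
   together with [ip : {dot U for idfun}] satisfying [ip u u = `|u| ^+ 2];
   this last equation is a hypothesis of the theorem.

   Sequences start at 0: [d i] and [lam i] stand for d_(i+1), lambda_(i+1). *)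

Section linear_operators.
Context {R : realType} {U : lmodType R}.

(* An operator with domain; the values of [opfun] outside [dom] are junk. *)
Record partial_op := PartialOp { dom : set U ; opfun :> U -> U }.

Definition linear_op (A : partial_op) :=
  dom A 0 /\
  forall (a : R) u v, dom A u -> dom A v ->
    dom A (a *: u + v) /\ A (a *: u + v) = a *: A u + A v.

Definition comp_op (A B : partial_op) :=
  PartialOp [set u | dom B u /\ dom A (B u)] (A \o B).

Definition inverse_op (Q : U -> U) :=
  PartialOp (range Q) (fun u => xget 0 [set v | Q v = u]).

Variable ip : {dot U for idfun}.

Definition symmetric_op (A : partial_op) :=
  forall u v, dom A u -> dom A v -> ip (A u) v = ip u (A v).

Definition nonneg_op (A : partial_op) :=
  forall u, dom A u -> 0 <= ip (A u) u.

End linear_operators.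

Section basis.
Context {R : realType} {U : completeNormedModType R}.
Variables (ip : {dot U for idfun}) (d : nat -> U).

Definition basis_span (n : nat) : set U :=
  [set u | exists c : 'I_n -> R, u = \sum_(i < n) c i *: d i].

(* Existence of such a sequence forces [U] to be separable and of infinite
   dimension. *)
Definition orthonormal_basis :=
  (forall i j, ip (d i) (d j) = (i == j)%:R) /\
  closure (\bigcup_n basis_span n) = setT.

Definition coordinates (n : nat) (u : U) : 'rV[R]_n := \row_(i < n) ip u (d i).

Definition trace (T : U -> U) : R :=
  limn (series (fun i => ip (T (d i)) (d i))).

(* For symmetric nonnegative everywhere defined operators. *)
Definition trace_class (Q : U -> U) :=
  (\sum_(0 <= i <oo) (ip (Q (d i)) (d i))%:E < +oo)%E.

(* Q^{-1/2} on the linear span of the basis, where the series has only finitely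
   many nonzero terms. *)
Definition inv_sqrt_op (lam : nat -> R) :=
  PartialOp (\bigcup_n basis_span n)
    (fun u => limn (series (fun i => ((Num.sqrt (lam i))^-1 * ip u (d i)) *: d i))).

End basis.

Section smooth_functions.
Context {R : realType}.

Definition partials {m : nat} (s : seq 'I_m) (phi : 'rV[R]_m -> R) :
    'rV[R]_m -> R :=
  foldr (fun i (g : 'rV[R]_m -> R) x => 'D_(delta_mx 0 i) g x) phi s.

Definition Cb_infty {m : nat} (phi : 'rV[R]_m -> R) :=
  forall s : seq 'I_m,
    (forall x, differentiable (partials s phi) x) /\
    (exists M : R, forall x, `|partials s phi x| <= M).

Context {U : completeNormedModType R}.
Variables (ip : {dot U for idfun}) (d : nat -> U).

Definition FCb_infty : set (U -> R) :=
  [set f | exists (m : nat) (phi : 'rV[R]_m -> R),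
     Cb_infty phi /\ f = phi \o coordinates ip d m].

(* The Riesz representative of the Frechet derivative. *)
Definition gradient (f : U -> R) (u : U) : U :=
  xget 0 [set w | forall h : U, 'd f u h = ip w h].

Definition hessian (f : U -> R) (u : U) : U -> U := 'd (gradient f) u.

End smooth_functions.

Definition borel {R : realType} (U : completeNormedModType R) :=
  g_sigma_algebraType (@open U).

Section gaussian.
Context {R : realType} {U : completeNormedModType R}.
Variables (ip : {dot U for idfun}) (mu : probability (borel U) R).

(* [normal_prob 0 s] has standard deviation [s]; the library gives it another
   meaning for [s = 0], so that the degenerate law is stated separately. *)
Definition centered_gaussian_law (nu : set R -> \bar R) :=
  (exists2 s : R, 0 < s & forall A, measurable A -> nu A = normal_prob 0 s A) \/
  (forall A, measurable A -> nu A = \d_(0 : R) A).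

Definition centered_gaussian :=
  forall h : U, centered_gaussian_law (pushforward mu (fun u : borel U => ip u h)).

Definition covariance_operator (Q : U -> U) :=
  forall h k : U, (\int[mu]_u (ip u h * ip u k)%:E = (ip (Q h) k)%:E)%E.

End gaussian.

Section sobolev.
Context {R : realType} {U : completeNormedModType R}.
Variables (ip : {dot U for idfun}) (d : nat -> U) (mu : probability (borel U) R).

(* [(Phi, G)] is in the closure in L^2(mu, R) x L^2(mu, U) of the graph of the
   gradient on smooth cylinder functions: [Phi] is in W^{1,2} and [G] is a
   (mu-almost everywhere unique) version of its weak gradient. *)
Definition W12_gradient (Phi : borel U -> \bar R) (G : borel U -> borel U) :=
  [/\ measurable_fun setT Phi, measurable_fun setT G &
   exists fs : nat -> (U -> R),
   [/\ forall n, FCb_infty ip d (fs n),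
       ('N[mu]_2%:E[(fun u => (fs n u)%:E - Phi u)])%E @[n --> \oo] --> 0%E &
       ('N[mu]_2%:E[(fun u => (`|gradient ip (fs n) u - (G u : U)|%R)%:E)])%E
         @[n --> \oo] --> 0%E ] ].

End sobolev.

Definition convex_ereal {R : realType} {U : lmodType R} (Phi : U -> \bar R) :=
  forall (t : R) (u v : U), 0 < t < 1 ->
    (Phi (t *: u + (1 - t) *: v)%R <= t%:E * Phi u + (1 - t)%:E * Phi v)%E.

Section gibbs.
Context d (T : measurableType d) {R : realType}.
Variables (mu : {measure set T -> \bar R}) (Phi : {mfun T >-> \bar R}).
Local Open Scope ereal_scope.

Definition gibbs_const : \bar R := \int[mu]_u expeR (- Phi u).

Definition gibbs_density (u : T) : \bar R :=
  ((fine gibbs_const)^-1)%:E * expeR (- Phi u).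

Definition gibbs (A : set T) : \bar R := \int[mu]_(u in A) gibbs_density u.

Let gibbs_density_ge0 u : 0 <= gibbs_density u.
Proof.
rewrite mule_ge0 ?expeR_ge0// lee_fin invr_ge0 fine_ge0//.
by apply: integral_ge0 => x _; exact: expeR_ge0.
Qed.

Let measurable_gibbs_density : measurable_fun setT gibbs_density.
Proof.
apply: measurable_funeM; rewrite (_ : (fun u => _) = fun u =>
    if Phi u == -oo then +oo else if Phi u == +oo then 0
    else (expR (- fine (Phi u)))%:E); last first.
  by apply/funext => u; case: (Phi u).
apply: measurable_fun_ifT; [exact: measurable_fun_eqe|by []|].
apply: measurable_fun_ifT; [exact: measurable_fun_eqe|by []|].
apply/measurable_EFinP; apply: measurableT_comp => //.
by apply: measurableT_comp => //; exact: measurableT_comp.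
Qed.

Let gibbs0 : gibbs set0 = 0.
Proof. exact: integral_set0. Qed.

Let gibbs_ge0 A : 0 <= gibbs A.
Proof. exact: integral_ge0. Qed.

Let gibbs_sigma_additive : semi_sigma_additive gibbs.
Proof. exact: semi_sigma_additive_nng_induced. Qed.

HB.instance Definition _ :=
  isMeasure.Build _ _ _ gibbs gibbs0 gibbs_ge0 gibbs_sigma_additive.

End gibbs.

Section kolmogorov.
Context {R : realType} {U : completeNormedModType R}.
Variables (ip : {dot U for idfun}) (d : nat -> U).

Definition kolmogorov (Q : U -> U) (C : partial_op (U := U)) (DPhi : U -> U)
    (f : U -> R) (u : U) : R :=
  trace ip d (C \o hessian ip f u)
  - ip u (inverse_op Q (C (gradient ip f u)))
  - ip (DPhi u) (C (gradient ip f u)).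

End kolmogorov.

(* Main.v *)
Require Import Defs.
From HB Require Import structures.
From mathcomp Require Import all_boot all_order all_algebra sesquilinear.
From mathcomp Require Import all_classical all_reals all_analysis
  measurable_realfun measurable_fun_approximation.
From mathcomp Require Import ring lra.

(** Everything is written in the coordinates of the basis [d i]. By symmetry and
    invariance of the spans, [C] is diagonal: [C d_i = c_i d_i], with
    [c_i >= 0]. For a cylinder function [f] put [V_i = c_i D_i f], and let
    [X] be the potential, [X_i] the components of its gradient, [rho = exp(-X)].
    The adjoint of [D_i] in the measure [rho mu] is
      [D_i^* V = x_i V / lam_i - D_i V + X_i V],
    and [N f = - sum_i D_i^* V_i]. Two facts give the theorem:

    - [- E (rho f N f) = E (rho sum_i c_i (D_i f)^2)], the Dirichlet form, which
      is nonnegative;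
    - [E (rho (N f)^2) >= E (rho (sum_ij D_j V_i D_i V_j + sum_i V_i^2 / lam_i))],
      whose right-hand side contains the trace and the norm of the statement.

    Expanding the square of [g = alpha f - N f] against [rho] then yields both
    inequalities ([resolvent_estimates]).

    The second fact is Bochner's formula. Commuting [D_i] with [D_j^*] produces
    the right-hand side and one more term, [E (rho sum_ij V_i V_j D_i D_j X)],
    which is nonnegative because [X] is convex. The potential having only one
    weak derivative, that term is kept in the weak form
      [sum_ij E (rho X_j (delta_i (V_i V_j) + X_i V_i V_j))]
    ([bochner_pair], [bochner_ge]), where [delta_i] is the adjoint for [mu].

    Its sign comes in two steps. For a smooth density [eta >= 0] in place of
    [rho], both derivatives are moved to the test function, so that [X] may be
    replaced by a pointwise limit ([weak_convexity]). A convex lower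
    semicontinuous function is the supremum of a sequence of affine functions
    ([affine_minorants], through Moreau's regularization), hence the limit of
    log-sum-exp functions, which are smooth and whose second derivative is a
    variance ([softmax_hessian_ge0]). Then [eta] is taken to be a smooth function
    of the cylinder functions approaching [X] in [W^{1,2}], and the passage to
    the limit turns it into [rho] ([convexity_rho]); the same passage proves the
    chain rule [D_i rho = - rho X_i] ([weak_derivative_rho]).

    Everything rests on Gaussian integration by parts for bounded Lipschitz
    functions ([gaussian_ibp]). The one-dimensional laws give the characteristic
    function of [mu] and thus the formula for plane waves ([ibp_wave]). Bernstein
    polynomials in [(1 + sin (x_j / L)) / 2] are combinations of waves, and they
    approach a function of finitely many coordinates together with its
    derivative, one coordinate at a time. *)

Set Implicit Arguments.
Unset Strict Implicit.
Unset Printing Implicit Defensive.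

Import Order.TTheory GRing.Theory Num.Theory.
Import numFieldNormedType.Exports.

Local Open Scope classical_set_scope.
Local Open Scope ring_scope.

(** * Integrability and expectations *)

Lemma sqr_cvg0 (R : realType) (u : nat -> R) :
  u n ^+ 2 @[n --> \oo] --> 0 -> u n @[n --> \oo] --> 0.
Proof.
move=> cv; apply/cvgrPdist_le => e e0.
have /cvgrPdist_le/(_ (e ^+ 2) (exprn_gt0 _ e0)) := cv.
apply: filterS => n; rewrite !sub0r !normrN normrX ler_sqr// nnegrE// ltW//.
Qed.

Section integrability.
Context d (T : measurableType d) (R : realType) (mu : probability T R).
Implicit Types F G : T -> R.

Definition L1 F := mu.-integrable setT (EFin \o F).
Definition L2 F := measurable_fun setT F /\ L1 (fun x => F x ^+ 2).
Definition Bm F := measurable_fun setT F /\ exists K, forall x, `|F x| <= K.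
Definition expect F := \int[mu]_x F x.

Lemma L1_meas F : L1 F -> measurable_fun setT F.
Proof. by move=> /measurable_int/measurable_EFinP. Qed.

Lemma L1D F G : L1 F -> L1 G -> L1 (fun x => F x + G x).
Proof.
move=> iF iG; rewrite /L1 (_ : _ \o _ = (EFin \o F) \+ (EFin \o G))//.
exact: integrableD.
Qed.

Lemma L1Z k F : L1 F -> L1 (fun x => k * F x).
Proof.
move=> iF; rewrite /L1 (_ : _ \o _ = fun x => (k%:E * (EFin \o F) x)%E)//.
exact: integrableZl.
Qed.

Lemma L1N F : L1 F -> L1 (fun x => - F x).
Proof. by move=> /(L1Z (-1)); under [X in L1 X]eq_fun do rewrite mulN1r. Qed.

Lemma L1B F G : L1 F -> L1 G -> L1 (fun x => F x - G x).
Proof. by move=> iF iG; apply: L1D => //; exact: L1N. Qed.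

Lemma L1_le F G : measurable_fun setT F -> L1 G ->
  (forall x, `|F x| <= G x) -> L1 F.
Proof.
move=> mF iG FG; apply: (le_integrable measurableT _ _ iG).
  exact/measurable_EFinP.
by move=> x _; rewrite /= lee_fin (le_trans (FG x))// ler_norm.
Qed.

Lemma L1_norm F : L1 F -> L1 (fun x => `|F x|).
Proof. exact: integrable_norm. Qed.

Lemma L1_cst k : L1 (fun=> k).
Proof.
rewrite /L1 (_ : _ \o _ = cst k%:E)//.
by apply: finite_measure_integrable_cst; exact: measurableT.
Qed.

Lemma L1_Bm F : Bm F -> L1 F.
Proof. by move=> [mF [K FK]]; apply: (L1_le mF (L1_cst K)). Qed.

Lemma Bm_norm F : Bm F -> Bm (fun x => `|F x|).
Proof.
move=> [mF [K FK]]; split; first exact: measurableT_comp.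
by exists K => x; rewrite normr_id.
Qed.

Lemma Bm_cst k : Bm (fun=> k).
Proof. by split => //; exists `|k|. Qed.

Lemma BmD F G : Bm F -> Bm G -> Bm (fun x => F x + G x).
Proof.
move=> [mF [K FK]] [mG [K' GK]]; split; first exact: measurable_funD.
by exists (K + K') => x; rewrite (le_trans (ler_normD _ _))// lerD.
Qed.

Lemma BmM F G : Bm F -> Bm G -> Bm (fun x => F x * G x).
Proof.
move=> [mF [K FK]] [mG [K' GK]]; split; first exact: measurable_funM.
by exists (K * K') => x; rewrite normrM ler_pM.
Qed.

Lemma BmZ k F : Bm F -> Bm (fun x => k * F x).
Proof. by move=> bF; apply: (BmM (Bm_cst k)). Qed.

Lemma BmN F : Bm F -> Bm (fun x => - F x).
Proof. by move=> /(BmZ (-1)); under [X in Bm X]eq_fun do rewrite mulN1r. Qed.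

Lemma BmB F G : Bm F -> Bm G -> Bm (fun x => F x - G x).
Proof. by move=> bF bG; apply: BmD => //; exact: BmN. Qed.

Lemma Bm_sum I (s : seq I) (F : I -> T -> R) :
  (forall i, Bm (F i)) -> Bm (fun x => \sum_(i <- s) F i x).
Proof.
move=> bF; elim: s => [|i s IHs].
  by under eq_fun do rewrite big_nil; exact: Bm_cst.
by under eq_fun do rewrite big_cons; exact: BmD.
Qed.

Lemma L1MB F G : L1 F -> Bm G -> L1 (fun x => F x * G x).
Proof.
move=> iF [mG [K GK]].
apply: (@L1_le _ (fun x => K * `|F x|)); last first.
- by move=> x; rewrite normrM mulrC ler_wpM2r.
- exact/L1Z/L1_norm.
- apply: measurable_funM => //; exact: L1_meas.
Qed.

Lemma L1BM F G : Bm F -> L1 G -> L1 (fun x => F x * G x).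
Proof. by move=> bF iG; under [X in L1 X]eq_fun do rewrite mulrC; exact: L1MB. Qed.

Lemma L2M F G : L2 F -> L2 G -> L1 (fun x => F x * G x).
Proof.
move=> [mF iF] [mG iG]; apply: (@L1_le _ (fun x => F x ^+ 2 + G x ^+ 2)).
- exact: measurable_funM.
- exact: L1D.
- move=> x; rewrite normrM -(real_normK (num_real (F x))).
  rewrite -(real_normK (num_real (G x))).
  have := normr_ge0 (F x); have := normr_ge0 (G x); nra.
Qed.

Lemma L2_Bm F : Bm F -> L2 F.
Proof. by move=> bF; split; [case: bF|apply: L1_Bm; exact: BmM]. Qed.

Lemma L2_L1 F : L2 F -> L1 F.
Proof.
move=> F2; under [X in L1 X]eq_fun do rewrite -[F _]mulr1.
exact/(L2M F2)/L2_Bm/Bm_cst.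
Qed.

Lemma L2D F G : L2 F -> L2 G -> L2 (fun x => F x + G x).
Proof.
move=> F2 G2; split; first by apply: measurable_funD; [case: F2|case: G2].
under [X in L1 X]eq_fun do rewrite sqrrD mulr2n.
have FG := L2M F2 G2; apply: L1D; last by case: G2.
by apply: L1D; [case: F2|exact: L1D].
Qed.

Lemma L2MB F G : L2 F -> Bm G -> L2 (fun x => F x * G x).
Proof.
move=> [mF iF] bG; split; first by apply: measurable_funM => //; case: bG.
by under [X in L1 X]eq_fun do rewrite exprMn; apply: L1MB => //; exact: BmM.
Qed.

Lemma L2BM F G : Bm F -> L2 G -> L2 (fun x => F x * G x).
Proof. by move=> bF iG; under [X in L2 X]eq_fun do rewrite mulrC; exact: L2MB. Qed.

Lemma L2Z k F : L2 F -> L2 (fun x => k * F x).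
Proof. by move=> F2; apply: (L2BM (Bm_cst k)). Qed.

Lemma L2N F : L2 F -> L2 (fun x => - F x).
Proof. by move=> /(L2Z (-1)); under [X in L2 X]eq_fun do rewrite mulN1r. Qed.

Lemma L2B F G : L2 F -> L2 G -> L2 (fun x => F x - G x).
Proof. by move=> F2 G2; apply: L2D => //; exact: L2N. Qed.

Lemma L2_norm F : L2 F -> L2 (fun x => `|F x|).
Proof.
move=> [mF iF]; split; first exact: measurableT_comp.
by under [X in L1 X]eq_fun do rewrite real_normK ?num_real//.
Qed.

Lemma L2_sum I (s : seq I) (F : I -> T -> R) :
  (forall i, L2 (F i)) -> L2 (fun x => \sum_(i <- s) F i x).
Proof.
move=> bF; elim: s => [|i s IHs].
  by under eq_fun do rewrite big_nil; apply: L2_Bm; exact: Bm_cst.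
by under eq_fun do rewrite big_cons; exact: L2D.
Qed.

Lemma L1_sum I (s : seq I) (F : I -> T -> R) :
  (forall i, L1 (F i)) -> L1 (fun x => \sum_(i <- s) F i x).
Proof.
move=> bF; elim: s => [|i s IHs].
  by under eq_fun do rewrite big_nil; exact: L1_cst.
by under eq_fun do rewrite big_cons; exact: L1D.
Qed.

Lemma L2_le F G : measurable_fun setT F -> L2 G ->
  (forall x, `|F x| <= G x) -> L2 F.
Proof.
move=> mF [_ iG] FG; split => //; apply: (L1_le _ iG).
  exact: measurable_funX.
move=> x; rewrite normrX ler_sqr ?nnegrE// (le_trans _ (FG x))//.
Qed.

Lemma expectD F G : L1 F -> L1 G ->
  expect (fun x => F x + G x) = expect F + expect G.
Proof. exact: RintegralD. Qed.

Lemma expectZ k F : L1 F -> expect (fun x => k * F x) = k * expect F.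
Proof. exact: RintegralZl. Qed.

Lemma expectN F : L1 F -> expect (fun x => - F x) = - expect F.
Proof. by move=> /(expectZ (-1)); rewrite mulN1r => <-; congr expect; apply/funext => x; rewrite mulN1r. Qed.

Lemma expectB F G : L1 F -> L1 G ->
  expect (fun x => F x - G x) = expect F - expect G.
Proof. exact: RintegralB. Qed.

Lemma expect_cst k : expect (fun=> k) = k.
Proof.
rewrite /expect Rintegral_cst//.
by rewrite [X in fine X](_ : _ = 1%E) ?mulr1//; exact: probability_setT.
Qed.

Lemma expect_sum I (s : seq I) (F : I -> T -> R) : (forall i, L1 (F i)) ->
  expect (fun x => \sum_(i <- s) F i x) = \sum_(i <- s) expect (F i).
Proof.
move=> bF; elim: s => [|i s IHs].
  by under eq_fun do rewrite big_nil; rewrite big_nil expect_cst.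
under eq_fun do rewrite big_cons; rewrite expectD ?IHs ?big_cons//.
exact: L1_sum.
Qed.

Lemma expect_ge0 F : (forall x, 0 <= F x) -> 0 <= expect F.
Proof. by move=> F0; apply: Rintegral_ge0 => x _. Qed.

Lemma expect_le F G : L1 F -> L1 G -> (forall x, F x <= G x) ->
  expect F <= expect G.
Proof. by move=> iF iG FG; apply: le_Rintegral => // x _. Qed.

Lemma expect_norm F : L1 F -> `|expect F| <= expect (fun x => `|F x|).
Proof. by move=> iF; apply: le_normr_Rintegral. Qed.

Lemma expect_ae F G : (exists2 N, mu.-negligible N & forall x, ~ N x -> F x = G x) ->
  measurable_fun setT F -> measurable_fun setT G -> expect F = expect G.
Proof.
move=> [N nN FG] mF mG; rewrite /expect /Rintegral; congr fine.
apply: ae_eq_integral => //; [exact/measurable_EFinP..|].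
apply: negligibleS nN => x /= FGx; apply: contrapT => nNx; apply: FGx => _.
by rewrite FG.
Qed.

Lemma expect_dct (Fn : nat -> T -> R) F G :
  (forall n, measurable_fun setT (Fn n)) ->
  (forall x, Fn n x @[n --> \oo] --> F x) -> L1 G ->
  (forall n x, `|Fn n x| <= G x) ->
  L1 F /\ expect (Fn n) @[n --> \oo] --> expect F.
Proof.
move=> mFn FnF iG FnG.
have mF : measurable_fun setT F by apply: measurable_fun_cvg => // x _; exact: FnF.
have [] := @dominated_convergence _ _ _ mu setT measurableT
  (fun n => EFin \o Fn n) (EFin \o F) (EFin \o G).
- by move=> n; exact/measurable_EFinP.
- exact/measurable_EFinP.
- by apply: aeW => x _; apply: cvg_EFin => //; [exact: nearW|exact: FnF].
- exact: iG.
- by apply: aeW => x n _; rewrite /= lee_fin.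
move=> iF _ cv; split => //; apply: fine_cvg; rewrite fineK//.
apply: integrable_fin_num => //.
Qed.

(** Cauchy-Schwarz in the form that passes to limits. *)
Lemma expect_CS F G : L2 F -> L2 G ->
  expect (fun x => F x * G x) ^+ 2 <=
  expect (fun x => F x ^+ 2) * expect (fun x => G x ^+ 2).
Proof.
move=> F2 G2; set a := expect (fun x => F x ^+ 2).
set b := expect (fun x => F x * G x); set c := expect (fun x => G x ^+ 2).
have quad t : 0 <= a * t ^+ 2 + 2 * b * t + c.
  have := @expect_ge0 (fun x => (t * F x + G x) ^+ 2) (fun x => sqr_ge0 _).
  rewrite (_ : (fun x => _) = fun x =>
    (t ^+ 2 * F x ^+ 2 + 2 * t * (F x * G x)) + G x ^+ 2); last first.
    by apply/funext => x; ring.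
  have [_ iF] := F2; have [_ iG] := G2; have FG := L2M F2 G2.
  rewrite expectD ?expectD ?expectZ//; [|exact: L1Z..|by apply: L1D; exact: L1Z].
  by rewrite -/a -/b -/c => h; rewrite (le_trans h)// le_eqVlt; apply/orP; left;
    apply/eqP; ring.
have a0 : 0 <= a by apply: expect_ge0 => x; exact: sqr_ge0.
have c0 : 0 <= c by apply: expect_ge0 => x; exact: sqr_ge0.
have [a_eq0|a_neq0] := eqVneq a 0.
  have [->|b_neq0] := eqVneq b 0; first by rewrite expr0n/= mulr_ge0.
  have := quad (- (c + 1) / (2 * b)); rewrite a_eq0 mul0r add0r.
  rewrite (_ : 2 * b * (- (c + 1) / (2 * b)) = - (c + 1)); last by field.
  by move=> ?; exfalso; lra.
have ap : 0 < a by rewrite lt_neqAle eq_sym a_neq0.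
have := quad (- b / a).
rewrite (_ : a * (- b / a) ^+ 2 + 2 * b * (- b / a) + c = (a * c - b ^+ 2) / a);
  last by field.
by rewrite pmulr_lge0 ?invr_gt0// subr_ge0.
Qed.

(** Pairing with a fixed square-integrable function is continuous in mean square. *)
Lemma expect_L2_cvg (Fn : nat -> T -> R) F G :
  (forall n, L2 (Fn n)) -> L2 F -> L2 G ->
  expect (fun x => (Fn n x - F x) ^+ 2) @[n --> \oo] --> 0 ->
  expect (fun x => Fn n x * G x) @[n --> \oo] --> expect (fun x => F x * G x).
Proof.
move=> Fn2 F2 G2 cv; apply/subr_cvg0.
suff : (expect (fun x => Fn n x * G x) - expect (fun x => F x * G x)) ^+ 2
    @[n --> \oo] --> 0.
  exact: sqr_cvg0.
apply: (@squeeze_cvgr _ _ _ _ (cst 0)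
  (fun n => expect (fun x => (Fn n x - F x) ^+ 2) * expect (fun x => G x ^+ 2))).
- apply: nearW => n; rewrite sqr_ge0/= -expectB; [|exact: L2M..].
  under eq_fun do rewrite -mulrBl.
  by apply: expect_CS => //; exact: L2B.
- exact: cvg_cst.
- by rewrite -[X in _ --> X](mul0r (expect (fun x => G x ^+ 2))); apply: cvgMl.
Qed.

(** An integrable factor is split at a level [K]: below it the mean-square
    convergence acts, above it the tail of [A] is small. *)
Lemma expect_L1_bounded_cvg (Dn : nat -> T -> R) A C :
  L1 A -> (forall n, measurable_fun setT (Dn n)) -> (forall n x, `|Dn n x| <= C) ->
  expect (fun x => Dn n x ^+ 2) @[n --> \oo] --> 0 ->
  expect (fun x => A x * Dn n x) @[n --> \oo] --> 0.
Proof.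
move=> iA mD DC cv.
have bD n : Bm (Dn n) by split => //; exists C.
have mA := L1_meas iA.
have C0 : 0 <= C by apply: le_trans (DC 0%N (point)).
pose tail (K : nat) x := `|A x| - Order.min `|A x| K%:R.
have tail_ge0 K x : 0 <= tail K x by rewrite subr_ge0 ge_min lexx.
have mmin K : measurable_fun setT (fun x => Order.min `|A x| K%:R).
  by apply: measurable_minr => //; exact: measurableT_comp.
have mtail K : measurable_fun setT (tail K).
  by apply: measurable_funB => //; exact: measurableT_comp.
have itail K : L1 (tail K).
  apply: (L1_le (mtail K) (L1_norm iA)) => x; rewrite ger0_norm// /tail.
  by rewrite gerBl le_min normr_ge0/=.
have [_ tail0] : L1 (fun=> 0) /\ expect (tail K) @[K --> \oo] --> expect (fun=> 0).
  apply: (expect_dct mtail _ (L1_norm iA)).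
    move=> x; apply: cvg_near_cst; near=> K; rewrite /tail min_l ?subrr//.
    by near: K; exact: nbhs_infty_ger.
  by move=> K x; rewrite ger0_norm// /tail gerBl le_min normr_ge0/=.
rewrite expect_cst in tail0.
apply/cvgrPdist_le => e e0.
have /cvgrPdist_le/(_ (e / (2 * (C + 1)))) : expect (tail K) @[K --> \oo] --> 0 by [].
have C1 : 0 < 2 * (C + 1) by lra.
move=> /(_ (divr_gt0 e0 C1)) [K0 _ /(_ K0 (leqnn _))].
rewrite sub0r normrN ger0_norm ?expect_ge0// => hK.
pose del := e / (2 * (K0%:R + 1)) : R.
have K1 : 0 < 2 * (K0%:R + 1) :> R by rewrite mulr_gt0// ltr_wpDl.
have del0 : 0 < del by rewrite divr_gt0.
have /cvgrPdist_le/(_ (del ^+ 2)) := cv => /(_ (exprn_gt0 _ del0)) hn.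
near=> n; rewrite sub0r normrN.
have Dn2 : expect (fun x => Dn n x ^+ 2) <= del ^+ 2.
  have : `|0 - expect (fun x => Dn n x ^+ 2)| <= del ^+ 2 by near: n.
  by rewrite sub0r normrN ger0_norm// expect_ge0// => x; exact: sqr_ge0.
have Dn1 : expect (fun x => `|Dn n x|) <= del.
  have := expect_CS (L2_norm (L2_Bm (bD n))) (L2_Bm (Bm_cst 1)).
  under eq_fun do rewrite mulr1; rewrite expr1n expect_cst mulr1.
  under [X in _ <= expect X]eq_fun do rewrite real_normK ?num_real//.
  move=> /le_trans/(_ Dn2); rewrite ler_sqr// nnegrE ?(ltW del0)//.
  by apply: expect_ge0 => x.
rewrite (le_trans (expect_norm (L1MB iA (bD n))))//.
apply: (@le_trans _ _ (expect (fun x => K0%:R * `|Dn n x| + C * tail K0 x))).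
  apply: expect_le.
  - exact/L1_norm/L1MB.
  - by apply: L1D; apply: L1Z => //; exact/L1_Bm/Bm_norm.
  - move=> x; rewrite normrM -[X in X * _](subrK (Order.min `|A x| K0%:R)).
    rewrite mulrDl addrC lerD//.
      by rewrite ler_wpM2r// ge_min lexx orbT.
    by rewrite mulrC ler_wpM2r//; exact: tail_ge0.
rewrite expectD; [|exact/L1Z/L1_Bm/Bm_norm|exact: L1Z].
rewrite !expectZ//; last exact/L1_Bm/Bm_norm.
have h1 : K0%:R * expect (fun x => `|Dn n x|) <= e / 2.
  rewrite (@le_trans _ _ (K0%:R * del))// ?ler_wpM2l// /del.
  rewrite mulrA ler_pdivrMr// mulrC.
  rewrite [leRHS](_ : _ = e * (K0%:R + 1)); last by field.
  by rewrite ler_pM2l// lerDl.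
have h2 : C * expect (tail K0) <= e / 2.
  rewrite (@le_trans _ _ (C * (e / (2 * (C + 1)))))// ?ler_wpM2l//.
  rewrite mulrA ler_pdivrMr// mulrC.
  rewrite [leRHS](_ : _ = e * (C + 1)); last by field.
  by rewrite ler_pM2l// lerDl.
lra.
Unshelve. all: end_near. Qed.

End integrability.

(** * Truncation, densities and the normal law *)

Section real_calculus.
Context {R : realType}.
Implicit Types f g : R -> R.

Lemma is_derive_continuous f f' : (forall x : R, is_derive x 1 f (f' x)) -> continuous f.
Proof.
by move=> df x; apply: differentiable_continuous; apply/derivable1_diffP; exact: ex_derive.
Qed.

Lemma mean_value f f' a b : (forall x : R, is_derive x 1 f (f' x)) ->
  exists c, [/\ `|c - a| <= `|b - a|, `|c - b| <= `|b - a| &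
                f b - f a = f' c * (b - a)].
Proof.
move=> df; have cf := is_derive_continuous df.
have [ab|ba|->] := ltgtP a b; last first.
- by exists b; rewrite !subrr mulr0 normr0.
- have [|c /[!in_itv]/= /andP[bc ca] E] := MVT ba (fun x _ => df x).
    exact: continuous_subspaceT.
  exists c; split; last by rewrite -[LHS]opprB E -mulrN opprB.
  - by rewrite (@ler0_norm _ (c - a)) ?(@ler0_norm _ (b - a)) ?subr_le0 ?ltW//; lra.
  - by rewrite (@ger0_norm _ (c - b)) ?(@ler0_norm _ (b - a)) ?subr_ge0 ?subr_le0 ?ltW//; lra.
- have [|c /[!in_itv]/= /andP[ac cb] E] := MVT ab (fun x _ => df x).
    exact: continuous_subspaceT.
  exists c; split => //.
  - by rewrite (@ger0_norm _ (c - a)) ?(@ger0_norm _ (b - a)) ?subr_ge0 ?ltW//; lra.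
  - by rewrite (@ler0_norm _ (c - b)) ?(@ger0_norm _ (b - a)) ?subr_ge0 ?subr_le0 ?ltW//; lra.
Qed.

Lemma mean_value_le f f' K a b : (forall x : R, is_derive x 1 f (f' x)) ->
  (forall x, `|f' x| <= K) -> `|f a - f b| <= K * `|a - b|.
Proof.
move=> df f'K; have [c [_ _ ->]] := mean_value b a df.
by rewrite normrM ler_wpM2r.
Qed.

Lemma cos_lip (a b : R) : `|cos a - cos b| <= `|a - b|.
Proof.
rewrite -[leRHS]mul1r; apply: (mean_value_le a b (f' := fun x => - sin x)) => x.
by rewrite normrN sin_max.
Qed.

Lemma sin_lip (a b : R) : `|sin a - sin b| <= `|a - b|.
Proof.
rewrite -[leRHS]mul1r; apply: (mean_value_le a b (f' := fun x => cos x)) => x.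
by rewrite cos_max.
Qed.

Lemma cos_taylor (a y : R) : `|cos (a + y) - cos a + y * sin a| <= y ^+ 2.
Proof.
have df (x : R) : is_derive x 1 (fun y => cos (a + y) + y * sin a) (- sin (a + x) + sin a).
  by apply: is_derive_eq; rewrite /GRing.scale/=; ring.
have [c [cy _]] := mean_value 0 y df.
rewrite !subr0 addr0 mul0r addr0 in cy *; rewrite addrAC => ->.
rewrite normrM -[leRHS]ger0_norm ?sqr_ge0// expr2 normrM ler_wpM2r//.
rewrite addrC (le_trans (sin_lip _ _))// opprD addrA subrr sub0r normrN//.
Qed.

Lemma sin_taylor (y : R) : `|sin y - y| <= y ^+ 2.
Proof.
have := cos_taylor (- (pi / 2)) y; rewrite (addrC _ y) cosBpihalf cosN cos_pihalf subr0.
by rewrite sinN sin_pihalf mulrN1.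
Qed.

Lemma sin_le_id (y : R) : `|sin y| <= `|y|.
Proof. by have := sin_lip y 0; rewrite sin0 !subr0. Qed.

(** [L sin(x/L)] is the bounded substitute for the identity used in every
    truncation below; here [L = n + 1]. *)
Definition trunc (n : nat) (x : R) : R := n.+1%:R * sin (x / n.+1%:R).

Lemma trunc_le n x : `|trunc n x| <= `|x|.
Proof.
rewrite /trunc normrM (le_trans (ler_wpM2l _ (sin_le_id _)))//.
by rewrite normrM mulrCA normfV divff ?mulr1// normr_eq0.
Qed.

Lemma trunc_bound n x : `|trunc n x| <= n.+1%:R.
Proof. by rewrite /trunc normrM normr_nat ler_piMr// sin_max. Qed.

Lemma cvg_div_nat (x : R) : x / n.+1%:R @[n --> \oo] --> 0.
Proof. by rewrite -[X in _ --> X](mulr0 x); apply: cvgMr; exact: cvg_harmonic. Qed.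

Lemma trunc_cvg x : trunc n x @[n --> \oo] --> x.
Proof.
apply/subr_cvg0; apply: norm_cvg0.
apply: (@squeeze_cvgr _ _ _ _ (cst 0) (fun n => x ^+ 2 / n.+1%:R)).
- apply: nearW => n; rewrite normr_ge0/= /trunc.
  have nz : n.+1%:R != 0 :> R by [].
  rewrite (_ : _ - x = n.+1%:R * (sin (x / n.+1%:R) - x / n.+1%:R)); last by field.
  rewrite normrM normr_nat (le_trans (ler_wpM2l _ (sin_taylor _)))//.
  by rewrite le_eqVlt; apply/orP; left; apply/eqP; field.
- exact: cvg_cst.
- exact: cvg_div_nat.
Qed.

Lemma cos_trunc_cvg (x : R) : cos (x / n.+1%:R) @[n --> \oo] --> (1 : R).
Proof.
by have := cvg_comp _ _ (cvg_div_nat x) (@continuous_cos R 0); rewrite cos0.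
Qed.

Lemma is_derive_trunc n (x : R) : is_derive x 1 (trunc n) (cos (x / n.+1%:R)).
Proof.
rewrite /trunc; apply: is_derive_eq; rewrite /GRing.scale/=.
have nz : n.+1%:R != 0 :> R by []. by field.
Qed.

End real_calculus.

Section density.
Import HBNNSimple.
Context d (T : measurableType d) (R : realType).
Variables (m1 m2 : {measure set T -> \bar R}) (g : T -> R).
Hypothesis g_ge0 : forall x, 0 <= g x.
Hypothesis g_meas : measurable_fun setT g.
Hypothesis m2E : forall A, measurable A -> m2 A = (\int[m1]_(x in A) (g x)%:E)%E.
Local Open Scope ereal_scope.

(** By monotone convergence from simple functions, for which it is the hypothesis
    [m2E] summed over the fibres. *)
Lemma ge0_integral_density (f : T -> \bar R) : (forall x, 0 <= f x) ->
  measurable_fun setT f -> \int[m2]_x f x = \int[m1]_x (f x * (g x)%:E).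
Proof.
move=> f0 mf; pose h := nnsfun_approx measurableT mf.
have mg : measurable_fun setT (EFin \o g) by exact/measurable_EFinP.
have -> : \int[m2]_x f x = lim (\int[m2]_x (h n x)%:E @[n --> \oo]).
  have fE x : f x = lim ((h n x)%:E @[n --> \oo]).
    by apply/esym/cvg_lim => //; exact: cvg_nnsfun_approx.
  under eq_integral do rewrite fE.
  apply: monotone_convergence => //.
  - by move=> n; apply/measurable_EFinP; exact/measurable_funP.
  - by move=> n x _ //=; rewrite lee_fin.
  - by move=> x _ a b ab; rewrite lee_fin; exact/lefP/nd_nnsfun_approx.
have -> : \int[m1]_x (f x * (g x)%:E) =
    lim (\int[m1]_x ((h n x)%:E * (g x)%:E) @[n --> \oo]).
  have fg x : f x * (g x)%:E = lim ((h n x)%:E * (g x)%:E @[n --> \oo]).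
    by apply/esym/cvg_lim => //; apply: cvgeZr => //; exact: cvg_nnsfun_approx.
  under eq_integral do rewrite fg.
  apply: monotone_convergence => [//| | |].
  - by move=> n; apply/emeasurable_funM => //; exact/measurable_EFinP.
  - by move=> n x _ /=; rewrite mule_ge0 ?lee_fin.
  - move=> x _ a b ab/=; rewrite lee_wpmul2r ?lee_fin ?g_ge0//.
    exact/lefP/nd_nnsfun_approx.
suff suf n : \int[m1]_x ((h n x)%:E * (g x)%:E) = \int[m2]_x (h n x)%:E.
  by congr (limn _); apply/funext => n; rewrite suf.
transitivity (\int[m2]_x
   (\sum_(y \in range (h n)) (y * \1_(h n @^-1` [set y]) x)%:E)); last first.
  by apply: eq_integral => t tE; rewrite /= fimfunE -fsumEFin.
have indich m r : measurable_fun setT (fun x => (r * \1_(h m @^-1` [set r]) x)%:E).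
  by apply: (measurable_comp measurableT) => //; exact: measurable_funM.
rewrite ge0_integral_fsum//; last by move=> m y Ey; exact: nnfun_muleindic_ge0.
transitivity (\int[m1]_x (\sum_(y \in range (h n))
    (y * \1_(h n @^-1` [set y]) x)%:E * (g x)%:E)).
  under [RHS]eq_integral => x xE.
    rewrite -ge0_mule_fsuml => [|y]; last exact: nnfun_muleindic_ge0.
    rewrite fsumEFin // -(fimfunE _ x); over.
  by [].
rewrite ge0_integral_fsum//; last 2 first.
  - by move=> y; apply: emeasurable_funM.
  - move=> y x _; rewrite mule_ge0//; first exact: nnfun_muleindic_ge0.
    by rewrite lee_fin.
apply: eq_fsbigr => r rhn.
under [RHS]eq_integral do rewrite EFinM.
rewrite integralZl_indic_nnsfun => //.
under eq_integral do rewrite EFinM -muleA.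
rewrite ge0_integralZl//.
- under eq_integral do rewrite muleC.
  rewrite (eq_integral ((EFin \o g) \_ (h n @^-1` [set r]))); last first.
    by move=> x xE; rewrite epatch_indic.
  by rewrite -integral_mkcond -m2E// integral_indic// setIT.
- by apply: emeasurable_funM => //; exact/measurable_EFinP.
- by move=> t Et; rewrite mule_ge0 ?lee_fin.
- by move: rhn; rewrite inE => -[t _ <-]; rewrite lee_fin.
Qed.

Lemma integrable_density (f : T -> R) : measurable_fun setT f ->
  m2.-integrable setT (EFin \o f) <-> m1.-integrable setT (fun x => (f x * g x)%:E).
Proof.
move=> mf; have E : \int[m2]_x `|(f x)%:E| = \int[m1]_x `|(f x * g x)%:E|.
  rewrite ge0_integral_density//; last by apply/measurable_EFinP; exact: measurableT_comp.
  by apply: eq_integral => x _; rewrite EFinM abseM (@gee0_abs _ (g x)%:E)// lee_fin.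
split => /integrableP[_ fi]; apply/integrableP; split.
- by apply/measurable_EFinP; exact: measurable_funM.
- by rewrite -E.
- exact/measurable_EFinP.
- by rewrite /= E.
Qed.

Lemma integral_density (f : T -> R) : measurable_fun setT f ->
  \int[m2]_x (f x)%:E = \int[m1]_x (f x * g x)%:E.
Proof.
move=> mf; rewrite integralE [RHS]integralE.
rewrite !ge0_integral_density//; last 2 first.
  by apply: measurable_funeneg; exact/measurable_EFinP.
  by apply: measurable_funepos; exact/measurable_EFinP.
congr (_ - _); apply: eq_integral => x _.
- by rewrite !funeposE EFinM maxeMl ?lee_fin// mul0e.
- rewrite !funenegE EFinM -mulNe maxeMl ?lee_fin// mul0e//.
Qed.

End density.

Section normal_law.
Context {R : realType}.
Variables (s : R).
Hypothesis s_gt0 : 0 < s.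
Let p := normal_pdf (0 : R) s.
Let lebesgue := @lebesgue_measure R.

Let s_neq0 : s != 0. Proof. by rewrite gt_eqF. Qed.

Let pE x : p x = normal_peak s * expR (- (x ^+ 2) / (s ^+ 2 *+ 2)).
Proof. by rewrite /p normal_pdfE// /normal_fun subr0. Qed.

Let p_ge0 x : 0 <= p x. Proof. exact: normal_pdf_ge0. Qed.

Let mp : measurable_fun setT p. Proof. exact: measurable_normal_pdf. Qed.

Lemma is_derive_normal_pdf (x : R) : is_derive x 1 p (- (x / s ^+ 2) * p x).
Proof.
rewrite (_ : p = fun x => normal_peak s * expR (- (x ^+ 2) / (s ^+ 2 *+ 2))); last first.
  by apply/funext => y; exact: pE.
apply: is_derive_eq; rewrite /GRing.scale/= -mulr_natl.
by field; rewrite s_neq0.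
Qed.

Lemma normal_prob_L1 (f : R -> R) : measurable_fun setT f ->
  L1 (normal_prob 0 s) f <-> lebesgue.-integrable setT (fun x => (f x * p x)%:E).
Proof. by move=> mf; apply: integrable_density. Qed.

Lemma normal_prob_expect (f : R -> R) : measurable_fun setT f ->
  (\int[normal_prob 0 s]_x (f x)%:E = \int[lebesgue]_x (f x * p x)%:E)%E.
Proof. by move=> mf; apply: integral_density. Qed.

(** The fourth power is absorbed by the wider Gaussian of deviation [2 s]. *)
Lemma normal_fourth_moment : L1 (normal_prob 0 s) (fun x => x ^+ 4).
Proof.
have s2 : 2 * s != 0 by rewrite mulf_neq0.
apply/normal_prob_L1; first exact: exprn_measurable.
pose q := normal_pdf (0 : R) (2 * s).
have qi : lebesgue.-integrable setT (EFin \o (fun x => 128 * s ^+ 4 * q x)).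
  rewrite (_ : EFin \o _ = fun x => ((128 * s ^+ 4)%:E * (q x)%:E)%E)//.
  by apply: integrableZl => //; exact: integrable_normal_pdf.
apply: (le_integrable measurableT _ _ qi).
  by apply/measurable_EFinP; apply: measurable_funM => //; exact: exprn_measurable.
move=> x _; rewrite /= lee_fin ger0_norm; last first.
  by rewrite mulr_ge0// exprn_even_ge0.
rewrite (le_trans _ (ler_norm _))// /q normal_pdfE// /normal_fun subr0 pE.
have peakE : normal_peak s = 2 * normal_peak (2 * s).
  rewrite /normal_peak (_ : (2 * s) ^+ 2 * pi *+ 2 = 2 ^+ 2 * (s ^+ 2 * pi *+ 2)).
    rewrite sqrtrM ?sqr_ge0// sqrtr_sqr ger0_norm// invfM mulrA divff// mul1r//.
  by rewrite exprMn -mulrA mulrnAr.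
rewrite peakE; set a := normal_peak (2 * s).
have a0 : 0 <= a by exact: normal_peak_ge0.
pose y := x ^+ 2 / (4 * s ^+ 2).
have y0 : 0 <= y by apply: divr_ge0; [exact: sqr_ge0|apply: mulr_ge0 => //; exact: sqr_ge0].
have -> : - x ^+ 2 / (s ^+ 2 *+ 2) = - y - y.
  by rewrite /y -mulr_natl; field; rewrite s_neq0.
have -> : - x ^+ 2 / ((2 * s) ^+ 2 *+ 2) = - y / 2.
  by rewrite /y -mulr_natl; field; rewrite s_neq0.
have -> : x ^+ 4 = 16 * s ^+ 4 * y ^+ 2 by rewrite /y; field; rewrite s_neq0.
have e1 : expR (- y - y) <= expR (- y) * expR (- y / 2).
  by rewrite -expRD ler_expR; lra.
have e2 : y ^+ 2 * expR (- y) <= 4.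
  rewrite expRN ler_pdivrMr ?expR_gt0//.
  have -> : expR y = expR (y / 2) ^+ 2 by rewrite expr2 -expRD; congr expR; lra.
  have := expR_ge1Dx (y / 2); have := expR_gt0 (y / 2); nra.
apply: (@le_trans _ _ (32 * s ^+ 4 * a * (y ^+ 2 * (expR (- y) * expR (- y / 2))))).
  rewrite [leLHS](_ : _ = 32 * s ^+ 4 * a * (y ^+ 2 * expR (- y - y))); last by ring.
  rewrite ler_wpM2l// ?ler_wpM2l ?sqr_ge0//.
  by rewrite mulr_ge0// mulr_ge0// exprn_even_ge0.
rewrite [leRHS](_ : _ = 32 * s ^+ 4 * a * (4 * expR (- y / 2))); last by ring.
rewrite ler_wpM2l//; first by rewrite mulr_ge0// mulr_ge0// exprn_even_ge0.
by rewrite mulrA ler_wpM2r ?expR_ge0.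
Qed.

Lemma normal_L2 : L2 (normal_prob 0 s) (fun x => x).
Proof.
split => //; apply: (L1_le (G := fun x : measurableTypeR R => 1 + x ^+ 4)).
- exact: exprn_measurable.
- by apply: L1D; [exact: L1_cst|exact: normal_fourth_moment].
- by move=> x; rewrite ger0_norm ?sqr_ge0//; nra.
Qed.

Let pdf_tail A n : 0 <= A -> forall x, `|x| = n.+1%:R ->
  A * (1 + `|x|) * p x <= A * normal_peak s * (4 * s ^+ 2) / n.+1%:R.
Proof.
move=> A0 x xn; rewrite pE -(real_normK (num_real x)) xn.
have n1 : 1 <= n.+1%:R :> R by rewrite ler1n.
set N := n.+1%:R; have N0 : 0 < N by exact: lt_le_trans n1.
have pk := normal_peak_ge0 s.
have s20 : 0 < s ^+ 2 *+ 2 by rewrite pmulrn_lgt0// exprn_gt0.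
have e : expR (- N ^+ 2 / (s ^+ 2 *+ 2)) <= (s ^+ 2 *+ 2) / N ^+ 2.
  rewrite mulNr expRN -[leRHS]invrK lef_pV2 ?posrE ?expR_gt0 ?invr_gt0 ?divr_gt0 ?exprn_gt0//.
  rewrite invf_div (le_trans _ (expR_ge1Dx _))//; lra.
rewrite (@le_trans _ _ (A * (N + N) * (normal_peak s * ((s ^+ 2 *+ 2) / N ^+ 2))))//.
  rewrite ler_pM ?mulr_ge0 ?expR_ge0 ?addr_ge0 ?(ltW N0)//.
  - by rewrite ler_wpM2l// lerD2r.
  - by rewrite ler_wpM2l.
by rewrite le_eqVlt; apply/orP; left; apply/eqP; rewrite -mulr_natl; field; rewrite gt_eqF.
Qed.

(** Integrate the derivative of [G p] over [-n, n] and let [n] go to infinity. *)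
Lemma normal_ibp (G G' : R -> R) A : 0 <= A ->
  (forall x : R, is_derive x 1 G (G' x)) -> continuous G' ->
  (forall x, `|G x| <= A * (1 + `|x|)) -> (forall x, `|G' x| <= A) ->
  expect (normal_prob 0 s) (fun x => x * G x) =
  s ^+ 2 * expect (normal_prob 0 s) G'.
Proof.
move=> A0 dG cG' GA G'A.
have cG : continuous G := is_derive_continuous dG.
have mG : measurable_fun setT G by exact: continuous_measurable_fun.
have mG' : measurable_fun setT G' by exact: continuous_measurable_fun.
pose m := [the probability _ _ of normal_prob (0 : R) s].
have iG' : L1 m G' by apply: L1_Bm; split => //; exists A.
have ixG : L1 m (fun x => x * G x).
  apply: (L1_le (G := fun x : measurableTypeR R => A * (1 + x ^+ 2 + x ^+ 2))).
  - exact: measurable_funM.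
  - have [_ i2] := normal_L2.
    by apply: L1Z; apply: L1D => //; apply: L1D => //; exact: L1_cst.
  - move=> x; rewrite normrM mulrC (le_trans (ler_wpM2r _ (GA x)))// -mulrA ler_wpM2l//.
    rewrite -(real_normK (num_real x)); nra.
pose H x := G x * p x.
pose h x := (G' x - x * G x / s ^+ 2) * p x.
have dH (x : R) : is_derive x 1 H (h x).
  have := is_derive_normal_pdf x => dp.
  apply: is_derive_eq; rewrite /GRing.scale/= /h; ring.
have mid : measurable_fun setT (fun x => G' x - x * G x / s ^+ 2).
  by apply: measurable_funB => //; apply: measurable_funM => //; exact: measurable_funM.
have ch : continuous h.
  move=> x; apply: cvgM; last exact: continuous_normal_pdf.
  apply: cvgB; first exact: cG'.
  by apply: cvgM; [apply: cvgM; [exact: cvg_id|exact: cG]|exact: cvg_cst].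
have imid : L1 m (fun x => G' x - x * G x / s ^+ 2).
  apply: L1B => //; under [X in L1 _ X]eq_fun do rewrite mulrC.
  exact: L1Z.
have ih : lebesgue.-integrable setT (EFin \o h) by exact/normal_prob_L1.
suff h0 : (\int[lebesgue]_x (h x)%:E = 0)%E.
  have : expect m (fun x => G' x - x * G x / s ^+ 2) = 0.
    by rewrite /expect /Rintegral normal_prob_expect// h0.
  rewrite expectB//; last first.
    under [X in L1 _ X]eq_fun do rewrite mulrC; exact: L1Z.
  under [X in _ - expect _ X]eq_fun do rewrite mulrC.
  rewrite expectZ// => /eqP; rewrite subr_eq0 => /eqP ->.
  by rewrite mulrA divff ?mul1r// sqrf_eq0.
pose I n : set R := `[- n.+1%:R, n.+1%:R]%classic.
have intI n : (\int[lebesgue]_(x in I n) (h x)%:E = (H n.+1%:R - H (- n.+1%:R))%:E)%E.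
  rewrite EFinB; apply: continuous_FTC2.
  - by rewrite gtrN.
  - exact: continuous_subspaceT.
  - split; [by move=> x _; apply: ex_derive|..].
    + apply: cvg_at_right_filter; exact: (is_derive_continuous dH).
    + apply: cvg_at_left_filter; exact: (is_derive_continuous dH).
  - by move=> x _; rewrite derive1E; apply: derive_val.
have cv1 : (\int[lebesgue]_x ((h \_ (I n)) x)%:E @[n --> \oo] -->
            \int[lebesgue]_x (h x)%:E)%E.
  have mh : measurable_fun setT h by exact: continuous_measurable_fun.
  have [] := @dominated_convergence _ _ _ lebesgue setT measurableT
    (fun n => EFin \o (h \_ (I n))) (EFin \o h) (fun x => (`|h x|)%:E) => //.
  - move=> n; apply/measurable_EFinP.
    by apply/(measurable_restrictT _ (measurable_itv _)); exact: measurable_funTS.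
  - exact/measurable_EFinP.
  - apply: aeW => x _; apply: cvg_near_cst; near=> n; rewrite /= patchE mem_set//.
    rewrite /I/= in_itv/= -ler_norml.
    have : `|x| <= n%:R by near: n; exact: nbhs_infty_ger.
    by move=> /le_trans; apply; rewrite ler_nat.
  - exact: integrable_norm.
  - apply: aeW => x n _; rewrite /= lee_fin patchE; case: ifPn => // _.
    by rewrite normr0.
have cv2 : (\int[lebesgue]_x ((h \_ (I n)) x)%:E @[n --> \oo] --> 0)%E.
  have E n : (\int[lebesgue]_x ((h \_ (I n)) x)%:E = (H n.+1%:R - H (- n.+1%:R))%:E)%E.
    by rewrite -intI [RHS]integral_mkcond; under [RHS]eq_integral do rewrite restrict_EFin.
  under eq_fun do rewrite E.
  apply: cvg_EFin; first exact: nearW.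
  pose B := A * normal_peak s * (4 * s ^+ 2).
  have HB n x : `|x| = n.+1%:R -> `|H x| <= B / n.+1%:R.
    move=> xn; rewrite (le_trans _ (pdf_tail A0 xn))// /H normrM.
    by rewrite (ger0_norm (p_ge0 _)) ler_wpM2r.
  apply: norm_cvg0; apply: (@squeeze_cvgr _ _ _ _ (cst 0) (fun n => (2 * B) / n.+1%:R)).
  - apply: nearW => n; rewrite normr_ge0/= (le_trans (ler_normB _ _))//.
    have h1 := @HB n n.+1%:R (normr_nat _ _).
    have h2 : `|H (- n.+1%:R)| <= B / n.+1%:R by apply: HB; rewrite normrN normr_nat.
    by rewrite (_ : 2 * B / n.+1%:R = B / n.+1%:R + B / n.+1%:R); [exact: lerD|ring].
  - exact: cvg_cst.
  - exact: cvg_div_nat.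
exact: (cvg_unique _ cv1 cv2).
Unshelve. all: end_near. Qed.

End normal_law.

Section gaussian_law.
Context d (T : measurableType d) {R : realType} (mu : probability T R) (Y : T -> R).
Hypothesis mY : measurable_fun setT Y.

Let transfer (m : probability (measurableTypeR R) R) :
  (forall A : set (measurableTypeR R), measurable A -> pushforward mu Y A = m A) ->
  forall F : R -> R, measurable_fun setT F -> L1 m F ->
  L1 mu (F \o Y) /\ expect mu (F \o Y) = expect m F.
Proof.
move=> law F mF iF.
have mY' : @measurable_fun _ _ T (measurableTypeR R) setT Y := mY.
pose Yp : {mfun T >-> measurableTypeR R} := HB.pack Y (isMeasurableFun.Build _ _ _ _ _ mY').
have E (f : measurableTypeR R -> \bar R) :
  (\int[@pushforward _ _ T (measurableTypeR R) R mu Y]_x f x = \int[m]_x f x)%E.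
  apply: (@eq_measure_integral _ (measurableTypeR R) R setT m (pushforward mu Yp) f).
  by move=> A mA _; exact: law.
have mFE : measurable_fun setT (EFin \o F) by exact/measurable_EFinP.
have iFY : L1 mu (F \o Y).
  have /integrableP[_ fi] := iF; apply/integrableP; split.
    by apply: (measurableT_comp mFE).
  rewrite -E ge0_integral_pushforward// in fi.
  exact: (measurableT_comp _ mFE).
by split => //; rewrite /expect /Rintegral -E integral_pushforward.
Qed.

(** Stein's identity against waves, which characterises the centered Gaussian
    laws; it also holds for the degenerate one. *)
Lemma centered_gaussian_stein : centered_gaussian_law (pushforward mu Y) ->
  L1 mu (fun x => Y x ^+ 4) /\
  forall t c, expect mu (fun x => Y x * sin (t * Y x + c)) =
    expect mu (fun x => Y x ^+ 2) * (t * expect mu (fun x => cos (t * Y x + c))).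
Proof.
move=> [[s s0 law]|law].
- have tr := transfer (m := [the probability _ _ of normal_prob (0 : R) s]) law.
  have tr1 F mF iF := (tr F mF iF).1; have tr2 F mF iF := (tr F mF iF).2.
  have [mid i2] := normal_L2 s0.
  have wave g t c : continuous g -> (forall x, `|g x| <= 1) ->
      @Bm _ (measurableTypeR R) R (fun x => g (t * x + c)).
    move=> cg g1; split; last by exists 1 => x; exact: g1.
    apply: continuous_measurable_fun => x; apply: continuous_comp; last exact: cg.
    by apply: cvgD; [apply: cvgM; [exact: cvg_cst|exact: cvg_id]|exact: cvg_cst].
  split; first by apply: (tr1 (fun x => x ^+ 4)); [exact: exprn_measurable|exact: normal_fourth_moment].
  move=> t c.
  have bs := wave (@sin R) t c (@continuous_sin R) (@sin_max R).
  have bc := wave (@cos R) t c (@continuous_cos R) (@cos_max R).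
  rewrite (tr2 (fun x => x * sin (t * x + c))); first last.
  - by apply: L1MB => //; apply: L2_L1; exact: normal_L2.
  - by apply: measurable_funM => //; case: bs.
  have e2 : expect mu (fun x => Y x ^+ 2) = s ^+ 2.
    rewrite (tr2 (fun x => x ^+ 2) (exprn_measurable 2) i2).
    have := @normal_ibp R s s0 id (fun=> 1) 1 ler01 (fun x => is_derive_id _ _).
    rewrite expect_cst mulr1 => <-//.
    - by move=> x; exact: cvg_cst.
    - by move=> x; rewrite mul1r lerDr.
    - by move=> x; rewrite normr1.
  rewrite e2 (tr2 (fun x => cos (t * x + c))); [|by case: bc|exact: L1_Bm].
  rewrite -expectZ; last exact: L1_Bm.
  apply: (normal_ibp s0 (G := fun x => sin (t * x + c))
    (G' := fun x => t * cos (t * x + c)) (A := 1 + `|t|)).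
  - by rewrite addr_ge0.
  - move=> x; apply: is_derive_eq; rewrite /GRing.scale/=; ring.
  - move=> x; apply: cvgM; first exact: cvg_cst.
    apply: continuous_comp; last exact: continuous_cos.
    by apply: cvgD; [apply: cvgM; [exact: cvg_cst|exact: cvg_id]|exact: cvg_cst].
  - move=> x; rewrite (le_trans (sin_max _))// -[leLHS]mulr1 ler_pM//.
      by rewrite lerDl.
    by rewrite lerDl.
  - move=> x; rewrite normrM (le_trans (ler_wpM2l _ (cos_max _)))//.
    by rewrite mulr1 lerDr.
- pose m0 := [the probability (measurableTypeR R) R of \d_(0 : measurableTypeR R)].
  have tr := @transfer m0 law.
  have dir (F : measurableTypeR R -> R) : measurable_fun setT F -> L1 m0 F.
    move=> mF; apply/integrableP; split; first exact/measurable_EFinP.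
    rewrite integral_dirac//; last by apply/measurable_EFinP; exact: measurableT_comp.
    by rewrite diracT mul1e ltry.
  have tr1 F mF := (tr F mF (dir F mF)).1.
  have tr2 (F : R -> R) (mF : measurable_fun setT F) : expect mu (F \o Y) = F 0.
    rewrite (tr F mF (dir F mF)).2 /expect /Rintegral /m0 integral_dirac//.
      by rewrite diracT mul1e.
    exact/measurable_EFinP.
  split; first by apply: (tr1 (fun x => x ^+ 4)); exact: exprn_measurable.
  move=> t c; rewrite (tr2 (fun x => x * sin (t * x + c))); last first.
    apply: continuous_measurable_fun => x; apply: cvgM; first exact: cvg_id.
    apply: continuous_comp; last exact: continuous_sin.
    by apply: cvgD; [apply: cvgM; [exact: cvg_cst|exact: cvg_id]|exact: cvg_cst].
  rewrite (tr2 (fun x => x ^+ 2)); last exact: exprn_measurable.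
  by rewrite expr0n/= !mul0r.
Qed.

End gaussian_law.

(** * Directional derivatives and smooth functions *)

Section directional_derivatives.
Context {R : realType} {U : completeNormedModType R}.
Implicit Types (F G : U -> R) (u v w : U).

(** Bounded Lipschitz, with one constant for both: an algebra of Borel functions
    on which uniform bounds and moduli of continuity are kept together. *)
Definition BL F := exists K : R, (forall u, `|F u| <= K) /\
  forall u v, `|F u - F v| <= K * `|u - v|.

Definition dd v F F' := forall u, is_derive u v F (F' u : R).

Lemma BL_ge0 F : BL F -> exists K : R, [/\ 0 <= K, forall u, `|F u| <= K &
  forall u v, `|F u - F v| <= K * `|u - v|].
Proof. by move=> [K [FK FL]]; exists K; split => //; apply: le_trans (FK 0). Qed.

Lemma BL_cst k : BL (fun=> k).
Proof.
exists `|k|; split => // u v; by rewrite subrr normr0 mulr_ge0.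
Qed.

Lemma BLD F G : BL F -> BL G -> BL (fun u => F u + G u).
Proof.
move=> [K [FK FL]] [L [GL GL']]; exists (K + L); split => [u|u v].
  by rewrite (le_trans (ler_normD _ _))// lerD.
rewrite (_ : _ - _ = (F u - F v) + (G u - G v)); last by ring.
by rewrite (le_trans (ler_normD _ _))// mulrDl lerD.
Qed.

Lemma BLM F G : BL F -> BL G -> BL (fun u => F u * G u).
Proof.
move=> /BL_ge0[K [K0 FK FL]] /BL_ge0[L [L0 GL GL']].
exists (K * L + K * L); split => [u|u v].
  rewrite normrM (le_trans (ler_pM _ _ (FK u) (GL u)))// lerDl mulr_ge0//.
rewrite (_ : _ - _ = F u * (G u - G v) + (F u - F v) * G v); last by ring.
rewrite (le_trans (ler_normD _ _))// [leRHS]mulrDl lerD// normrM.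
  by rewrite -mulrA ler_pM.
by rewrite mulrAC ler_pM// mulr_ge0.
Qed.

Lemma BL_comp (g : R -> R) (Y : U -> R) K L : 0 <= L ->
  (forall x, `|g x| <= K) -> (forall x y, `|g x - g y| <= L * `|x - y|) ->
  (forall u v, `|Y u - Y v| <= K * `|u - v|) -> BL (fun u => g (Y u)).
Proof.
move=> L0 gK gL YK; exists (K + L * K); split => [u|u v].
  have K0 : 0 <= K by apply: le_trans (gK 0).
  by rewrite (le_trans (gK _))// lerDl mulr_ge0.
have K0 : 0 <= K by apply: le_trans (gK 0).
rewrite (le_trans (gL _ _))// (le_trans (ler_wpM2l L0 (YK _ _)))//.
by rewrite mulrA ler_wpM2r// lerDr.
Qed.

Lemma lip_continuous F K : (forall u v, `|F u - F v| <= K * `|u - v|) -> continuous F.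
Proof.
move=> FK u; apply/cvgrPdist_le => e e0.
have K1 : 0 < `|K| + 1 by rewrite ltr_wpDl.
near=> v; rewrite (le_trans (FK _ _))//.
rewrite (@le_trans _ _ ((`|K| + 1) * `|u - v|))//.
  by rewrite ler_wpM2r// (le_trans (ler_norm _))// lerDl.
rewrite mulrC -ler_pdivlMr//; near: v.
by apply: cvgr_dist_le; [exact: cvg_id|rewrite divr_gt0].
Unshelve. all: end_near. Qed.

Lemma continuous_borel F : continuous F ->
  measurable_fun setT (F : borel U -> R).
Proof.
move=> /continuousP cF; apply: (measurability _ (RGenOpens.measurableE R)).
move=> _ [_ [a [b ->] <-]]; rewrite setTI.
by apply: sub_sigma_algebra; exact/cF/interval_open.
Qed.

Lemma BL_measurable F : BL F -> measurable_fun setT (F : borel U -> R).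
Proof. by move=> [K [_ FL]]; apply: continuous_borel; exact: lip_continuous FL. Qed.

Lemma BL_Bm F : BL F -> Bm (F : borel U -> R).
Proof. by move=> bF; split; [exact: BL_measurable|case: bF => K [? _]; exists K]. Qed.

(** A directional derivative is an ordinary derivative along a line, which gives
    access to the mean value theorem and to the one-variable chain rule. *)
Lemma dd_lineE F u v a : is_derive u v F a <->
  is_derive (0 : R) 1 (fun t => F (u + t *: v)) a.
Proof.
have E : (fun h : R => h^-1 *: ((F \o shift u) (h *: v) - F u)) =
   (fun h : R => h^-1 *: (((fun t => F (u + t *: v)) \o shift 0) (h *: 1) -
      (fun t => F (u + t *: v)) 0)).
  by apply/funext => h /=; rewrite scale0r !addr0 [h *: v + u]addrC /GRing.scale/= mulr1.
split => -[da Da]; split.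
- by rewrite /derivable -E.
- by rewrite -Da /derive -E.
- by rewrite /derivable E.
- by rewrite -Da /derive E.
Qed.

Lemma dd_line v F F' u (t : R) : dd v F F' ->
  is_derive t 1 (fun t => F (u + t *: v)) (F' (u + t *: v)).
Proof.
move=> dF; have /dd_lineE d0 := dF (u + t *: v).
rewrite (_ : (fun t => _) =
  (fun s => F (u + t *: v + s *: v)) \o (fun s => s - t)); last first.
  by apply/funext => s /=; rewrite -addrA -scalerDl [t + _]addrC subrK.
rewrite -[X in is_derive _ _ _ X]mulr1.
apply: is_derive1_comp; first by rewrite subrr.
by apply: is_derive_eq; rewrite subr0.
Qed.

Lemma pd_eq v F F' : dd v F F' -> 'D_v F = F'.
Proof. by move=> dF; apply/funext => u; exact: (derive_val (is_derive := dF u)). Qed.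

Lemma dd_cst v k : dd v (fun=> k) (fun=> 0).
Proof. by move=> u; exact: is_derive_cst. Qed.

Lemma ddD v F G F' G' : dd v F F' -> dd v G G' ->
  dd v (fun u => F u + G u) (fun u => F' u + G' u).
Proof. by move=> dF dG u; apply: (is_deriveD (f := F) (g := G)). Qed.

Lemma ddM v F G F' G' : dd v F F' -> dd v G G' ->
  dd v (fun u => F u * G u) (fun u => F u * G' u + F' u * G u).
Proof.
move=> dF dG u; have := is_deriveM (dF u) (dG u).
by rewrite /GRing.scale/= [G u * _]mulrC.
Qed.

Lemma ddZ v k F F' : dd v F F' -> dd v (fun u => k * F u) (fun u => k * F' u).
Proof.
move=> dF u; have := ddM (dd_cst v k) dF u.
by rewrite mul0r addr0.
Qed.

Lemma dd_sum v I (s : seq I) (F F' : I -> U -> R) : (forall i, dd v (F i) (F' i)) ->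
  dd v (fun u => \sum_(i <- s) F i u) (fun u => \sum_(i <- s) F' i u).
Proof.
move=> dF; elim: s => [|i s IHs].
  have -> : (fun u => \sum_(i <- [::]) F i u) = fun=> 0.
    by apply/funext => u; rewrite big_nil.
  by move=> u; rewrite big_nil; exact: dd_cst.
have -> : (fun u => \sum_(j <- i :: s) F j u) = fun u => F i u + \sum_(j <- s) F j u.
  by apply/funext => u; rewrite big_cons.
by move=> u; rewrite big_cons; exact: (ddD (dF i) IHs u).
Qed.

Lemma dd_comp v (g g' : R -> R) F F' : (forall u, is_derive (F u) 1 g (g' (F u))) ->
  dd v F F' -> dd v (fun u => g (F u)) (fun u => g' (F u) * F' u).
Proof.
move=> dg dF u; apply/dd_lineE; have /dd_lineE d0 := dF u.
have dg0 : is_derive (F (u + 0 *: v)) 1 g (g' (F u)) by rewrite scale0r addr0.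
exact: (is_derive1_comp dg0 d0).
Qed.

Lemma dd_mean_value v F F' u (s : R) : dd v F F' ->
  exists c, `|c| <= `|s| /\ F (u + s *: v) - F u = F' (u + c *: v) * s.
Proof.
move=> dF.
have [c []] := mean_value 0 s (fun t => dd_line u t dF).
by rewrite !subr0 scale0r addr0 => cs _ E; exists c.
Qed.

Lemma dd_lip F K : (forall v, exists2 F', dd v F F' & forall u, `|F' u| <= K * `|v|) ->
  forall u v, `|F u - F v| <= K * `|u - v|.
Proof.
move=> dF u v; have [F' dF' F'K] := dF (u - v).
have [c [_]] := dd_mean_value v 1 dF'.
by rewrite scale1r subrKC mulr1 => ->.
Qed.

(** A way to identify two Lipschitz functions at a point when they are only
    known to take a common value at points arbitrarily close to it. *)
Lemma lip_eq_at (A B : U -> R) (K L M : R) u :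
  (forall v w, `|A v - A w| <= L * `|v - w|) ->
  (forall v w, `|B v - B w| <= K * `|v - w|) -> 0 <= K -> 0 <= L -> 0 <= M ->
  (forall s, 0 < s -> exists p q,
    [/\ `|p - u| <= s * M, `|q - u| <= s * M & B p = A q]) -> A u = B u.
Proof.
move=> AL BK K0 L0 M0 near; apply/eqP; rewrite -subr_eq0 -normr_le0.
apply/ler_addgt0Pr => e e0; rewrite add0r.
set N := (K + L) * M + 1; have N0 : 0 < N by rewrite ltr_wpDl// mulr_ge0// addr_ge0.
have [p [q [pu qu pq]]] := near (e / N) (divr_gt0 e0 N0).
rewrite (_ : A u - B u = (A u - A q) + (B p - B u)); last by rewrite pq; ring.
have h1 : `|A u - A q| <= L * (e / N * M).
  by rewrite (le_trans (AL _ _))// ler_wpM2l// distrC.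
have h2 : `|B p - B u| <= K * (e / N * M).
  by rewrite (le_trans (BK _ _))// ler_wpM2l.
rewrite (le_trans (ler_normD _ _))// (le_trans (lerD h1 h2))//.
rewrite [leRHS](_ : e = e / N * N); last by rewrite divfK// gt_eqF.
rewrite (_ : _ + _ = e / N * ((K + L) * M)); last by ring.
by rewrite ler_pM2l ?divr_gt0// /N lerDl.
Qed.

Section iterated.
Variable d : nat -> U.

(** Class [C^n_b] along the basis. Being Lipschitz in norm stands in for the
    continuity of the derivatives, as in Schwarz's theorem below. *)
Fixpoint Cn n F : Prop := if n isn't n'.+1 then BL F else
  BL F /\ forall k, dd (d k) F ('D_(d k) F) /\ Cn n' ('D_(d k) F).

Lemma Cn_BL n F : Cn n F -> BL F.
Proof. by case: n => [//|n] []. Qed.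

Lemma Cn_intro n F : BL F -> (forall k, exists2 F', dd (d k) F F' & Cn n F') ->
  Cn n.+1 F.
Proof.
move=> bF dF; split=> // k; have [F' dF' CF'] := dF k.
by rewrite (pd_eq dF').
Qed.

Lemma Cn_dd n F k : Cn n.+1 F -> dd (d k) F ('D_(d k) F).
Proof. by move=> [_ /(_ k)[]]. Qed.

Lemma Cn_pd n F k : Cn n.+1 F -> Cn n ('D_(d k) F).
Proof. by move=> [_ /(_ k)[]]. Qed.

Lemma CnS n F : Cn n.+1 F -> Cn n F.
Proof.
elim: n F => [|n IHn] F; first exact: Cn_BL.
move=> CF; split; first exact: (Cn_BL CF).
by move=> k; split; [exact: (Cn_dd k CF)|apply: IHn; exact: Cn_pd].
Qed.

Lemma Cn_cst n k : Cn n (fun=> k).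
Proof.
elim: n k => [|n IHn] k; first exact: BL_cst.
by apply: Cn_intro => [|j]; [exact: BL_cst|exists (fun=> 0); [exact: dd_cst|]].
Qed.

Lemma CnD n F G : Cn n F -> Cn n G -> Cn n (fun u => F u + G u).
Proof.
elim: n F G => [|n IHn] F G CF CG; first exact: BLD.
apply: Cn_intro => [|k]; first by apply: BLD; [exact: (Cn_BL CF)|exact: (Cn_BL CG)].
exists (fun u => 'D_(d k) F u + 'D_(d k) G u).
  exact: (ddD (Cn_dd k CF) (Cn_dd k CG)).
by apply: IHn; exact: Cn_pd.
Qed.

Lemma CnM n F G : Cn n F -> Cn n G -> Cn n (fun u => F u * G u).
Proof.
elim: n F G => [|n IHn] F G CF CG; first exact: BLM.
apply: Cn_intro => [|k]; first by apply: BLM; [exact: (Cn_BL CF)|exact: (Cn_BL CG)].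
exists (fun u => F u * 'D_(d k) G u + 'D_(d k) F u * G u).
  exact: (ddM (Cn_dd k CF) (Cn_dd k CG)).
by apply: CnD; apply: IHn; try exact: Cn_pd; exact: CnS.
Qed.

Lemma CnZ n k F : Cn n F -> Cn n (fun u => k * F u).
Proof. by move=> CF; apply: CnM => //; exact: Cn_cst. Qed.

Lemma CnN n F : Cn n F -> Cn n (fun u => - F u).
Proof. by move=> /(CnZ (-1)); under [X in Cn n X]eq_fun do rewrite mulN1r. Qed.

Lemma Cn_expR n F : Cn n F -> Cn n (fun u => expR (F u)).
Proof.
have bl G : BL G -> BL (fun u => expR (G u)).
  move=> /BL_ge0[K [K0 GK GL]].
  exists (expR (3 * K) + expR (3 * K) * K); split => [u|u v].
    apply: (@le_trans _ _ (expR (3 * K))); last by rewrite lerDl mulr_ge0 ?expR_ge0.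
    rewrite ger0_norm ?expR_ge0// ler_expR (le_trans (ler_norm _))//.
    by rewrite (le_trans (GK u))//; lra.
  have [c [cu _ ->]] := mean_value (G v) (G u) (fun x => is_derive_expR x).
  rewrite normrM (@le_trans _ _ (expR (3 * K) * (K * `|u - v|)))//; last first.
    by rewrite mulrA ler_wpM2r// lerDr expR_ge0.
  rewrite ler_pM// ger0_norm ?expR_ge0// ler_expR.
  have := GK u; have := GK v; move: cu; rewrite !ler_norml.
  have : `|G u - G v| <= K + K by rewrite (le_trans (ler_normB _ _))// lerD.
  lra.
elim: n F => [|n IHn] F CF; first exact: bl.
apply: Cn_intro => [|k]; first exact/bl/(Cn_BL CF).
exists (fun u => expR (F u) * 'D_(d k) F u).
  exact: (dd_comp (fun u => is_derive_expR (F u)) (Cn_dd k CF)).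
by apply: CnM; [apply: IHn; exact: CnS|exact: Cn_pd].
Qed.

Lemma Cn_inv n F e : 0 < e -> (forall u, e <= F u) -> Cn n F ->
  Cn n (fun u => (F u)^-1).
Proof.
move=> e0 Fe.
have F0 u : 0 < F u by exact: lt_le_trans (Fe u).
have bl : BL F -> BL (fun u => (F u)^-1).
  move=> /BL_ge0[K [K0 FK FL]].
  have iF u : `|(F u)^-1| <= e^-1.
    by have := F0 u => Fu0; rewrite gtr0_norm ?invr_gt0// lef_pV2 ?posrE.
  exists (e^-1 + e^-1 * K * e^-1); split => [u|u v].
    by rewrite (le_trans (iF u))// lerDl !mulr_ge0// invr_ge0 ltW.
  rewrite (_ : _ - _ = (F u)^-1 * (F v - F u) * (F v)^-1); last first.
    by field; rewrite !gt_eqF.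
  rewrite !normrM mulrDl ler_wpDl ?mulr_ge0 ?invr_ge0 ?(ltW e0)//.
  rewrite -[leRHS]mulrA [_^-1 * `|u - v|]mulrC mulrA ler_pM// -?mulrA.
  by rewrite ler_pM// distrC.
elim: n => [|n IHn] CF; first exact: bl.
apply: Cn_intro => [|k]; first exact/bl/(Cn_BL CF).
exists (fun u => - (F u) ^- 2 * 'D_(d k) F u).
  apply: (dd_comp (g := GRing.inv) (g' := fun x => - x ^- 2) _ (Cn_dd k CF)) => u.
  have := is_deriveV (f := id) (lt0r_neq0 (F0 u)) (is_derive_id (F u) 1).
  by rewrite /GRing.scale/= mulr1.
apply: CnM; last exact: Cn_pd.
apply: CnN; under [X in Cn n X]eq_fun do rewrite -exprVn expr2.
by apply: CnM; apply: IHn; exact: CnS.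
Qed.

Lemma Cn_trunc n Y K : (forall u v, `|Y u - Y v| <= K * `|u - v|) ->
  (forall k, exists2 Y', dd (d k) Y Y' & BL Y') ->
  Cn 1 (fun u => trunc n (Y u)).
Proof.
move=> YK dY.
have YK' : forall u v, `|Y u - Y v| <= (`|K| + n.+1%:R + 1) * `|u - v|.
  move=> u v; rewrite (le_trans (YK _ _))// ler_wpM2r//.
  by rewrite (le_trans (ler_norm _))// -addrA lerDl.
have bl : BL (fun u => trunc n (Y u)).
  apply: (@BL_comp _ _ _ 1 _ _ _ YK') => // [x|x y].
    by rewrite (le_trans (trunc_bound n x))// -addrA [leRHS]addrC -addrA lerDl.
  apply: (mean_value_le x y (is_derive_trunc n)) => z; exact: cos_max.
apply: Cn_intro => // k; have [Y' dY' bY'] := dY k.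
exists (fun u => cos (Y u / n.+1%:R) * Y' u).
  exact: (dd_comp (g' := fun x => cos (x / n.+1%:R)) (fun u => is_derive_trunc n (Y u)) dY').
apply: BLM => //; apply: (@BL_comp (fun x => cos (x / n.+1%:R)) _ _ 1 _ _ _ YK') => // [x|x y].
  by rewrite (le_trans (cos_max _))// lerDr.
rewrite (le_trans (cos_lip _ _))// -mulrBl normrM mul1r ler_piMr//.
by rewrite ger0_norm// invf_le1// ler1n.
Qed.

(** The mean value theorem in one direction after the other. Exchanging [i] and
    [j] leaves the double increment unchanged. *)
Lemma double_increment i j F u (s : R) : 0 < s -> Cn 2 F ->
  exists p, `|p - u| <= s * (`|d i| + `|d j|) /\
    F (u + s *: d i + s *: d j) - F (u + s *: d i) - F (u + s *: d j) + F u =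
    s ^+ 2 * 'D_(d j) ('D_(d i) F) p.
Proof.
move=> s0 CF; have di := Cn_dd i CF.
have dj := Cn_dd j (Cn_pd i CF).
pose G w := F (w + s *: d j) - F w.
pose G' w := 'D_(d i) F (w + s *: d j) - 'D_(d i) F w.
have dG : dd (d i) G G'.
  move=> w; apply/dd_lineE.
  have /dd_lineE d1 := di (w + s *: d j).
  have /dd_lineE d2 := di w.
  rewrite (_ : (fun t => _) = (fun t => F (w + s *: d j + t *: d i)) -
     (fun t => F (w + t *: d i))); last first.
    by apply/funext => t; rewrite /G fctE addrAC.
  exact: is_deriveB.
have [c [cs E]] := dd_mean_value u s dG.
have [c' [cs' E']] := dd_mean_value (u + c *: d i) s dj.
exists (u + c *: d i + c' *: d j); split.
  rewrite (_ : _ - u = c *: d i + c' *: d j); last first.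
    by rewrite -[u + _ + _]addrA [u + _]addrC addrK.
  rewrite (le_trans (ler_normD _ _))// !normrZ mulrDr.
  have sE : `|s| = s by rewrite gtr0_norm.
  by rewrite sE in cs cs'; rewrite lerD// ler_wpM2r.
transitivity (G (u + s *: d i) - G u); first by rewrite /G; ring.
by rewrite E /G' E' expr2; ring.
Qed.

(** Schwarz: both mixed derivatives are limits of the same double increment. *)
Lemma pd_sym i j F : Cn 2 F -> 'D_(d i) ('D_(d j) F) = 'D_(d j) ('D_(d i) F).
Proof.
move=> CF; have CF2 i' j' := Cn_pd j' (Cn_pd i' CF).
apply/funext => u; have [K [K0 _ KL]] := BL_ge0 (CF2 i j).
have [L [L0 _ LL]] := BL_ge0 (CF2 j i).
apply: (lip_eq_at (M := `|d i| + `|d j|) LL KL) => // s s0.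
have [p [pu Ep]] := double_increment i j u s0 CF.
have [q [qu Eq]] := double_increment j i u s0 CF.
exists p, q; split; [exact: pu|by rewrite [`|d i| + _]addrC|].
have s2 : s ^+ 2 != 0 by rewrite sqrf_eq0 gt_eqF.
apply: (mulfI s2); apply: (etrans (esym Ep)); apply: (etrans _ Eq).
rewrite (addrAC u (s *: d i)).
apply: (congr1 (fun x => x + F u)).
by rewrite -!addrA; congr (_ + _); exact: addrC.
Qed.

End iterated.
End directional_derivatives.

(** * The Hilbert space and its Gaussian measure *)

Section hilbert.
Context {R : realType} {U : completeNormedModType R}.
Variable ip : {dot U for idfun}.
Hypothesis ip_norm : forall u, ip u u = `|u| ^+ 2.
Implicit Types u v w h k : U.

Lemma ipC u v : ip u v = ip v u.
Proof. by rewrite hermC expr0 mul1r. Qed.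

Lemma ipDl u v w : ip (u + v) w = ip u w + ip v w. Proof. exact: linearDl. Qed.
Lemma ipZl a u w : ip (a *: u) w = a * ip u w. Proof. exact: linearZl_LR. Qed.
Lemma ipBl u v w : ip (u - v) w = ip u w - ip v w. Proof. exact: linearBl. Qed.
Lemma ip0l w : ip 0 w = 0. Proof. exact: linear0l. Qed.
Lemma ipDr u v w : ip w (u + v) = ip w u + ip w v. Proof. by rewrite !(ipC w) ipDl. Qed.
Lemma ipZr a u w : ip w (a *: u) = a * ip w u. Proof. by rewrite !(ipC w) ipZl. Qed.
Lemma ipBr u v w : ip w (u - v) = ip w u - ip w v. Proof. by rewrite !(ipC w) ipBl. Qed.
Lemma ip0r w : ip w 0 = 0. Proof. by rewrite ipC ip0l. Qed.

Lemma ip_suml I (s : seq I) (F : I -> U) w :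
  ip (\sum_(i <- s) F i) w = \sum_(i <- s) ip (F i) w.
Proof.
elim: s => [|i s IHs]; first by rewrite !big_nil ip0l.
by rewrite !big_cons ipDl IHs.
Qed.

Lemma ip_sumr I (s : seq I) (F : I -> U) w :
  ip w (\sum_(i <- s) F i) = \sum_(i <- s) ip w (F i).
Proof. by rewrite ipC ip_suml; apply: eq_bigr => i _; rewrite ipC. Qed.

Lemma ip_normB u v : `|u - v| ^+ 2 = `|u| ^+ 2 - 2 * ip u v + `|v| ^+ 2.
Proof. by rewrite -!ip_norm ipBl !ipBr (ipC v u); ring. Qed.

Lemma ip_CS u v : `|ip u v| <= `|u| * `|v|.
Proof.
rewrite -ler_sqr ?nnegrE ?mulr_ge0// real_normK ?num_real// exprMn.
have [->|v0] := eqVneq v 0; first by rewrite ip0r expr0n/= mulr_ge0 ?sqr_ge0.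
have vp : 0 < `|v| ^+ 2 by rewrite exprn_gt0// normr_gt0.
have := sqr_ge0 `| `|v| ^+ 2 *: u - ip u v *: v|.
rewrite -ip_norm ipBl !ipBr !ipZl !ipZr (ipC v u) !ip_norm.
rewrite [X in 0 <= X -> _](_ : _ = `|v| ^+ 2 * (`|u| ^+ 2 * `|v| ^+ 2 - ip u v ^+ 2)).
  by rewrite pmulr_rge0// subr_ge0.
by ring.
Qed.

Lemma ip_lip h u v : `|ip u h - ip v h| <= `|h| * `|u - v|.
Proof. by rewrite -ipBl mulrC ip_CS. Qed.

Lemma ip_measurable h : measurable_fun setT ((fun u => ip u h) : borel U -> R).
Proof. by apply: continuous_borel; exact: lip_continuous (ip_lip h). Qed.

Lemma dd_ip v h : dd v (fun u => ip u h) (fun=> ip v h).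
Proof.
move=> u; apply/dd_lineE.
rewrite (_ : (fun t => _) = (fun t => ip u h + ip v h * t)).
  by apply: is_derive_eq; rewrite add0r /GRing.scale/=; ring.
by apply/funext => t; rewrite ipDl ipZl mulrC.
Qed.

Section basis.
Variable d : nat -> U.
Hypothesis d_basis : orthonormal_basis ip d.

Lemma basis_ip i j : ip (d i) (d j) = (i == j)%:R. Proof. exact: d_basis.1. Qed.

Lemma basis_norm i : `|d i| = 1.
Proof.
apply/eqP; rewrite -(@eqrXn2 _ 2)// -ip_norm basis_ip eqxx expr1n//.
Qed.

Definition proj (n : nat) u : U := \sum_(i < n) ip u (d i) *: d i.

Lemma ip_basis_sum m (a : nat -> R) (k : nat) :
  ip (\sum_(i < m) a i *: d i) (d k) = if (k < m)%N then a k else 0.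
Proof.
rewrite ip_suml (eq_bigr (fun i : 'I_m => (i == k :> nat)%:R * a k)) => [|i _].
  case: ltnP => km; last first.
    rewrite big1// => i _; case: eqP => [ik|_]; last by rewrite mul0r.
    by move: (ltn_ord i); rewrite ik ltnNge km.
  rewrite (bigD1 (Ordinal km))//= eqxx mul1r big1 ?addr0// => i /negbTE ik.
  by rewrite -(inj_eq val_inj)/= in ik; rewrite ik mul0r.
rewrite ipZl basis_ip mulrC.
by case: eqP => [->|_]; rewrite ?mul1r ?mul0r.
Qed.

Lemma ip_proj n u (k : nat) : ip (proj n u) (d k) = if (k < n)%N then ip u (d k) else 0.
Proof. exact: (ip_basis_sum n (fun i => ip u (d i))). Qed.

Lemma proj_best n u w : basis_span d n w -> `|u - proj n u| <= `|u - w|.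
Proof.
move=> [c ->]; rewrite -ler_sqr ?nnegrE//.
set w' := \sum_(i < n) _.
have orth (b : 'I_n -> R) : ip (u - proj n u) (\sum_(i < n) b i *: d i) = 0.
  rewrite ip_sumr big1// => i _; rewrite ipZr ipBl ip_proj ltn_ord subrr mulr0//.
have E : u - w' = (u - proj n u) - (\sum_(i < n) (c i - ip u (d i)) *: d i).
  under [X in _ = _ - X]eq_bigr do rewrite scalerBl.
  by rewrite sumrB opprB addrA subrK.
by rewrite E [leRHS]ip_normB orth mulr0 subr0 lerDl sqr_ge0.
Qed.

Lemma basis_spanW m n w : (m <= n)%N -> basis_span d m w -> basis_span d n w.
Proof.
move=> mn [c ->].
pose c' (i : nat) : R := odflt 0 (omap c (insub i)).
exists (fun i : 'I_n => c' i).
transitivity (\sum_(i < m) c' i *: d i).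
  by apply: eq_bigr => i _; rewrite /c' valK.
rewrite (big_ord_widen n (fun i => c' i *: d i) mn).
rewrite [RHS](bigID (fun i : 'I_n => (i < m)%N))/= [X in _ = _ + X]big1 ?addr0//.
by move=> i im; rewrite /c' insubF ?scale0r//; apply/negbTE.
Qed.

(** The span of the basis is dense and [proj n u] is the best approximation of
    [u] in its [n]-th step. *)
Lemma proj_cvg u : proj n u @[n --> \oo] --> u.
Proof.
apply/cvgrPdist_lt => e e0.
have : closure (\bigcup_n basis_span d n) u by rewrite d_basis.2.
move=> /(_ (ball u e) (nbhsx_ballx _ _ e0)) [w [[n _ wn]]].
rewrite -ball_normE/= => uw.
exists n => // m /= nm; rewrite (le_lt_trans _ uw)//.
exact/proj_best/(basis_spanW nm).
Qed.

End basis.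
End hilbert.

Lemma is_derive_quadratic (R : realType) (f : R -> R) (t a M : R) :
  (forall h, `|f (t + h) - f t - h * a| <= M * h ^+ 2) -> is_derive t 1 f a.
Proof.
move=> fM.
suff cv : h^-1 *: ((f \o shift t) (h *: (1 : R)) - f t) @[h --> 0^'] --> a.
  by split; [apply/cvg_ex; exists a|exact: cvg_lim cv].
apply/cvgrPdist_le => e e0.
have M1 : 0 < `|M| + 1 by rewrite ltr_wpDl.
near=> h.
have h0 : h != 0 by near: h; exact: nbhs_dnbhs_neq.
rewrite distrC /= /GRing.scale/= mulr1 (addrC h t).
rewrite (_ : _ - _ = h^-1 * (f (t + h) - f t - h * a)); last by field.
rewrite normrM normfV mulrC ler_pdivrMr ?normr_gt0//.
rewrite (le_trans (fM _))// -(real_normK (num_real h)) expr2 mulrA.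
rewrite ler_wpM2r//.
have he : `|h| <= e / (`|M| + 1).
  near: h; apply: cvgr0_norm_le; last by rewrite divr_gt0.
  exact: nbhs_dnbhs.
rewrite (@le_trans _ _ ((`|M| + 1) * `|h|))//.
  by rewrite ler_wpM2r// (le_trans (ler_norm _))// lerDl.
by rewrite mulrC -ler_pdivlMr.
Unshelve. all: end_near. Qed.

Section wave_derivative.
Context d (T : measurableType d) {R : realType} (mu : probability T R).

Lemma Bm_comp (g : R -> R) (A : T -> R) : continuous g -> (forall x, `|g x| <= 1) ->
  measurable_fun setT A -> Bm (fun x => g (A x)).
Proof.
move=> cg g1 mA; split; last by exists 1 => x; exact: g1.
by apply: measurableT_comp => //; exact: continuous_measurable_fun.
Qed.

Lemma Bm_cos (A : T -> R) : measurable_fun setT A -> Bm (fun x => cos (A x)).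
Proof. by apply: Bm_comp => [|x]; [exact: continuous_cos|exact: cos_max]. Qed.

Lemma Bm_sin (A : T -> R) : measurable_fun setT A -> Bm (fun x => sin (A x)).
Proof. by apply: Bm_comp => [|x]; [exact: continuous_sin|exact: sin_max]. Qed.

(** The second-order Taylor bound of the cosine, whose remainder [h^2 B^2] is
    integrable, replaces a domination of the difference quotients. *)
Lemma is_derive_expect_cos (A B : T -> R) (t : R) : measurable_fun setT A -> L2 mu B ->
  is_derive t 1 (fun t => expect mu (fun x => cos (A x + t * B x)))
    (- expect mu (fun x => B x * sin (A x + t * B x))).
Proof.
move=> mA B2; have [mB iB2] := B2.
have mAB s : measurable_fun setT (fun x => A x + s * B x).
  by apply: measurable_funD => //; exact: measurable_funM.
have ic s : L1 mu (fun x => cos (A x + s * B x)) by apply/L1_Bm/Bm_cos.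
have is' : L1 mu (fun x => B x * sin (A x + t * B x)).
  by apply: L1MB; [exact: L2_L1|exact: Bm_sin].
apply: (@is_derive_quadratic _ _ _ _ (expect mu (fun x => B x ^+ 2))) => h.
rewrite mulrN opprK -expectZ// -expectB// -expectD//; [|exact: L1B|exact: L1Z].
have i3 : L1 mu (fun x => cos (A x + (t + h) * B x) - cos (A x + t * B x) +
    h * (B x * sin (A x + t * B x))).
  by apply: L1D; [exact: L1B|exact: L1Z].
rewrite (le_trans (expect_norm i3))// mulrC -expectZ//.
apply: expect_le; [exact: L1_norm|exact: L1Z|move=> x].
rewrite (_ : A x + (t + h) * B x = A x + t * B x + h * B x); last by ring.
by rewrite mulrA (le_trans (cos_taylor _ _))// exprMn.
Qed.

End wave_derivative.

Section gaussian_measure.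
Context {R : realType} {U : completeNormedModType R}.
Variable ip : {dot U for idfun}.
Hypothesis ip_norm : forall u, ip u u = `|u| ^+ 2.
Variables (mu : probability (borel U) R) (Q : U -> U).
Hypothesis mu_gaussian : centered_gaussian ip mu.
Hypothesis mu_cov : covariance_operator ip mu Q.
Hypothesis Q_sym : forall u v, ip (Q u) v = ip u (Q v).

Notation E := (expect mu).

Let law h := centered_gaussian_stein (ip_measurable ip_norm h) (mu_gaussian h).

Lemma cov_expect h k : E (fun u => ip u h * ip u k) = ip (Q h) k.
Proof. by rewrite /expect /Rintegral mu_cov. Qed.

Lemma L2_ip_sqr h : L2 mu (fun u => ip u h ^+ 2).
Proof.
split; first by apply: measurable_funX; exact: ip_measurable.
by under [X in L1 _ X]eq_fun do rewrite -exprM; exact: (law h).1.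
Qed.

Lemma L2_ip h : L2 mu (fun u => ip u h).
Proof. by split; [exact: ip_measurable|exact/L2_L1/L2_ip_sqr]. Qed.

Lemma L2_ip2 h k : L2 mu (fun u => ip u h * ip u k).
Proof.
apply: (L2_le (G := fun u : borel U => ip u h ^+ 2 + ip u k ^+ 2)).
- by apply: measurable_funM; exact: ip_measurable.
- by apply: L2D; exact: L2_ip_sqr.
- move=> u; rewrite normrM -(real_normK (num_real (ip u h))).
  rewrite -(real_normK (num_real (ip u k))).
  have := normr_ge0 (ip u h); have := normr_ge0 (ip u k); nra.
Qed.

(** The characteristic function solves a linear differential equation by
    Stein's identity. *)
Lemma gaussian_char h c :
  E (fun u => cos (ip u h + c)) = expR (- (ip (Q h) h / 2)) * cos c.
Proof.
set q := ip (Q h) h.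
pose phi (t : R) := E (fun u => cos (c + t * ip u h)).
have dphi (t : R) : is_derive t 1 phi (- (q * t * phi t)).
  have := is_derive_expect_cos t (measurable_cst c) (L2_ip h).
  move=> D; apply: (is_derive_eq D); congr (- _).
  have := (law h).2 t c; rewrite (_ : E (fun u => ip u h ^+ 2) = q); last first.
    by rewrite /q -cov_expect; congr expect; apply/funext => u; rewrite expr2.
  under eq_fun do rewrite addrC; move=> ->; rewrite mulrA; congr (_ * expect _ _).
  by apply/funext => u; rewrite addrC.
pose G t := phi t * expR (q / 2 * t ^+ 2).
have dG (t : R) : is_derive t 1 G 0.
  apply: is_derive_eq; rewrite /GRing.scale/= ?expr1; by field.
have G10 : G 1 = G 0 by exact: is_derive_0_is_cst.
have phi0 : phi 0 = cos c.
  by rewrite /phi; under eq_fun do rewrite mul0r addr0; rewrite expect_cst.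
rewrite /G phi0 expr0n/= mulr0 expR0 mulr1 expr1n mulr1 in G10.
rewrite -G10 [RHS]mulrC -mulrA -expRD subrr expR0 mulr1 /phi.
by congr expect; apply/funext => u; rewrite mul1r addrC.
Qed.

(** Gaussian integration by parts for a plane wave: differentiate the
    characteristic function in the direction [k]. *)
Lemma ibp_wave h k c : E (fun u => ip u k * cos (ip u h + c)) =
  - (ip (Q h) k * E (fun u => sin (ip u h + c))).
Proof.
pose c' := c - pi / 2.
have d1 : is_derive (0 : R) 1
    (fun t => E (fun u => cos ((ip u h + c') + t * ip u k)))
    (- E (fun u => ip u k * sin ((ip u h + c') + 0 * ip u k))).
  apply: is_derive_expect_cos; last exact: L2_ip.
  by apply: measurable_funD => //; exact: ip_measurable.
have E1 : (fun t => E (fun u => cos ((ip u h + c') + t * ip u k))) =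
  fun t => expR (- ((ip (Q h) h + 2 * (ip (Q h) k) * t + ip (Q k) k * t ^+ 2) / 2))
      * cos c'.
  apply/funext => t; transitivity (E (fun u => cos (ip u (h + t *: k) + c'))).
    by congr expect; apply/funext => u; rewrite ipDr ipZr; congr cos; ring.
  rewrite gaussian_char; congr (expR (- (_ / 2)) * _).
  rewrite Q_sym ipDl !(ipDl, ipZl, ipDr, ipZr) -!Q_sym.
  rewrite !(ipDl, ipZl, ipDr, ipZr) (_ : ip (Q k) h = ip (Q h) k); last first.
    by rewrite Q_sym ipC.
  by ring.
have d2 : is_derive (0 : R) 1
    (fun t => expR (- ((ip (Q h) h + 2 * (ip (Q h) k) * t + ip (Q k) k * t ^+ 2) / 2))
      * cos c') (- ip (Q h) k * (expR (- (ip (Q h) h / 2)) * cos c')).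
  apply: is_derive_eq; rewrite /GRing.scale/= ?expr1 ?expr0n/= ?mulr0 ?addr0.
  by field.
rewrite E1 in d1; have := derive_val (is_derive := d1).
rewrite (derive_val (is_derive := d2)) -gaussian_char.
have cs x : cos (x + c') = sin (x + c) by rewrite /c' addrA cosBpihalf.
under [X in _ * expect _ X = _ -> _]eq_fun do rewrite cs.
rewrite mulNr => ->; rewrite -expectN; last first.
  apply: L1MB; [exact/L2_L1/L2_ip|apply: Bm_sin].
  apply: measurable_funD; last by apply: measurable_funM => //; exact: ip_measurable.
  by apply: measurable_funD => //; exact: ip_measurable.
congr expect; apply/funext => u; rewrite mul0r addr0 -mulrN; congr (_ * _).
by rewrite /c' addrA sinBpihalf opprK.
Qed.

End gaussian_measure.

(** * Gaussian integration by parts for Lipschitz functions *)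

Section bernstein.
Context {R : realType}.
Implicit Types (g : nat -> R) (s : R).

(** Bernstein polynomials through de Casteljau's recursion: [bern N s g] is
    the mean of [g] under the binomial law of parameters [N] and [s]; [dbern] is
    its derivative in [s]. *)
Fixpoint bern (N : nat) s g : R := if N is M.+1 then
  (1 - s) * bern M s g + s * bern M s (fun i => g i.+1) else g 0%N.

Fixpoint dbern (N : nat) s g : R := if N is M.+1 then
  (1 - s) * dbern M s g + s * dbern M s (fun i => g i.+1) +
  (bern M s (fun i => g i.+1) - bern M s g) else 0.

Lemma bernZ N s k g : bern N s (fun i => k * g i) = k * bern N s g.
Proof. by elim: N g => [//|N IHN] g; rewrite /= !IHN; ring. Qed.

Lemma bernD N s g h : bern N s (fun i => g i + h i) = bern N s g + bern N s h.
Proof.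
elim: N g h => [//|N IHN] g h.
by rewrite /= IHN (IHN (fun i => g i.+1) (fun i => h i.+1)); ring.
Qed.

Lemma bernB N s g h : bern N s (fun i => g i - h i) = bern N s g - bern N s h.
Proof.
rewrite -mulN1r -bernZ -bernD; congr bern.
by apply/funext => i; rewrite mulN1r.
Qed.

Lemma bern_cst N s c : bern N s (fun=> c) = c.
Proof. by elim: N => [//|N IHN]; rewrite /= IHN; ring. Qed.

Lemma bern_le N s g h : 0 <= s <= 1 -> (forall i, g i <= h i) ->
  bern N s g <= bern N s h.
Proof.
move=> /andP[s0 s1] gh; elim: N g h gh => [|N IHN] g h gh /=; first exact: gh.
by rewrite lerD// ler_wpM2l ?subr_ge0//; apply: IHN.
Qed.

Lemma bern_norm N s g K : 0 <= s <= 1 -> (forall i, `|g i| <= K) ->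
  `|bern N s g| <= K.
Proof.
move=> s01 gK; have gK' i : - K <= g i <= K by rewrite -ler_norml.
rewrite ler_norml -{1}(bern_cst N s (- K)) -{2}(bern_cst N s K).
by apply/andP; split; apply: bern_le => // i; case/andP: (gK' i).
Qed.

Lemma bern_variance N s a : bern N s (fun i => (i%:R - a) ^+ 2) =
  N%:R * s * (1 - s) + (N%:R * s - a) ^+ 2.
Proof.
elim: N a => [|N IHN] a /=; first by ring.
rewrite IHN (_ : (fun i => _) = fun i => (i%:R - (a - 1)) ^+ 2); last first.
  by apply/funext => i; rewrite -natr1; ring.
by rewrite IHN -natr1; ring.
Qed.

(** In this form the derivative is a mean of difference quotients, so that
    [bern_cvg] gives its convergence too. *)
Lemma dbernE N s g :
  dbern N.+1 s g = N.+1%:R * bern N s (fun i => g i.+1 - g i).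
Proof.
elim: N g => [|N IHN] g; first by rewrite /=; ring.
rewrite [LHS]/= -/(dbern N.+1 s g) -/(dbern N.+1 s (fun i => g i.+1)) !IHN.
rewrite -/(bern N.+1 s g) -/(bern N.+1 s (fun i => g i.+1)).
by rewrite -bernB [bern N.+1 s _]/= -[N.+2%:R]natr1; ring.
Qed.

(** Chebyshev's argument with an explicit modulus: the binomial variance is
    of order [1 / n]. The values [g n i] may miss their limit by [B / (n + 1)],
    which leaves room for difference quotients. *)
Lemma bern_cvg (M : nat -> nat) (g : nat -> nat -> R) s c A B :
  0 <= s <= 1 -> 0 <= A -> 0 <= B -> (forall n, M n = n \/ M n = n.+1) ->
  (forall n i, `|g n i - c| <= A * `|i%:R / n.+1%:R - s| + B / n.+1%:R) ->
  bern (M n) s (g n) @[n --> \oo] --> c.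
Proof.
move=> s01 A0 B0 Mn gc.
have bound del n : 0 < del ->
    `|bern (M n) s (g n) - c| <= A * del + (2 * A / del + B) / n.+1%:R.
  move=> del0; rewrite -(bern_cst (M n) s c) -bernB.
  have N0 : 0 < n.+1%:R :> R by [].
  have V : bern (M n) s (fun i => (i%:R / n.+1%:R - s) ^+ 2) <= 2 / n.+1%:R.
    rewrite (_ : (fun i => _) = fun i => (n.+1%:R ^- 2) * (i%:R - n.+1%:R * s) ^+ 2);
      last by apply/funext => i; field; rewrite gt_eqF.
    rewrite bernZ bern_variance mulrC ler_pdivrMr ?exprn_gt0//.
    rewrite [leRHS](_ : _ = 2 * n.+1%:R); last by field; rewrite gt_eqF.
    have n1 : 1 <= n.+1%:R :> R by rewrite ler1n.
    case/andP: s01 => s0 s1.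
    have [->|->] := Mn n; last by rewrite subrr; nra.
    rewrite -natr1; have : 0 <= n%:R :> R by []. nra.
  have h : bern (M n) s (fun i => `|g n i - c|) <= A * del + (2 * A / del + B) / n.+1%:R.
    apply: (@le_trans _ _ (bern (M n) s (fun i =>
      (A * del + B / n.+1%:R) + (A / del) * (i%:R / n.+1%:R - s) ^+ 2))).
      apply: bern_le => // i; rewrite (le_trans (gc n i))// addrAC lerD2r.
      rewrite -(real_normK (num_real (_ - s))); set y := `|_|.
      have y0 : 0 <= y by exact: normr_ge0.
      rewrite -mulrA -mulrDr ler_wpM2l// -(@ler_pM2l _ del)// mulrDr mulVKf ?gt_eqF//.
      by nra.
    rewrite bernD bern_cst bernZ.
    have := ler_wpM2l (divr_ge0 A0 (ltW del0)) V.
    rewrite [X in _ <= X -> _](_ : _ = (2 * A / del) / n.+1%:R); last first.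
      by field; rewrite !gt_eqF.
    by rewrite [(2 * A / del + B) / _]mulrDl -addrA lerD2l addrC lerD2r.
  apply: le_trans h; rewrite ler_norml; apply/andP; split.
    rewrite -mulN1r -bernZ; apply: bern_le => // i.
    by rewrite mulN1r lerNl -normrN ler_norm.
  by apply: bern_le => // i; exact: ler_norm.
apply/cvgrPdist_le => e e0.
have A1 : 0 < 2 * (A + 1) by lra.
pose del := e / (2 * (A + 1)); have del0 : 0 < del by rewrite divr_gt0.
near=> n; rewrite distrC (le_trans (bound _ n del0))//.
have h1 : A * del <= e / 2.
  rewrite /del mulrA ler_pdivrMr// (_ : e / 2 * _ = e * (A + 1)); last by field.
  by rewrite mulrC ler_pM2l// lerDl.
have h2 : (2 * A / del + B) / n.+1%:R <= e / 2.
  near: n.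
  have := cvg_div_nat (2 * A / del + B) => /cvgrPdist_le/(_ (e / 2)).
  rewrite divr_gt0// => /(_ isT); apply: filterS => n.
  by rewrite sub0r normrN => /(le_trans (ler_norm _)).
by rewrite [leRHS]splitr lerD.
Unshelve. all: end_near. Qed.

End bernstein.

Section gaussian_ibp.
Context {R : realType} {U : completeNormedModType R}.
Variable ip : {dot U for idfun}.
Hypothesis ip_norm : forall u, ip u u = `|u| ^+ 2.
Variables (mu : probability (borel U) R) (Q : U -> U).
Hypothesis mu_gaussian : centered_gaussian ip mu.
Hypothesis mu_cov : covariance_operator ip mu Q.
Hypothesis Q_sym : forall u v, ip (Q u) v = ip u (Q v).
Variable d : nat -> U.
Hypothesis d_basis : orthonormal_basis ip d.
Variable lam : nat -> R.
Hypothesis Q_eigen : forall i, Q (d i) = lam i *: d i.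

Notation E := (expect mu).
Notation x_ k := (fun u : borel U => ip u (d k)).

Let L2x h : L2 mu (fun u : borel U => ip u h).
Proof. exact: (L2_ip ip_norm mu_gaussian h). Qed.

Section fixed_direction.
Variable k : nat.

(** Integration by parts in the direction [d k] for [F] times every plane
    wave. Carrying the waves along makes the class stable under
    multiplication by trigonometric polynomials. *)
Definition ibp_waves (F F' : borel U -> R) := [/\ Bm F, Bm F' & forall h c,
  E (fun u => ip u (d k) * (cos (ip u h + c) * F u)) =
  lam k * E (fun u => cos (ip u h + c) * F' u - ip h (d k) * (sin (ip u h + c) * F u))].

Let mwave h c : measurable_fun setT ((fun u => ip u h + c) : borel U -> R).
Proof. by apply: measurable_funD => //; exact: ip_measurable. Qed.

Let bcos h c : Bm ((fun u => cos (ip u h + c)) : borel U -> R).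
Proof. exact: (Bm_cos (mwave h c)). Qed.

Let bsin h c : Bm ((fun u => sin (ip u h + c)) : borel U -> R).
Proof. exact: (Bm_sin (mwave h c)). Qed.

Let L1_lhs F h c : Bm F -> L1 mu (fun u => ip u (d k) * (cos (ip u h + c) * F u)).
Proof. by move=> bF; apply: L1MB; [exact/L2_L1/L2x|exact: BmM]. Qed.

Let Bm_rhs F F' h c : Bm F -> Bm F' ->
  Bm (fun u : borel U => cos (ip u h + c) * F' u - ip h (d k) * (sin (ip u h + c) * F u)).
Proof. by move=> bF bF'; apply: BmB; [exact: BmM|apply: BmZ; exact: BmM]. Qed.

Lemma ibp_waves_cst a : ibp_waves (fun=> a) (fun=> 0).
Proof.
split; [exact: Bm_cst..|move=> h c].
have := ibp_wave ip_norm mu_gaussian mu_cov Q_sym h (d k) c.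
rewrite Q_sym Q_eigen (ipZr ip) => w.
transitivity (a * E (fun u => ip u (d k) * cos (ip u h + c))).
  rewrite -expectZ; last by apply: L1MB; [exact/L2_L1/L2x|exact: bcos].
  by congr expect; apply/funext => u; ring.
rewrite w; transitivity (lam k * E (fun u => (- a * ip h (d k)) * sin (ip u h + c))).
  by rewrite expectZ; [ring|exact/L1_Bm/bsin].
by congr (_ * expect _ _); apply/funext => u; ring.
Qed.

Lemma ibp_wavesD F F' G G' : ibp_waves F F' -> ibp_waves G G' ->
  ibp_waves (fun u => F u + G u) (fun u => F' u + G' u).
Proof.
move=> [bF bF' iF] [bG bG' iG]; split; [exact: BmD..|move=> h c].
transitivity (E (fun u => ip u (d k) * (cos (ip u h + c) * F u)
    + ip u (d k) * (cos (ip u h + c) * G u))).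
  by congr expect; apply/funext => u; ring.
rewrite expectD ?iF ?iG; [|exact: L1_lhs..].
rewrite -mulrDr -expectD; [|exact/L1_Bm/Bm_rhs..].
by congr (_ * expect _ _); apply/funext => u; ring.
Qed.

Lemma ibp_wavesZ a F F' : ibp_waves F F' ->
  ibp_waves (fun u => a * F u) (fun u => a * F' u).
Proof.
move=> [bF bF' iF]; split; [exact: BmZ..|move=> h c].
transitivity (E (fun u => a * (ip u (d k) * (cos (ip u h + c) * F u)))).
  by congr expect; apply/funext => u; ring.
rewrite expectZ ?iF; last exact: L1_lhs.
rewrite mulrCA; congr (_ * _); rewrite -expectZ; last by apply: L1_Bm; exact: Bm_rhs.
by congr expect; apply/funext => u; ring.
Qed.

(** A product of two waves is a sum of two waves. *)
Lemma ibp_waves_cos F F' g b : ibp_waves F F' ->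
  ibp_waves (fun u => cos (ip u g + b) * F u)
    (fun u => cos (ip u g + b) * F' u - ip g (d k) * (sin (ip u g + b) * F u)).
Proof.
move=> [bF bF' iF]; split; [by apply: BmM|exact: Bm_rhs|move=> h c].
have sumE u : cos (ip u (h + g) + (c + b)) =
    cos (ip u h + c) * cos (ip u g + b) - sin (ip u h + c) * sin (ip u g + b).
  by rewrite -cosD (ipDr ip); congr cos; ring.
have sumS u : sin (ip u (h + g) + (c + b)) =
    sin (ip u h + c) * cos (ip u g + b) + cos (ip u h + c) * sin (ip u g + b).
  by rewrite -sinD (ipDr ip); congr sin; ring.
have difE u : cos (ip u (h - g) + (c - b)) =
    cos (ip u h + c) * cos (ip u g + b) + sin (ip u h + c) * sin (ip u g + b).
  by rewrite -cosB (ipBr ip); congr cos; ring.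
have difS u : sin (ip u (h - g) + (c - b)) =
    sin (ip u h + c) * cos (ip u g + b) - cos (ip u h + c) * sin (ip u g + b).
  by rewrite -sinB (ipBr ip); congr sin; ring.
transitivity (2^-1 * (E (fun u => ip u (d k) * (cos (ip u (h + g) + (c + b)) * F u))
   + E (fun u => ip u (d k) * (cos (ip u (h - g) + (c - b)) * F u)))).
  rewrite -expectD; [|exact: L1_lhs..].
  rewrite -expectZ; last by apply: L1D; exact: L1_lhs.
  by congr expect; apply/funext => u; rewrite sumE difE; field.
rewrite !iF -mulrDr mulrCA; congr (_ * _); rewrite -expectD; [|exact/L1_Bm/Bm_rhs..].
rewrite -expectZ; last by apply: L1D; apply: L1_Bm; exact: Bm_rhs.
congr expect; apply/funext => u; rewrite sumE sumS difE difS.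
by rewrite (ipDl ip) (ipBl ip); field.
Qed.

Lemma ibp_waves_lim (Fn Fn' : nat -> borel U -> R) F F' K :
  (forall n, ibp_waves (Fn n) (Fn' n)) ->
  (forall u, Fn n u @[n --> \oo] --> F u) -> (forall u, Fn' n u @[n --> \oo] --> F' u) ->
  (forall n u, `|Fn n u| <= K) -> (forall n u, `|Fn' n u| <= K) -> ibp_waves F F'.
Proof.
move=> iFn FnF FnF' FnK FnK'.
have lim_bm (Gn : nat -> borel U -> R) G : (forall n, Bm (Gn n)) ->
    (forall u, Gn n u @[n --> \oo] --> G u) -> (forall n u, `|Gn n u| <= K) -> Bm G.
  move=> bG GnG GK; split.
    apply: (measurable_fun_cvg (h := Gn)) => [n|u _]; last exact: GnG.
    by case: (bG n).
  exists K => u.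
  have cvn : `|Gn n u| @[n --> \oo] --> `|G u| by apply: cvg_norm; exact: GnG.
  rewrite -(cvg_lim (@norm_hausdorff _ _) cvn); apply: limr_le.
    by apply/cvg_ex; eexists; exact: cvn.
  by apply: nearW => n; exact: GK.
have bFn n : Bm (Fn n) by case: (iFn n).
have bFn' n : Bm (Fn' n) by case: (iFn n).
have bF : Bm F by exact: (lim_bm Fn).
have bF' : Bm F' by exact: (lim_bm Fn').
split=> // h c.
have [_ c1] : L1 mu (fun u => ip u (d k) * (cos (ip u h + c) * F u)) /\
  E (fun u => ip u (d k) * (cos (ip u h + c) * Fn n u)) @[n --> \oo] -->
  E (fun u => ip u (d k) * (cos (ip u h + c) * F u)).
  apply: (expect_dct (G := fun u : borel U => K * `|ip u (d k)|)).
  - by move=> n; exact: L1_meas (L1_lhs h c (bFn n)).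
  - by move=> u; apply: cvgMr; apply: cvgMr; exact: FnF.
  - exact/L1Z/L1_norm/L2_L1/L2x.
  - move=> n u; rewrite !normrM mulrC ler_wpM2r//.
    by rewrite -[K]mul1r ler_pM// cos_max.
have [_ c2] : L1 mu (fun u => cos (ip u h + c) * F' u - ip h (d k) * (sin (ip u h + c) * F u)) /\
  E (fun u => cos (ip u h + c) * Fn' n u - ip h (d k) * (sin (ip u h + c) * Fn n u)) @[n --> \oo] -->
  E (fun u => cos (ip u h + c) * F' u - ip h (d k) * (sin (ip u h + c) * F u)).
  apply: (expect_dct (G := fun u : borel U => K + `|ip h (d k)| * K)).
  - by move=> n; case: (Bm_rhs h c (bFn n) (bFn' n)).
  - move=> u; apply: cvgB; first by apply: cvgMr; exact: FnF'.
    by apply: cvgMr; apply: cvgMr; exact: FnF.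
  - exact/L1_Bm/Bm_cst.
  - move=> n u; rewrite (le_trans (ler_normB _ _))// lerD// !normrM.
      by rewrite -[K]mul1r ler_pM// cos_max.
    by rewrite ler_wpM2l// -[K]mul1r ler_pM// sin_max.
have e n : E (fun u => ip u (d k) * (cos (ip u h + c) * Fn n u)) = lam k *
    E (fun u => cos (ip u h + c) * Fn' n u - ip h (d k) * (sin (ip u h + c) * Fn n u)).
  by case: (iFn n) => _ _ ->.
rewrite (funext e) in c1.
have c3 : lam k * E (fun u => cos (ip u h + c) * Fn' n u -
      ip h (d k) * (sin (ip u h + c) * Fn n u)) @[n --> \oo] -->
    lam k * E (fun u => cos (ip u h + c) * F' u - ip h (d k) * (sin (ip u h + c) * F u)).
  by apply: cvgMr; exact: c2.
exact: (cvg_unique _ c1 c3).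
Qed.

Section bernstein_step.
Variables (j l : nat).
Let L : R := l.+1%:R.
Let s (u : U) : R := (1 + sin (ip u (d j) / L)) / 2.
Let s' (u : U) : R := (j == k)%:R * cos (ip u (d j) / L) / (2 * L).

(** The node [s] is itself affine in a wave, a sine being a shifted cosine; its
    derivative along [d k] is [s']. *)
Lemma ibp_waves_node F F' : ibp_waves F F' ->
  ibp_waves (fun u => s u * F u) (fun u => s u * F' u + s' u * F u).
Proof.
move=> iF; have := ibp_wavesD (ibp_wavesZ 2^-1 iF)
  (ibp_wavesZ 2^-1 (ibp_waves_cos (L^-1 *: d j) (- (pi / 2)) iF)).
have L0 : L != 0 by rewrite pnatr_eq0.
have c u : cos (ip u (L^-1 *: d j) - pi / 2) = sin (ip u (d j) / L).
  by rewrite cosBpihalf (ipZr ip) mulrC.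
have sn u : sin (ip u (L^-1 *: d j) - pi / 2) = - cos (ip u (d j) / L).
  by rewrite sinBpihalf (ipZr ip) mulrC.
have dk : ip (L^-1 *: d j) (d k) = L^-1 * (j == k)%:R.
  by rewrite (ipZl ip) (basis_ip d_basis).
congr ibp_waves; apply/funext => u; rewrite c ?sn ?dk /s /s'; by field.
Qed.

Lemma ibp_waves_bern N (G G' : nat -> borel U -> R) :
  (forall i, ibp_waves (G i) (G' i)) ->
  ibp_waves (fun u => bern N (s u) (G ^~ u))
    (fun u => bern N (s u) (G' ^~ u) + s' u * dbern N (s u) (G ^~ u)).
Proof.
elim: N G G' => [|N IHN] G G' iG /=.
  by have := iG 0%N; congr ibp_waves; apply/funext => u; rewrite mulr0 addr0.
have i0 := IHN _ _ iG.
have i1 := IHN _ _ (fun i => iG i.+1).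
have := ibp_wavesD i0 (ibp_waves_node (ibp_wavesD i1 (ibp_wavesZ (-1) i0))).
by congr ibp_waves; apply/funext => u; ring.
Qed.

Let s01 u : 0 <= s u <= 1.
Proof.
rewrite /s; have := sin_geN1 (ip u (d j) / L); have := sin_le1 (ip u (d j) / L).
by move=> ? ?; apply/andP; split; lra.
Qed.

Let L_gt0 : 0 < L. Proof. by rewrite /L. Qed.

Let L_ge1 : 1 <= L. Proof. by rewrite /L ler1n. Qed.

Let s'_le u : `|s' u| <= 1.
Proof.
rewrite /s' normrM normfV [`|2 * L|]ger0_norm ?mulr_ge0 ?(ltW L_gt0)//.
rewrite ler_pdivrMr ?mulr_gt0// mul1r normrM.
apply: (@le_trans _ _ (1 * 1)); last by have := L_ge1; lra.
by apply: ler_pM => //; [case: eqP; rewrite ?normr1 ?normr0|exact: cos_max].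
Qed.

(** The Bernstein polynomials of [y |-> F(y d_j + p u)] on [-L, L], evaluated at
    [y = L sin(x_j / L)], are trigonometric polynomials in [x_j]; as the degree
    grows they converge with their derivatives. *)
Lemma ibp_waves_trunc (p : U -> U) F F' (D : bool) : BL F -> dd (d k) F F' -> BL F' ->
  (forall y : R, ibp_waves (fun u => F (y *: d j + p u))
      (fun u => if D then F' (y *: d j + p u) else 0)) ->
  ibp_waves (fun u => F (trunc l (ip u (d j)) *: d j + p u))
    (fun u => (if D then F' (trunc l (ip u (d j)) *: d j + p u) else 0) +
      (j == k)%:R * cos (ip u (d j) / L) * F' (trunc l (ip u (d j)) *: d j + p u)).
Proof.
move=> /BL_ge0[K [K0 FK FL]] dF /BL_ge0[K' [K'0 FK' FL']] iF.
pose y (n i : nat) : R := L * (2 * (i%:R / n.+1%:R) - 1).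
pose G n (i : nat) (u : borel U) : R := F (y n i *: d j + p u).
pose G' n (i : nat) (u : borel U) : R := if D then F' (y n i *: d j + p u) else 0.
pose top u := trunc l (ip u (d j)) *: d j + p u.
have dj : `|d j| = 1 by exact: (basis_norm ip_norm d_basis).
have topE u : trunc l (ip u (d j)) = L * (2 * s u - 1).
  by rewrite /trunc /s -/L; field.
have ydist n i u : `|(y n i *: d j + p u) - top u| = 2 * L * `|i%:R / n.+1%:R - s u|.
  rewrite /top opprD addrACA subrr addr0 -scalerBl normrZ dj mulr1 topE.
  rewrite (_ : _ - _ = 2 * L * (i%:R / n.+1%:R - s u)); last by rewrite /y; ring.
  by rewrite normrM ger0_norm ?mulr_ge0 ?(ltW L_gt0).
have N0 n : (n.+1%:R : R) != 0 by rewrite pnatr_eq0.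
have dy n i : y n i.+1 = y n i + 2 * L / n.+1%:R.
  rewrite /y -[i.+1%:R]natr1; move: (N0 n); generalize (n.+1%:R : R) => N NN.
  by field.
have incr n i (u : U) : j = k -> exists c : R, `|c| <= 2 * L / n.+1%:R /\ n.+1%:R * (G n i.+1 u - G n i u) =
    2 * L * F' (y n i *: d j + p u + c *: d j) :> R.
  move=> jk; have dF' : dd (d j) F F' by rewrite jk.
  have [c [cL Ec]] := dd_mean_value (y n i *: d j + p u) (2 * L / n.+1%:R) dF'.
  exists c; split.
    by rewrite (le_trans cL)// ger0_norm// divr_ge0// mulr_ge0// ltW.
  rewrite /G dy scalerDl -addrA [_ + p u]addrC addrA Ec.
  by rewrite mulrCA [X in _ * X]mulrC divfK// mulrC.
apply: (@ibp_waves_lim (fun n u => bern n.+1 (s u) (G n ^~ u))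
   (fun n u => bern n.+1 (s u) (G' n ^~ u) + s' u * dbern n.+1 (s u) (G n ^~ u))
   _ _ (K + (K' + 2 * L * K'))).
- by move=> n; apply: ibp_waves_bern => i; exact: iF.
- move=> u; apply: (@bern_cvg _ (fun n => n.+1) _ _ _ (K * (2 * L)) 0) => //.
  + by rewrite mulr_ge0// mulr_ge0// ltW.
  + by move=> n; right.
  + move=> n i; rewrite mul0r addr0 (le_trans (FL _ _))// ydist -[leRHS]mulrA.
    by rewrite ler_wpM2l.
- move=> u; apply: cvgD.
    rewrite /G'; case: (D); last first.
      under eq_fun do rewrite bern_cst; exact: cvg_cst.
    apply: (@bern_cvg _ (fun n => n.+1) _ _ _ (K' * (2 * L)) 0) => //.
    + by rewrite mulr_ge0// mulr_ge0// ltW.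
    + by move=> n; right.
    + move=> n i; rewrite mul0r addr0 (le_trans (FL' _ _))// ydist -[leRHS]mulrA.
      by rewrite ler_wpM2l.
  have [jk|jk] := eqVneq j k; last first.
    rewrite (_ : s' u = 0); last by rewrite /s' (negbTE jk) !mul0r.
    by under eq_fun do rewrite mul0r; rewrite !mul0r; exact: cvg_cst.
  rewrite (_ : 1%:R * _ * _ = s' u * (2 * L * F' (top u))); last first.
    rewrite /s' /top jk eqxx; set a := cos _; set b := F' _.
    by move: (lt0r_neq0 L_gt0) => L0; rewrite /=; field.
  apply: cvgMr; under eq_fun do rewrite dbernE -bernZ.
  apply: (@bern_cvg _ id _ _ _ (2 * L * K' * (2 * L)) (2 * L * K' * (2 * L))) => //.
  + by rewrite !mulr_ge0 ?(ltW L_gt0).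
  + by rewrite !mulr_ge0 ?(ltW L_gt0).
  + by move=> n; left.
  + move=> n i; have [c [cL ->]] := incr n i u jk.
    rewrite -mulrBr normrM (ger0_norm (mulr_ge0 _ (ltW L_gt0)))//.
    rewrite -[2 * L * K' * (2 * L) * `|_|]mulrA -[2 * L * K' * (2 * L) / _]mulrA.
    rewrite -![2 * L * K' * _]mulrA -mulrDr ler_wpM2l ?mulr_ge0 ?(ltW L_gt0)//.
    rewrite (le_trans (FL' _ _))// -mulrDr ler_wpM2l// addrAC.
    rewrite (le_trans (ler_normD _ _))// ydist lerD2l normrZ dj mulr1.
    exact: cL.
- move=> n u; rewrite (le_trans (bern_norm _ (s01 u) (fun i => FK _)))//.
  by rewrite lerDl addr_ge0// mulr_ge0// mulr_ge0// ltW.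
- move=> n u; rewrite (le_trans (ler_normD _ _))// ler_wpDl// lerD//.
    apply: bern_norm => // i; rewrite /G'; case: (D) => //.
    by rewrite normr0.
  have [jk|jk] := eqVneq j k; last first.
    rewrite (_ : s' u = 0); last by rewrite /s' (negbTE jk) !mul0r.
    by rewrite mul0r normr0 !mulr_ge0 ?(ltW L_gt0).
  rewrite dbernE -bernZ normrM -[leRHS]mul1r ler_pM//.
  apply: bern_norm => // i; have [c [_ ->]] := incr n i u jk.
  by rewrite normrM (ger0_norm (mulr_ge0 _ (ltW L_gt0)))// ler_wpM2l// mulr_ge0// ltW.
Qed.

End bernstein_step.

Definition tail_proj (j n : nat) (u : U) : U := \sum_(j <= i < n) ip u (d i) *: d i.

(** Free the coordinates one at a time, from the last to the first. *)
Lemma ibp_waves_tail n m : (m <= n)%N -> forall F F', BL F -> dd (d k) F F' -> BL F' ->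
  ibp_waves (fun u => F (tail_proj (n - m) n u))
    (fun u => if (n - m <= k < n)%N then F' (tail_proj (n - m) n u) else 0).
Proof.
elim: m => [|m IHm] mn F F' bF dF bF'.
  have q0 u : tail_proj (n - 0) n u = 0 by rewrite /tail_proj subn0 big_geq.
  have -> : (n - 0 <= k < n)%N = false.
    by rewrite subn0; apply/negbTE; rewrite negb_and -ltnNge -leqNgt; case: ltnP.
  by have := ibp_waves_cst (F 0); congr ibp_waves; apply/funext => u; rewrite q0.
set j := (n - m.+1)%N; have jn : (j < n)%N by rewrite /j ltn_subrL//; exact: leq_trans mn.
have jm : (n - m)%N = j.+1 by rewrite /j subnSK.
have qE u : tail_proj j n u = ip u (d j) *: d j + tail_proj j.+1 n u.
  by rewrite /tail_proj big_ltn.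
have iF y : ibp_waves (fun u => F (y *: d j + tail_proj j.+1 n u))
    (fun u => if (j < k < n)%N then F' (y *: d j + tail_proj j.+1 n u) else 0).
  rewrite -jm; apply: (IHm (ltnW mn) (fun u => F (y *: d j + u)) (fun u => F' (y *: d j + u))).
  - have [K [FK FL]] := bF; exists K; split => // u v.
    by rewrite (le_trans (FL _ _))// opprD addrACA subrr add0r.
  - move=> u; apply/dd_lineE; have /dd_lineE := dF (y *: d j + u).
    by under eq_fun do rewrite -addrA.
  - have [K [FK FL]] := bF'; exists K; split => // u v.
    by rewrite (le_trans (FL _ _))// opprD addrACA subrr add0r.
have [K [K0 FK FL]] := BL_ge0 bF; have [K' [K'0 FK' FL']] := BL_ge0 bF'.
pose top l u := trunc l (ip u (d j)) *: d j + tail_proj j.+1 n u.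
have dj : `|d j| = 1 by exact: (basis_norm ip_norm d_basis).
have lim_top (H : U -> R) M u : 0 <= M -> (forall u v, `|H u - H v| <= M * `|u - v|) ->
    H (top l u) @[l --> \oo] --> H (tail_proj j n u).
  move=> M0 HM; apply/subr_cvg0; apply: norm_cvg0.
  apply: (@squeeze_cvgr _ _ _ _ (cst 0)
     (fun l => M * `|trunc l (ip u (d j)) - ip u (d j)|)).
  - apply: nearW => l; rewrite normr_ge0/= (le_trans (HM _ _))//.
    by rewrite qE /top opprD addrACA subrr addr0 -scalerBl normrZ dj mulr1.
  - exact: cvg_cst.
  - rewrite -(mulr0 M); apply: cvgMr; rewrite -(normr0 R); apply: cvg_norm.
    by apply/subr_cvg0; exact: trunc_cvg.
apply: (@ibp_waves_lim (fun l u => F (top l u)) (fun l u =>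
    (if (j < k < n)%N then F' (top l u) else 0) +
    (j == k)%:R * cos (ip u (d j) / l.+1%:R) * F' (top l u)) _ _ (K + (K' + K'))).
- by move=> l; apply: ibp_waves_trunc.
- by move=> u; apply: lim_top FL.
- move=> u; have cF' := lim_top F' K' u K'0 FL'.
  have -> : (if (j <= k < n)%N then F' (tail_proj j n u) else 0) =
    (if (j < k < n)%N then F' (tail_proj j n u) else 0) +
    (j == k)%:R * 1 * F' (tail_proj j n u).
    rewrite leq_eqVlt; have [jk|jk] := eqVneq j k.
      by rewrite -jk ltnn jn/= add0r !mul1r.
    by rewrite !mul0r addr0.
  apply: cvgD; first by case: ifP => _; [exact: cF'|exact: cvg_cst].
  apply: cvgM => //; apply: cvgMr; exact: cos_trunc_cvg.
- by move=> l u; rewrite (le_trans (FK _))// lerDl addr_ge0.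
- move=> l u; rewrite (le_trans (ler_normD _ _))// ler_wpDl// lerD//.
    by case: ifP => // _; rewrite normr0.
  rewrite !normrM -[leRHS]mul1r ler_pM// -[leRHS]mulr1 ler_pM ?cos_max//.
  by case: eqP; rewrite ?normr1 ?normr0.
Qed.

End fixed_direction.

(** Apply the finite-dimensional statement to [F] composed with the projections
    on the first basis vectors, which converge pointwise to the identity. *)
Theorem gaussian_ibp k F F' : BL F -> dd (d k) F F' -> BL F' ->
  E (fun u => ip u (d k) * F u) = lam k * E F'.
Proof.
move=> bF dF bF'.
have [K [K0 FK FL]] := BL_ge0 bF; have [K' [K'0 FK' FL']] := BL_ge0 bF'.
have projE n u : tail_proj 0 n u = proj ip d n u.
  by rewrite /tail_proj big_mkord.
have lim_proj (H : U -> R) M u : 0 <= M -> (forall u v, `|H u - H v| <= M * `|u - v|) ->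
    H (proj ip d (n + k.+1) u) @[n --> \oo] --> H u.
  move=> M0 HM; have cH : continuous H := lip_continuous HM.
  apply: (@cvg_comp _ _ _ (fun n => proj ip d (n + k.+1) u) H _ (nbhs u)); last exact: cH.
  by rewrite (cvg_shiftn k.+1 (fun n => proj ip d n u)); exact: (proj_cvg ip_norm d_basis).
have iF n : E (fun u => ip u (d k) * F (proj ip d (n + k.+1) u)) =
    lam k * E (fun u => F' (proj ip d (n + k.+1) u)).
  have [_ _] := ibp_waves_tail (leqnn (n + k.+1)) bF dF bF'.
  rewrite subnn addnS ltnS leq_addl/= => /(_ 0 0) => i.
  transitivity (E (fun u => ip u (d k) * (cos (ip u 0 + 0) * F (tail_proj 0 (n + k).+1 u)))).
    by congr expect; apply/funext => u; rewrite (ip0r ip) addr0 cos0 mul1r projE.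
  rewrite i; congr (_ * expect _ _); apply/funext => u.
  by rewrite (ip0r ip) (ip0l ip) addr0 cos0 mul1r mul0r subr0 projE.
have proj_lip n u v : `|proj ip d n u - proj ip d n v| <= n%:R * `|u - v|.
  rewrite -sumrB (le_trans (ler_norm_sum _ _ _))// -[n in leRHS]card_ord -sum1_card.
  rewrite natr_sum mulr_suml ler_sum// => i _.
  rewrite -scalerBl -(ipBl ip) normrZ (le_trans (ler_wpM2r _ (ip_CS ip_norm _ _)))//.
  by rewrite (basis_norm ip_norm d_basis) !mulr1 mul1r.
have mH (H : U -> R) M : (forall u v, `|H u - H v| <= M * `|u - v|) -> forall n,
    measurable_fun setT ((fun u => H (proj ip d n u)) : borel U -> R).
  move=> HM n; apply: continuous_borel; apply: (@lip_continuous _ _ _ (`|M| * n%:R)) => u v.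
  rewrite (le_trans (HM _ _))// -mulrA (le_trans (ler_wpM2r _ (ler_norm M)))//.
  by rewrite ler_wpM2l.
have [_ c1] : L1 mu (fun u => ip u (d k) * F u) /\ E (fun u => ip u (d k) * F (proj ip d (n + k.+1) u)) @[n --> \oo] -->
   E (fun u => ip u (d k) * F u).
  apply: (expect_dct (G := fun u : borel U => K * `|ip u (d k)|)).
  - by move=> n; apply: measurable_funM; [exact: (ip_measurable ip_norm)|exact: mH FL _].
  - by move=> u; apply: cvgMr; exact: lim_proj FL.
  - exact/L1Z/L1_norm/L2_L1/L2x.
  - by move=> n u; rewrite normrM mulrC ler_wpM2r.
have [_ c2] : L1 mu F' /\ E (fun u => F' (proj ip d (n + k.+1) u)) @[n --> \oo] --> E F'.
  apply: (expect_dct (G := fun u : borel U => K')).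
  - by move=> n; exact: mH FL' _.
  - by move=> u; exact: lim_proj FL'.
  - exact/L1_Bm/Bm_cst.
  - by [].
rewrite (funext iF) in c1.
have c3 : lam k * E (fun u => F' (proj ip d (n + k.+1) u)) @[n --> \oo] --> lam k * E F'.
  by apply: cvgMr; exact: c2.
exact: (cvg_unique _ c1 c3).
Qed.

End gaussian_ibp.

(** * Weak derivatives *)

Lemma cvg_sumR (R : realType) I (s : seq I) (u : I -> nat -> R) (l : I -> R) :
  (forall i, u i n @[n --> \oo] --> l i) ->
  \sum_(i <- s) u i n @[n --> \oo] --> \sum_(i <- s) l i.
Proof.
move=> ul; elim: s => [|i s IHs].
  by under eq_fun do rewrite big_nil; rewrite big_nil; exact: cvg_cst.
by under eq_fun do rewrite big_cons; rewrite big_cons; apply: cvgD.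
Qed.

Lemma cvg_sqr (R : realType) (u : nat -> R) (l : R) :
  u n @[n --> \oo] --> l -> u n ^+ 2 @[n --> \oo] --> l ^+ 2.
Proof.
move=> ul; rewrite expr2 (_ : (fun n => _) = fun n => u n * u n); first exact: cvgM.
by apply/funext => n; rewrite expr2.
Qed.

Section weak_derivatives.
Context {R : realType} {U : completeNormedModType R}.
Variable ip : {dot U for idfun}.
Hypothesis ip_norm : forall u, ip u u = `|u| ^+ 2.
Variables (mu : probability (borel U) R) (Q : U -> U).
Hypothesis mu_gaussian : centered_gaussian ip mu.
Hypothesis mu_cov : covariance_operator ip mu Q.
Hypothesis Q_sym : forall u v, ip (Q u) v = ip u (Q v).
Variable d : nat -> U.
Hypothesis d_basis : orthonormal_basis ip d.
Variable lam : nat -> R.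
Hypothesis lam_gt0 : forall i, 0 < lam i.
Hypothesis Q_eigen : forall i, Q (d i) = lam i *: d i.

Notation E := (expect mu).
Local Notation D k F := ('D_(d k) F).

(** [delta k W W'] is the adjoint of the [k]-th derivative applied to [W], for a
    function [W] of derivative [W']. *)
Definition delta k (W W' : U -> R) (u : U) : R := ip u (d k) / lam k * W u - W' u.

(** The Gaussian integration by parts, taken as a definition of the derivative. *)
Definition weak_derivative k (X X' : borel U -> R) := [/\ L2 mu X, L2 mu X' &
  forall W, Cn d 1 W -> E (fun u => X' u * W u) = E (fun u => X u * delta k W (D k W) u)].

(** Test functions of polynomial growth, as dominated limits of bounded ones. *)
Definition admissible k (W W' : U -> R) := exists (Wn : nat -> U -> R) (A : borel U -> R),
  [/\ forall n, Cn d 1 (Wn n), forall u, Wn n u @[n --> \oo] --> W u,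
      forall u, D k (Wn n) u @[n --> \oo] --> W' u,
      L2 mu A /\ L2 mu (fun u => A u * ip u (d k)) &
      forall n u, `|Wn n u| <= A u /\ `|D k (Wn n) u| <= A u].

Let L2x h : L2 mu (fun u : borel U => ip u h).
Proof. exact: (L2_ip ip_norm mu_gaussian h). Qed.

Let L2xx h g : L2 mu (fun u : borel U => ip u h * ip u g).
Proof. exact: (L2_ip2 ip_norm mu_gaussian h g). Qed.

Lemma Cn_Bm n F : Cn d n F -> Bm (F : borel U -> R).
Proof. by move=> /Cn_BL; exact: BL_Bm. Qed.

Lemma L2_delta k W : Cn d 1 W -> L2 mu (delta k W (D k W)).
Proof.
move=> CW; apply: L2B; last exact/L2_Bm/(Cn_Bm (Cn_pd k CW)).
apply: L2MB; last exact: Cn_Bm CW.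
by under [X in L2 _ X]eq_fun do rewrite mulrC; exact: L2Z.
Qed.

Lemma weak_derivative_Cn k X : Cn d 1 X -> weak_derivative k X (D k X).
Proof.
move=> CX; split; [exact/L2_Bm/(Cn_Bm CX)|exact/L2_Bm/(Cn_Bm (Cn_pd k CX))|move=> W CW].
have CXW := CnM CX CW; have dXW := ddM (Cn_dd k CX) (Cn_dd k CW).
have bX := Cn_Bm CX; have bW := Cn_Bm CW.
have bX' := Cn_Bm (Cn_pd k CX); have bW' := Cn_Bm (Cn_pd k CW).
have := gaussian_ibp ip_norm mu_gaussian mu_cov Q_sym d_basis Q_eigen
  (Cn_BL CXW) (dXW) (BLD (BLM (Cn_BL CX) (Cn_BL (Cn_pd k CW)))
     (BLM (Cn_BL (Cn_pd k CX)) (Cn_BL CW))).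
rewrite expectD; [|exact/L1_Bm/BmM..] => i.
have l0 : lam k != 0 by rewrite gt_eqF.
transitivity (E (fun u => (lam k)^-1 * (ip u (d k) * (X u * W u)) - X u * D k W u)).
  rewrite expectB; first last.
  - exact/L1_Bm/BmM.
  - by apply: L1Z; apply: L1MB; [exact/L2_L1/L2x|exact: BmM].
  rewrite expectZ; last by apply: L1MB; [exact/L2_L1/L2x|exact: BmM].
  by rewrite i; field.
by congr expect; apply/funext => u; rewrite /delta; ring.
Qed.

(** Both sides of the defining identity are continuous in mean square. *)
Lemma weak_derivative_lim k (Xn Xn' : nat -> borel U -> R) X X' :
  (forall n, weak_derivative k (Xn n) (Xn' n)) -> L2 mu X -> L2 mu X' ->
  E (fun u => (Xn n u - X u) ^+ 2) @[n --> \oo] --> 0 ->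
  E (fun u => (Xn' n u - X' u) ^+ 2) @[n --> \oo] --> 0 -> weak_derivative k X X'.
Proof.
move=> wX X2 X'2 cX cX'; split=> // W CW.
have c1 : E (fun u => Xn' n u * W u) @[n --> \oo] --> E (fun u => X' u * W u).
  apply: expect_L2_cvg => // [n|]; first by case: (wX n).
  exact/L2_Bm/(Cn_Bm CW).
have c2 : E (fun u => Xn n u * delta k W (D k W) u) @[n --> \oo] -->
    E (fun u => X u * delta k W (D k W) u).
  apply: expect_L2_cvg => // [n|]; first by case: (wX n).
  exact: L2_delta.
have e n : E (fun u => Xn' n u * W u) = E (fun u => Xn n u * delta k W (D k W) u).
  by case: (wX n) => _ _; exact.
rewrite (funext e) in c1; exact: (cvg_unique _ c1 c2).
Qed.

Lemma weak_derivative_admissible k X X' W W' : weak_derivative k X X' ->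
  admissible k W W' -> E (fun u => X' u * W u) = E (fun u => X u * delta k W W' u).
Proof.
move=> [X2 X'2 wX] [Wn [A [CWn WnW WnW' [A2 Ax2] WA]]].
have lk : 0 <= (lam k)^-1 by rewrite invr_ge0 ltW.
have [mX _] := X2; have [mX' _] := X'2.
have mWn n := (Cn_Bm (CWn n)).1; have mWn' n := (Cn_Bm (Cn_pd k (CWn n))).1.
have [_ c1] : L1 mu (fun u => X' u * W u) /\
    E (fun u => X' u * Wn n u) @[n --> \oo] --> E (fun u => X' u * W u).
  apply: (expect_dct (G := fun u : borel U => `|X' u| * `|A u|)).
  - by move=> n; exact: measurable_funM.
  - by move=> u; apply: cvgMr; exact: WnW.
  - by apply: L2M; exact: L2_norm.
  - move=> n u; rewrite normrM ler_wpM2l// (le_trans (WA n u).1)//; exact: ler_norm.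
have mx : measurable_fun setT ((fun u => ip u (d k) / lam k) : borel U -> R).
  by apply: measurable_funM => //; exact: (ip_measurable ip_norm).
have [_ c2] : L1 mu (fun u => X u * delta k W W' u) /\
    E (fun u => X u * delta k (Wn n) (D k (Wn n)) u) @[n --> \oo] -->
    E (fun u => X u * delta k W W' u).
  apply: (expect_dct (G := fun u : borel U =>
    `|X u| * ((lam k)^-1 * `|A u * ip u (d k)| + `|A u|))).
  - move=> n; apply: measurable_funM => //; apply: measurable_funB => //.
    exact: measurable_funM.
  - move=> u; apply: cvgMr; apply: cvgB; last exact: WnW'.
    by apply: cvgMr; exact: WnW.
  - apply: L2M; first exact: L2_norm.
    by apply: L2D; [apply: L2Z; exact: L2_norm|exact: L2_norm].
  - move=> n u; rewrite normrM ler_wpM2l// (le_trans (ler_normB _ _))// lerD//.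
      rewrite !normrM (ger0_norm lk) mulrAC mulrC ler_wpM2l// mulrC ler_wpM2r//.
      by rewrite (le_trans (WA n u).1)// ler_norm.
    by rewrite (le_trans (WA n u).2)// ler_norm.
have e n : E (fun u => X' u * Wn n u) = E (fun u => X u * delta k (Wn n) (D k (Wn n)) u).
  exact: wX.
rewrite (funext e) in c1; exact: (cvg_unique _ c1 c2).
Qed.

Lemma admissible_Cn k W : Cn d 1 W -> admissible k W (D k W).
Proof.
move=> CW; have [K [K0 WK _]] := BL_ge0 (Cn_BL CW).
have [L [L0 WL _]] := BL_ge0 (Cn_BL (Cn_pd k CW)).
exists (fun=> W), (fun=> K + L); split => // [u|u||n u].
- exact: cvg_cst.
- exact: cvg_cst.
- by split; [exact/L2_Bm/Bm_cst|exact: L2Z].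
- by split; [rewrite (le_trans (WK u))// lerDl|rewrite (le_trans (WL u))// lerDr].
Qed.

Lemma admissibleD k W W' V V' : admissible k W W' -> admissible k V V' ->
  admissible k (fun u => W u + V u) (fun u => W' u + V' u).
Proof.
move=> [Wn [A [CWn cW cW' [A2 Ax2] WA]]] [Vn [B [CVn cV cV' [B2 Bx2] VB]]].
exists (fun n u => Wn n u + Vn n u), (fun u => A u + B u).
have e n : D k (fun u => Wn n u + Vn n u) = fun u => D k (Wn n) u + D k (Vn n) u.
  by apply: pd_eq; apply: ddD; [exact: Cn_dd (CWn n)|exact: Cn_dd (CVn n)].
have eu n u : D k (fun u => Wn n u + Vn n u) u = D k (Wn n) u + D k (Vn n) u.
  exact: (congr1 (fun f : U -> R => f u) (e n)).
split => [n|u|u||n u].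
- exact: CnD.
- exact: cvgD.
- have -> : (fun n => D k (fun u => Wn n u + Vn n u) u) = fun n => D k (Wn n) u + D k (Vn n) u.
    by apply/funext => n; rewrite eu.
  exact: cvgD.
- split; first exact: L2D.
  by under [X in L2 _ X]eq_fun do rewrite mulrDl; exact: L2D.
- have [w1 w2] := WA n u; have [v1 v2] := VB n u; rewrite eu.
  by split; rewrite (le_trans (ler_normD _ _))// lerD.
Qed.

Lemma admissibleZ k c W W' : admissible k W W' ->
  admissible k (fun u => c * W u) (fun u => c * W' u).
Proof.
move=> [Wn [A [CWn cW cW' [A2 Ax2] WA]]].
exists (fun n u => c * Wn n u), (fun u => `|c| * A u).
have e n : D k (fun u => c * Wn n u) = fun u => c * D k (Wn n) u.
  by apply: pd_eq; apply: ddZ; exact: Cn_dd (CWn n).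
have eu n u : D k (fun u => c * Wn n u) u = c * D k (Wn n) u.
  exact: (congr1 (fun f : U -> R => f u) (e n)).
split => [n|u|u||n u].
- exact: CnZ.
- exact: cvgMr.
- have -> : (fun n => D k (fun u => c * Wn n u) u) = fun n => c * D k (Wn n) u.
    by apply/funext => n; rewrite eu.
  exact: cvgMr.
- split; first exact: L2Z.
  by under [X in L2 _ X]eq_fun do rewrite -mulrA; exact: L2Z.
- by have [w1 w2] := WA n u; rewrite eu !normrM; split; rewrite ler_wpM2l.
Qed.

(** The coordinate is replaced by its truncation, whose derivative is a cosine
    bounded by 1 and tending to 1. *)
Lemma admissible_ip k i G : Cn d 1 G ->
  admissible k (fun u => ip u (d i) * G u)
    (fun u => ip u (d i) * D k G u + (k == i)%:R * G u).
Proof.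
move=> CG; have [K [K0 GK _]] := BL_ge0 (Cn_BL CG).
have [L [L0 GL _]] := BL_ge0 (Cn_BL (Cn_pd k CG)).
pose Wn n u := trunc n (ip u (d i)) * G u.
have Ct n : Cn d 1 (fun u => trunc n (ip u (d i))).
  apply: (Cn_trunc n (ip_lip ip_norm (d i))) => j.
  by exists (fun=> ip (d j) (d i)); [exact: dd_ip|exact: BL_cst].
have e n : D k (Wn n) = fun u => trunc n (ip u (d i)) * D k G u +
    cos (ip u (d i) / n.+1%:R) * (k == i)%:R * G u.
  apply: pd_eq; apply: ddM (Cn_dd k CG).
  rewrite -(basis_ip d_basis).
  exact: (dd_comp (g' := fun x => cos (x / n.+1%:R))
    (fun u => is_derive_trunc n (ip u (d i))) (dd_ip ip (d k) (d i))).
have eu n u : D k (Wn n) u = trunc n (ip u (d i)) * D k G u +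
    cos (ip u (d i) / n.+1%:R) * (k == i)%:R * G u.
  exact: (congr1 (fun f : U -> R => f u) (e n)).
exists Wn, (fun u => (K + L) * (1 + `|ip u (d i)|)); split => [n|u|u||n u].
- exact: CnM.
- by apply: cvgMl; exact: trunc_cvg.
- have -> : (fun n => D k (Wn n) u) = fun n => trunc n (ip u (d i)) * D k G u +
      cos (ip u (d i) / n.+1%:R) * (k == i)%:R * G u.
    by apply/funext => n; rewrite eu.
  apply: cvgD.
    by apply: cvgMl; exact: trunc_cvg.
  apply: cvgMl; rewrite -[X in _ --> X]mul1r; apply: cvgMl; exact: cos_trunc_cvg.
- split.
    by apply: L2Z; apply: L2D; [exact/L2_Bm/Bm_cst|exact: L2_norm].
  under [X in L2 _ X]eq_fun do rewrite -mulrA [(1 + _) * _]mulrDl mul1r.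
  apply: L2Z; apply: L2D => //.
  have [mxx ixx] := L2xx (d i) (d k).
  split.
    apply: measurable_funM; last exact: (ip_measurable ip_norm).
    by apply: measurableT_comp => //; exact: (ip_measurable ip_norm).
  under [X in L1 _ X]eq_fun do rewrite exprMn real_normK ?num_real// -exprMn.
  exact: ixx.
- have t1 := trunc_le n (ip u (d i)); split.
    rewrite normrM mulrC ler_pM//; first by rewrite (le_trans (GK u))// lerDl.
    by rewrite (le_trans t1)// lerDr.
  rewrite eu (le_trans (ler_normD _ _))// mulrDr mulr1 addrC lerD//.
    rewrite !normrM (@le_trans _ _ (1 * 1 * K))//; last by rewrite !mul1r lerDl.
    rewrite ler_pM ?mulr_ge0// ler_pM ?cos_max//.
    by case: eqP; rewrite ?normr1 ?normr0.
  rewrite (normrM (trunc n (ip u (d i)))) mulrC ler_pM//.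
  by rewrite (le_trans (GL u))// lerDr.
Qed.

(** Globally Lipschitz functions with Lipschitz derivatives, by truncation. *)
Lemma weak_derivative_lip k Y Y' K : (forall u v, `|Y u - Y v| <= K * `|u - v|) ->
  (forall j, dd (d j) Y (Y' j) /\ BL (Y' j)) -> L2 mu Y ->
  weak_derivative k Y (Y' k).
Proof.
move=> YK dY Y2; have [mY iY] := Y2.
have bY' : Bm (Y' k : borel U -> R) by apply: BL_Bm; exact: (dY k).2.
have Ct n : Cn d 1 (fun u => trunc n (Y u)).
  by apply: (Cn_trunc n YK) => j; have [? ?] := dY j; exists (Y' j).
have e n : D k (fun u => trunc n (Y u)) = fun u => cos (Y u / n.+1%:R) * Y' k u.
  apply: pd_eq; exact: (dd_comp (g' := fun x => cos (x / n.+1%:R))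
    (fun u => is_derive_trunc n (Y u)) (dY k).1).
apply: (@weak_derivative_lim k (fun n u => trunc n (Y u))
    (fun n u => cos (Y u / n.+1%:R) * Y' k u)) => //.
- by move=> n; rewrite -e; exact: weak_derivative_Cn.
- exact/L2_Bm.
- have [_] : L1 mu (fun=> 0) /\ E (fun u => (trunc n (Y u) - Y u) ^+ 2) @[n --> \oo] --> E (fun=> 0).
    apply: (expect_dct (G := fun u : borel U => 4 * Y u ^+ 2)).
    + move=> n; apply: measurable_funX; apply: measurable_funB => //.
      exact: (Cn_Bm (Ct n)).1.
    + move=> u; rewrite [X in _ --> X](_ : 0 = (Y u - Y u) ^+ 2); last by rewrite subrr expr0n.
      by apply: cvg_sqr; apply: cvgB; [exact: trunc_cvg|exact: cvg_cst].
    + exact: L1Z.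
    + move=> n u; rewrite normrX -[Y u ^+ 2]real_normK ?num_real//.
      have -> : 4 * `|Y u| ^+ 2 = (`|Y u| + `|Y u|) ^+ 2 by ring.
      rewrite ler_sqr ?nnegrE ?addr_ge0// (le_trans (ler_normB _ _))// lerD2r.
      exact: trunc_le.
  by rewrite expect_cst.
- have mY' := bY'.1.
  have mc n : measurable_fun setT ((fun u => cos (Y u / n.+1%:R)) : borel U -> R).
    by have [] := @Bm_cos _ _ R (fun u : borel U => Y u / n.+1%:R) (measurable_funM mY (measurable_cst _)).
  have [_] : L1 mu (fun=> 0) /\ E (fun u => (cos (Y u / n.+1%:R) * Y' k u - Y' k u) ^+ 2)
      @[n --> \oo] --> E (fun=> 0).
    apply: (expect_dct (G := fun u : borel U => 4 * Y' k u ^+ 2)).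
    + move=> n; apply: measurable_funX; apply: measurable_funB => //.
      exact: measurable_funM.
    + move=> u; rewrite [X in _ --> X](_ : 0 = (1 * Y' k u - Y' k u) ^+ 2); last first.
        by rewrite mul1r subrr expr0n.
      apply: cvg_sqr; apply: cvgB; last exact: cvg_cst.
      by apply: cvgMl; exact: cos_trunc_cvg.
    + by apply: L1Z; apply: L1_Bm; under [X in Bm X]eq_fun do rewrite expr2; exact: BmM.
    + move=> n u; rewrite normrX -[Y' k u ^+ 2]real_normK ?num_real//.
      have -> : 4 * `|Y' k u| ^+ 2 = (`|Y' k u| + `|Y' k u|) ^+ 2 by ring.
      rewrite ler_sqr ?nnegrE ?addr_ge0// (le_trans (ler_normB _ _))// lerD2r.
      by rewrite normrM ler_piMl// cos_max.
  by rewrite expect_cst.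
Qed.

End weak_derivatives.

Section regularized_exponential.
Context {R : realType}.
Variable e : R.
Hypothesis e_gt0 : 0 < e.

(** A bounded smooth substitute for [exp(-x)], recovered as [e] goes to 0. *)
Definition psi (x : R) := (expR x + e)^-1.
Definition dpsi (x : R) := - (expR x * (expR x + e) ^- 2).

Let den x : 0 < expR x + e. Proof. by rewrite addr_gt0// expR_gt0. Qed.

Lemma psi_ge0 x : 0 <= psi x. Proof. by rewrite invr_ge0 ltW. Qed.

Lemma psi_le x : psi x <= e^-1.
Proof. by rewrite lef_pV2 ?posrE// lerDr expR_ge0. Qed.

Lemma psi_le_exp x : psi x <= expR (- x).
Proof. by rewrite expRN lef_pV2 ?posrE ?expR_gt0// lerDl ltW. Qed.

Lemma dpsi_norm x : `|dpsi x| = expR x * psi x * psi x.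
Proof.
rewrite /dpsi normrN ger0_norm; last by rewrite mulr_ge0 ?expR_ge0// invr_ge0 exprn_ge0// ltW.
by rewrite /psi -mulrA -invfM -expr2.
Qed.

Lemma exp_psi_le1 x : expR x * psi x <= 1.
Proof. by rewrite ler_pdivrMr// mul1r lerDl ltW. Qed.

Lemma dpsi_le_psi x : `|dpsi x| <= psi x.
Proof. by rewrite dpsi_norm ler_piMl ?psi_ge0// exp_psi_le1. Qed.

Lemma is_derive_psi (x : R) : is_derive x 1 psi (dpsi x).
Proof.
have dn : is_derive x 1 (fun x => expR x + e) (expR x).
  by apply: is_derive_eq; rewrite addr0.
have := is_deriveV (f := fun x => expR x + e) (lt0r_neq0 (den x)) dn.
by rewrite /GRing.scale/= /dpsi mulNr mulrC.
Qed.

Let ddpsi x := - (expR x * psi x ^+ 2) + 2 * (expR x * psi x) * (expR x * psi x) * psi x.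

Let is_derive_dpsi (x : R) : is_derive x 1 dpsi (ddpsi x).
Proof.
have -> : dpsi = fun x => - (expR x * psi x ^+ 2).
  by apply/funext => y; rewrite /dpsi /psi exprVn.
have dp := is_derive_psi x.
apply: is_derive_eq; rewrite /GRing.scale/= /ddpsi /dpsi /psi ?expr1 -exprVn; by ring.
Qed.

Lemma psi_lip x y : `|psi x - psi y| <= e^-1 * `|x - y|.
Proof.
apply: (mean_value_le x y is_derive_psi) => z.
by rewrite (le_trans (dpsi_le_psi z))// psi_le.
Qed.

Lemma dpsi_lip x y : `|dpsi x - dpsi y| <= 3 * e^-1 * `|x - y|.
Proof.
apply: (mean_value_le x y is_derive_dpsi) => z; rewrite /ddpsi.
have p0 := psi_ge0 z; have p1 := psi_le z; have s1 := exp_psi_le1 z.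
have s0 : 0 <= expR z * psi z by rewrite mulr_ge0 ?expR_ge0.
rewrite (_ : expR z * psi z ^+ 2 = (expR z * psi z) * psi z); last by ring.
set q := expR z * psi z in s0 s1 *.
rewrite (le_trans (ler_normD _ _))// normrN !ger0_norm ?mulr_ge0//.
have := ler_piMl p0 s1; have : 2 * q * q * psi z <= 2 * psi z.
  by rewrite ler_wpM2r//; nra.
lra.
Qed.

Lemma measurable_psi : measurable_fun setT psi.
Proof. by apply: continuous_measurable_fun; exact: is_derive_continuous is_derive_psi. Qed.

Lemma measurable_dpsi : measurable_fun setT dpsi.
Proof. by apply: continuous_measurable_fun; exact: is_derive_continuous is_derive_dpsi. Qed.

End regularized_exponential.

(** * The chain rule for [exp(-X)] *)

Lemma cvg_ge0 (R : realType) (u : nat -> R) (l : R) :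
  u n @[n --> \oo] --> l -> (forall n, 0 <= u n) -> 0 <= l.
Proof.
move=> ul u0; rewrite -(cvg_lim (@norm_hausdorff _ _) ul); apply: limr_ge.
  by apply/cvg_ex; exists l.
exact: nearW.
Qed.

Lemma expect_cvg d (T : measurableType d) (R : realType) (mu : probability T R)
    (Fn : nat -> T -> R) (F G : T -> R) :
  (forall n, measurable_fun setT (Fn n)) ->
  (forall x, Fn n x @[n --> \oo] --> F x) -> L1 mu G ->
  (forall n x, `|Fn n x| <= G x) -> expect mu (Fn n) @[n --> \oo] --> expect mu F.
Proof. by move=> mF FnF iG FG; have [] := expect_dct mF FnF iG FG. Qed.

Lemma Cn_psi (R : realType) (U : completeNormedModType R) (d : nat -> U) n (e : R) F :
  0 < e -> Cn d n F -> Cn d n (fun u => psi e (F u)).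
Proof.
move=> e0 CF; apply: (Cn_inv e0) => [u|]; first by rewrite lerDr expR_ge0.
by apply: CnD; [exact: Cn_expR|exact: Cn_cst].
Qed.

Section boltzmann.
Context {R : realType} {U : completeNormedModType R}.
Variable ip : {dot U for idfun}.
Hypothesis ip_norm : forall u, ip u u = `|u| ^+ 2.
Variables (mu : probability (borel U) R) (Q : U -> U).
Hypothesis mu_gaussian : centered_gaussian ip mu.
Hypothesis mu_cov : covariance_operator ip mu Q.
Hypothesis Q_sym : forall u v, ip (Q u) v = ip u (Q v).
Variable d : nat -> U.
Hypothesis d_basis : orthonormal_basis ip d.
Variable lam : nat -> R.
Hypothesis lam_gt0 : forall i, 0 < lam i.
Hypothesis Q_eigen : forall i, Q (d i) = lam i *: d i.

Notation E := (expect mu).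
Local Notation D k F := ('D_(d k) F).

Variables (Xn : nat -> U -> R) (X : borel U -> R) (X_ : nat -> borel U -> R) (m : R).
Hypothesis Xn_smooth : forall n l, Cn d l (Xn n).
Hypothesis X_L2 : L2 mu X.
Hypothesis X_L2' : forall k, L2 mu (X_ k).
Hypothesis Xn_cvg : E (fun u => (Xn n u - X u) ^+ 2) @[n --> \oo] --> 0.
Hypothesis Xn_cvg' : forall k, E (fun u => (D k (Xn n) u - X_ k u) ^+ 2) @[n --> \oo] --> 0.
Hypothesis X_ge : forall u, m <= X u.

Definition rho (u : borel U) : R := expR (- X u).

Let mX : measurable_fun setT X. Proof. by case: X_L2. Qed.

Let XnX n : L2 mu (fun u => Xn n u - X u).
Proof. by apply: L2B => //; apply: L2_Bm; exact: Cn_Bm (Xn_smooth n 0). Qed.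

Let XnX' n k : L2 mu (fun u => D k (Xn n) u - X_ k u).
Proof. by apply: L2B => //; apply: L2_Bm; exact: Cn_Bm (Cn_pd k (Xn_smooth n 1)). Qed.

Lemma rho_le u : rho u <= expR (- m). Proof. by rewrite ler_expR lerN2. Qed.

Lemma Bm_rho : Bm rho.
Proof.
split; first by apply: measurableT_comp => //; apply: measurable_funN.
by exists (expR (- m)) => u; rewrite ger0_norm ?expR_ge0// rho_le.
Qed.

Lemma weak_derivative_X k : weak_derivative ip mu d lam k X (X_ k).
Proof.
apply: (weak_derivative_lim ip_norm mu_gaussian (Xn := Xn) (Xn' := fun n => D k (Xn n))) => //.
move=> n; exact: (weak_derivative_Cn ip_norm mu_gaussian mu_cov Q_sym d_basis lam_gt0 Q_eigen k (Xn_smooth n 1)).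
Qed.

Section fixed_regularization.
Variable e : R.
Hypothesis e_gt0 : 0 < e.

Let ie0 : 0 <= e^-1. Proof. by rewrite invr_ge0 ltW. Qed.

Let Bm_dpsi (Y : borel U -> R) : measurable_fun setT Y -> Bm (fun u => dpsi e (Y u)).
Proof.
move=> mY; split; first by apply: measurableT_comp => //; exact: measurable_dpsi.
by exists e^-1 => u; rewrite (le_trans (dpsi_le_psi e_gt0 _))// psi_le.
Qed.

Let mXn n : measurable_fun setT (Xn n : borel U -> R).
Proof. exact: (Cn_Bm (Xn_smooth n 0)).1. Qed.

Let lip_cvg (g : R -> R) L K : 0 <= L -> (forall x y, `|g x - g y| <= L * `|x - y|) ->
  (forall x, `|g x| <= K) -> measurable_fun setT g -> forall A, L1 mu A ->
  E (fun u => A u * g (Xn n u)) @[n --> \oo] --> E (fun u => A u * g (X u)).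
Proof.
move=> L0 gL gK mg A iA.
have bg (Y : borel U -> R) : measurable_fun setT Y -> Bm (fun u => g (Y u)).
  by move=> mY; split; [exact: measurableT_comp|exists K].
have bgX := bg _ mX; have bgXn n := bg _ (mXn n).
have bdiff n : Bm (fun u : borel U => g (Xn n u) - g (X u)) by exact: BmB.
apply/subr_cvg0.
have -> : (fun n => E (fun u => A u * g (Xn n u)) - E (fun u => A u * g (X u))) =
    fun n => E (fun u => A u * (g (Xn n u) - g (X u))).
  apply/funext => n; rewrite -expectB; [|exact: L1MB..].
  by congr expect; apply/funext => u; rewrite mulrBr.
apply: (expect_L1_bounded_cvg iA (C := K + K)) => [n|n u|].
- by case: (bdiff n).
- by rewrite (le_trans (ler_normB _ _))// lerD.
apply: (@squeeze_cvgr _ _ _ _ (cst 0) (fun n => L ^+ 2 * E (fun u => (Xn n u - X u) ^+ 2))).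
- apply: nearW => n; apply/andP; split; first by apply: expect_ge0 => u; exact: sqr_ge0.
  have [_ iXX] := XnX n.
  rewrite -expectZ//; apply: expect_le; [|exact: L1Z|].
    by apply: L1_Bm; under [X in Bm X]eq_fun do rewrite expr2; exact: BmM.
  move=> u; rewrite -exprMn -(real_normK (num_real (_ - g _))).
  rewrite -[leRHS](real_normK (num_real _)) ler_sqr ?nnegrE//.
  by rewrite normrM (ger0_norm L0).
- exact: cvg_cst.
- by rewrite -(mulr0 (L ^+ 2)); apply: cvgMr; exact: Xn_cvg.
Qed.

Lemma psi_cvg A : L1 mu A ->
  E (fun u => A u * psi e (Xn n u)) @[n --> \oo] --> E (fun u => A u * psi e (X u)).
Proof.
apply: (lip_cvg ie0 (psi_lip e_gt0) (K := e^-1)); last exact: measurable_psi.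
by move=> x; rewrite ger0_norm ?psi_ge0// psi_le.
Qed.

(** The mean-square convergence of the derivatives is used against [H], that of
    the functions against the integrable product [H X_ k]. *)
Lemma dpsi_cvg H k : L2 mu H ->
  E (fun u => H u * (dpsi e (Xn n u) * D k (Xn n) u)) @[n --> \oo] -->
  E (fun u => H u * (dpsi e (X u) * X_ k u)).
Proof.
move=> H2; have iHX := L2M H2 (X_L2' k).
have H'2 n : L2 mu (fun u => H u * dpsi e (Xn n u)) by apply: L2MB => //; exact: Bm_dpsi.
have i1 n := L2M (H'2 n) (XnX' n k).
have i2 n : L1 mu (fun u => (H u * X_ k u) * dpsi e (Xn n u)).
  by apply: L1MB => //; exact: Bm_dpsi.
have dK x : `|dpsi e x| <= e^-1 by rewrite (le_trans (dpsi_le_psi e_gt0 _))// psi_le.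
have c2 := lip_cvg (mulr_ge0 (ler0n _ 3) ie0) (dpsi_lip e_gt0) dK (measurable_dpsi e_gt0) iHX.
have c1 : E (fun u => (H u * dpsi e (Xn n u)) * (D k (Xn n) u - X_ k u)) @[n --> \oo] --> 0.
  apply: sqr_cvg0; apply: (@squeeze_cvgr _ _ _ _ (cst 0) (fun n =>
      (e^-1 ^+ 2 * E (fun u => H u ^+ 2)) * E (fun u => (D k (Xn n) u - X_ k u) ^+ 2))).
  - apply: nearW => n; rewrite sqr_ge0/= (le_trans (expect_CS (H'2 n) (XnX' n k)))//.
    rewrite ler_wpM2r//; first by apply: expect_ge0 => u; exact: sqr_ge0.
    have [_ iH] := H2; have [_ iH'] := H'2 n.
    rewrite -expectZ//; apply: expect_le => //; first exact: L1Z.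
    move=> u; rewrite exprMn mulrC ler_wpM2r ?sqr_ge0//.
    by rewrite -(real_normK (num_real (dpsi _ _))) ler_sqr ?nnegrE.
  - exact: cvg_cst.
  - by rewrite -[X in _ --> X](mulr0 (e^-1 ^+ 2 * E (fun u => H u ^+ 2))); apply: cvgMr; exact: Xn_cvg'.
rewrite (_ : (fun n => _) = fun n =>
    E (fun u => (H u * dpsi e (Xn n u)) * (D k (Xn n) u - X_ k u)) +
    E (fun u => (H u * X_ k u) * dpsi e (Xn n u))); last first.
  by apply/funext => n; rewrite -expectD//; congr expect; apply/funext => u; ring.
rewrite (_ : E _ = 0 + E (fun u => H u * X_ k u * dpsi e (X u))); first exact: cvgD.
by rewrite add0r; congr expect; apply/funext => u; ring.
Qed.

End fixed_regularization.

Let e_ (n : nat) : R := n.+1%:R^-1.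
Let e_gt0 n : 0 < e_ n. Proof. by rewrite invr_gt0. Qed.

Let den_cvg x : expR x + e_ n @[n --> \oo] --> expR x.
Proof.
rewrite -[X in _ --> X]addr0; apply: cvgD; first exact: cvg_cst.
exact: cvg_harmonic.
Qed.

Let psi_e_cvg x : psi (e_ n) x @[n --> \oo] --> expR (- x).
Proof.
rewrite expRN; apply: cvgV; first by rewrite gt_eqF// expR_gt0.
exact: den_cvg.
Qed.

Let dpsi_e_cvg x : dpsi (e_ n) x @[n --> \oo] --> - expR (- x).
Proof.
have -> : - expR (- x) = - (expR x * expR (- x) ^+ 2).
  by rewrite expRN expr2 mulrA divff ?mul1r// gt_eqF// expR_gt0.
have -> : (fun n => dpsi (e_ n) x) = fun n => - (expR x * psi (e_ n) x ^+ 2).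
  by apply/funext => n; rewrite /dpsi /psi exprVn.
by apply: cvgN; apply: cvgMr; apply: cvg_sqr; exact: psi_e_cvg.
Qed.

Lemma psi_rho_cvg A : L1 mu A ->
  E (fun u => A u * psi (e_ n) (X u)) @[n --> \oo] --> E (fun u => A u * rho u).
Proof.
move=> iA; apply: (expect_cvg (G := fun u => expR (- m) * `|A u|)) => [n|u||n u].
- apply: measurable_funM; first exact: L1_meas iA.
  by apply: measurableT_comp => //; exact: measurable_psi.
- by apply: cvgMr; exact: psi_e_cvg.
- exact/L1Z/L1_norm.
- rewrite normrM mulrC ler_wpM2r// ger0_norm ?psi_ge0//.
  exact: le_trans (psi_le_exp (e_gt0 n) _) (rho_le u).
Qed.

Lemma dpsi_rho_cvg A : L1 mu A ->
  E (fun u => A u * dpsi (e_ n) (X u)) @[n --> \oo] --> E (fun u => A u * - rho u).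
Proof.
move=> iA; apply: (expect_cvg (G := fun u => expR (- m) * `|A u|)) => [n|u||n u].
- apply: measurable_funM; first exact: L1_meas iA.
  by apply: measurableT_comp => //; exact: measurable_dpsi.
- by apply: cvgMr; exact: dpsi_e_cvg.
- exact/L1Z/L1_norm.
- rewrite normrM mulrC ler_wpM2r// (le_trans (dpsi_le_psi (e_gt0 n) _))//.
  exact: le_trans (psi_le_exp (e_gt0 n) _) (rho_le u).
Qed.

Let D_psi n l k : D k (fun u => psi (e_ n) (Xn l u)) =
  fun u => dpsi (e_ n) (Xn l u) * D k (Xn l) u.
Proof.
apply: pd_eq; apply: dd_comp (Cn_dd k (Xn_smooth l 1)) => u.
exact: is_derive_psi.
Qed.

Let Cpsi n l r : Cn d r (fun u => psi (e_ n) (Xn l u)).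
Proof. by apply: Cn_psi. Qed.

(** The chain rule holds for [psi e] of the smooth approximations; it passes to
    the limit first in the approximation, then in [e]. *)
Lemma weak_derivative_rho k : weak_derivative ip mu d lam k rho (fun u => - (rho u * X_ k u)).
Proof.
split; [exact/L2_Bm/Bm_rho|by apply: L2N; apply: L2BM => //; exact: Bm_rho|move=> W CW].
have bW : Bm (W : borel U -> R) := Cn_Bm CW.
have i1 : L1 mu (fun u => X_ k u * W u) by apply: L1MB => //; exact: L2_L1.
have i2 : L1 mu (delta ip d lam k W (D k W)).
  by apply: L2_L1; exact: (L2_delta ip_norm mu_gaussian).
have step n : E (fun u => (X_ k u * W u) * dpsi (e_ n) (X u)) =
    E (fun u => delta ip d lam k W (D k W) u * psi (e_ n) (X u)).
  have c1 := dpsi_cvg (k := k) (e_gt0 n) (L2_Bm mu bW).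
  have c2 := psi_cvg (e_gt0 n) i2.
  have eq l : E (fun u => W u * (dpsi (e_ n) (Xn l u) * D k (Xn l) u)) =
      E (fun u => delta ip d lam k W (D k W) u * psi (e_ n) (Xn l u)).
    have [_ _ w] := weak_derivative_Cn ip_norm mu_gaussian mu_cov Q_sym d_basis
      lam_gt0 Q_eigen k (Cpsi n l 1).
    transitivity (E (fun u => D k (fun u => psi (e_ n) (Xn l u)) u * W u)).
      congr expect; apply/funext => u.
      by rewrite [in RHS](congr1 (fun f : U -> R => f u) (D_psi n l k)) mulrC.
    by rewrite w//; congr expect; apply/funext => u; rewrite mulrC.
  rewrite (funext eq) in c1.
  transitivity (E (fun u => W u * (dpsi (e_ n) (X u) * X_ k u))).
    by congr expect; apply/funext => u; ring.
  exact: (cvg_unique _ c1 c2).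
have c1 := dpsi_rho_cvg i1; rewrite (funext step) in c1.
have c2 := psi_rho_cvg i2.
transitivity (E (fun u => X_ k u * W u * - rho u)).
  by congr expect; apply/funext => u; ring.
transitivity (E (fun u => delta ip d lam k W (D k W) u * rho u)).
  exact: (cvg_unique _ c1 c2).
by congr expect; apply/funext => u; rewrite mulrC.
Qed.

(** The densities [eta] used are [psi e] of the smooth approximations of [X]; in
    the limit the derivative of [eta] becomes the term [X_ i (V_i V_j)]. *)
Lemma convexity_rho (s : seq nat) (V : nat -> U -> R) : (forall i, Cn d 2 (V i)) ->
  (forall eta, Cn d 2 eta -> (forall u, 0 <= eta u) ->
    0 <= \sum_(i <- s) \sum_(j <- s) E (fun u => X_ j u *
      delta ip d lam i (fun u => eta u * (V i u * V j u))
        (D i (fun u => eta u * (V i u * V j u))) u)) ->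
  0 <= \sum_(i <- s) \sum_(j <- s) E (fun u => rho u * X_ j u *
      (delta ip d lam i (fun u => V i u * V j u) (D i (fun u => V i u * V j u)) u
       + X_ i u * (V i u * V j u))).
Proof.
move=> CV pos; pose G i j u := V i u * V j u.
have CG i j : Cn d 2 (G i j) by exact: CnM.
have bG i j : Bm (G i j : borel U -> R) := Cn_Bm (CG i j).
pose A i j (u : borel U) := X_ j u * delta ip d lam i (G i j) (D i (G i j)) u.
pose H i j (u : borel U) := X_ j u * G i j u.
have iA i j : L1 mu (A i j).
  by apply: L2M => //; apply: (L2_delta ip_norm mu_gaussian); exact: CnS (CG i j).
have H2 i j : L2 mu (H i j) by apply: L2MB.
have iHX i j : L1 mu (fun u => H i j u * X_ i u) by apply: L2M.
have pos1 n l : 0 <= \sum_(i <- s) \sum_(j <- s) (E (fun u => A i j u * psi (e_ n) (Xn l u))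
    - E (fun u => H i j u * (dpsi (e_ n) (Xn l u) * D i (Xn l) u))).
  have := pos _ (Cpsi n l 2) (fun u => psi_ge0 (e_gt0 n) _).
  congr (0 <= _); apply: eq_bigr => i _; apply: eq_bigr => j _.
  rewrite -expectB; first last.
  - apply: L2M => //; apply: L2_Bm; rewrite -(D_psi n l i).
    exact: Cn_Bm (Cn_pd i (Cpsi n l 1)).
  - by apply: L1MB => //; exact: Cn_Bm (Cpsi n l 0).
  congr expect; apply/funext => u; rewrite /delta /A /H /delta.
  have dG : dd (d i) (fun u => psi (e_ n) (Xn l u) * G i j u) _ :=
    ddM (Cn_dd i (Cpsi n l 1)) (Cn_dd i (CG i j)).
  rewrite [X in _ * (_ - X)](congr1 (fun f : U -> R => f u) (pd_eq dG)).
  rewrite [X in _ * (_ - (_ + X * _))](congr1 (fun f : U -> R => f u) (D_psi n l i)).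
  by rewrite /G; ring.
have pos2 n : 0 <= \sum_(i <- s) \sum_(j <- s) (E (fun u => A i j u * psi (e_ n) (X u))
    - E (fun u => H i j u * (dpsi (e_ n) (X u) * X_ i u))).
  apply: cvg_ge0 (pos1 n); apply: cvg_sumR => i; apply: cvg_sumR => j; apply: cvgB.
    exact: psi_cvg.
  exact: dpsi_cvg.
have pos3 : 0 <= \sum_(i <- s) \sum_(j <- s) (E (fun u => A i j u * rho u)
    - E (fun u => (H i j u * X_ i u) * - rho u)).
  apply: (@cvg_ge0 _ (fun n => \sum_(i <- s) \sum_(j <- s)
      (E (fun u => A i j u * psi (e_ n) (X u))
    - E (fun u => (H i j u * X_ i u) * dpsi (e_ n) (X u))))) => [|n].
    apply: cvg_sumR => i; apply: cvg_sumR => j; apply: cvgB.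
      exact: psi_rho_cvg.
    exact: dpsi_rho_cvg.
  have := pos2 n; congr (0 <= _); apply: eq_bigr => i _; apply: eq_bigr => j _.
  by congr (_ - expect _ _); apply/funext => u; ring.
rewrite (le_trans pos3)// le_eqVlt; apply/orP; left; apply/eqP.
apply: eq_bigr => i _; apply: eq_bigr => j _; rewrite -expectB; first last.
- by apply: L1MB => //; apply: BmN; exact: Bm_rho.
- by apply: L1MB => //; exact: Bm_rho.
by congr expect; apply/funext => u; rewrite /A /H /G; ring.
Qed.

End boltzmann.

(** * Convex functions as suprema of affine functions *)

Section convex_functions.
Context {R : realType} {U : completeNormedModType R}.
Variable ip : {dot U for idfun}.
Hypothesis ip_norm : forall u, ip u u = `|u| ^+ 2.
Variables (Phi : U -> \bar R) (M : R).
Hypothesis Phi_convex : convex_ereal Phi.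
Hypothesis Phi_lsc : lower_semicontinuous Phi.
Hypothesis Phi_ge : forall u, (M%:E <= Phi u)%E.
Hypothesis Phi_proper : exists u, (Phi u < +oo)%E.

Let finE u : (Phi u < +oo)%E -> Phi u = (fine (Phi u))%:E.
Proof.
move=> u_oo; rewrite fineK// fin_numE -ltey u_oo andbT gt_eqF//.
by rewrite (lt_le_trans _ (Phi_ge u))// ltNyr.
Qed.

Let segment (t : R) u v : 0 < t < 1 -> (Phi u < +oo)%E -> (Phi v < +oo)%E ->
  (Phi (t *: u + (1 - t) *: v)%R < +oo)%E /\
  fine (Phi (t *: u + (1 - t) *: v)) <= t * fine (Phi u) + (1 - t) * fine (Phi v).
Proof.
move=> t01 fu fv; have := Phi_convex u v t01.
rewrite (finE fu) (finE fv) -!EFinM -EFinD => h.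
have fz : (Phi (t *: u + (1 - t) *: v)%R < +oo)%E by rewrite (le_lt_trans h)// ltry.
by split => //; rewrite /= -lee_fin -(finE fz).
Qed.

Section moreau.
Variables (q : U) (c : R).
Hypothesis c_gt0 : 0 < c.

Let J w := fine (Phi w) + c * `|w - q| ^+ 2.
Let S := J @` [set w | (Phi w < +oo)%E].
Let m := inf S.

Let J_ge w : (Phi w < +oo)%E -> m <= J w.
Proof.
move=> fw; apply: ge_inf; last by exists w.
exists M => _ [z /= fz <-]; rewrite -[M]addr0 lerD//.
  by rewrite -lee_fin -finE.
by rewrite mulr_ge0 ?sqr_ge0// ltW.
Qed.

Let J_adherent e : 0 < e -> exists2 w, (Phi w < +oo)%E & J w < m + e.
Proof.
move=> e0; have hS : has_inf S.
  split; first by have [w fw] := Phi_proper; exists (J w), w.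
  exists M => _ [z /= fz <-]; rewrite -[M]addr0 lerD//.
    by rewrite -lee_fin -finE.
  by rewrite mulr_ge0 ?sqr_ge0// ltW.
by have [_ [w fw <-] ?] := inf_adherent e0 hS; exists w.
Qed.

Let seg_sqr (t : R) w z : `|t *: w + (1 - t) *: z - q| ^+ 2 =
  t * `|w - q| ^+ 2 + (1 - t) * `|z - q| ^+ 2 - t * (1 - t) * `|w - z| ^+ 2.
Proof.
rewrite -!ip_norm; rewrite !(ipBl, ipBr, ipDl, ipDr, ipZl, ipZr) (ipC ip q w) (ipC ip q z) (ipC ip z w).
by ring.
Qed.

(** The parallelogram identity bounds the distance of two almost minimizers. *)
Let J_gap w z : (Phi w < +oo)%E -> (Phi z < +oo)%E ->
  c * `|w - z| ^+ 2 <= 2 * (J w - m) + 2 * (J z - m).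
Proof.
move=> fw fz; have t01 : 0 < (2^-1 : R) < 1 by lra.
have [fx lx] := segment t01 fw fz; have := J_ge fx.
rewrite /J seg_sqr; move: lx; nra.
Qed.

(** A minimizing sequence is Cauchy; lower semicontinuity lets the infimum be
    reached at its limit. *)
Let minimizer : exists2 v, (Phi v < +oo)%E & J v <= m.
Proof.
have e0 n : 0 < n.+1%:R^-1 :> R by rewrite invr_gt0.
pose w n := sval (cid2 (J_adherent (e0 n))).
have fw n : (Phi (w n) < +oo)%E by rewrite /w; case: cid2.
have Jw n : J (w n) < m + n.+1%:R^-1 by rewrite /w; case: cid2.
have cw : cvg (w @ \oo).
  apply: cauchy_cvg; apply: cauchy_exP => e e0'.
  have c4 : 0 < c * e ^+ 2 / 4 by rewrite divr_gt0// mulr_gt0// exprn_gt0.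
  have [n hn] := filter_ex (near_infty_natSinv_lt (PosNum c4)).
  exists (w n); have := near_infty_natSinv_lt (PosNum c4); apply: filterS => k hk.
  rewrite -ball_normE /ball_/= -ltr_sqr ?nnegrE// ?(ltW e0')// -(ltr_pM2l c_gt0).
  have h := J_gap (fw n) (fw k); apply: (le_lt_trans h).
  have hn' : n.+1%:R^-1 < c * e ^+ 2 / 4 := hn.
  have hk' : k.+1%:R^-1 < c * e ^+ 2 / 4 := hk.
  have := Jw n; have := Jw k; move: hn' hk'; move: (c * e ^+ 2) (n.+1%:R^-1) (k.+1%:R^-1).
  by move=> K x y; lra.
set v := lim (w @ \oo).
have wv : w n @[n --> \oo] --> v by exact: cw.
have cq : c * `|w n - q| ^+ 2 @[n --> \oo] --> c * `|v - q| ^+ 2.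
  apply: cvgMr; apply: cvg_sqr; apply: cvg_norm; apply: cvgB => //; exact: cvg_cst.
have below a : (a%:E < Phi v)%E -> a <= m - c * `|v - q| ^+ 2.
  move=> /Phi_lsc[V Vv Va].
  have c2 : m + n.+1%:R^-1 - c * `|w n - q| ^+ 2 @[n --> \oo] --> m + 0 - c * `|v - q| ^+ 2.
    by apply: cvgB => //; apply: cvgD; [exact: cvg_cst|exact: cvg_harmonic].
  rewrite addr0 in c2; rewrite -(cvg_lim (@norm_hausdorff _ _) c2); apply: limr_ge.
    by apply/cvg_ex; exists (m - c * `|v - q| ^+ 2).
  have wV : \forall n \near \oo, V (w n) by exact: (wv V Vv).
  apply: filterS wV => n /Va; rewrite (finE (fw n)) lte_fin => an.
  by have := Jw n; rewrite /J; move: (n.+1%:R^-1) => x; lra.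
have fv : (Phi v < +oo)%E.
  rewrite ltNge; apply/negP; rewrite leye_eq => /eqP fv.
  by have := below (m - c * `|v - q| ^+ 2 + 1); rewrite fv ltry => /(_ isT); lra.
exists v => //; rewrite /J.
apply/ler_addgt0Pr => e e0'.
have := below (fine (Phi v) - e); rewrite [in X in X -> _](finE fv) lte_fin.
rewrite (_ : fine (Phi v) - e < fine (Phi v)); last by rewrite ltrBlDr ltrDl.
by move=> /(_ isT); lra.
Qed.

(** Minimizing [Phi + c |. - q|^2] gives a point [v] at which [2 c (q - v)] is a
    subgradient of [Phi]. *)
Lemma moreau_subgradient : exists v r, Phi v = r%:E /\
  forall w, ((r + 2 * c * ip (q - v) (w - v))%:E <= Phi w)%E.
Proof.
have [v fv Jv] := minimizer; exists v, (fine (Phi v)); split; first exact: finE.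
move=> w; have [fw|] := ltP (Phi w) +oo%E; last by rewrite leye_eq => /eqP ->; exact: leey.
rewrite (finE fw) lee_fin -subr_ge0; set g := fine (Phi w) - _.
have small (t : R) : 0 < t < 1 -> 0 <= g + t * (c * `|w - v| ^+ 2).
  move=> /[dup] t01 /andP[t0 t1]; have [fx lx] := segment t01 fw fv; have := J_ge fx.
  rewrite /J seg_sqr => h; rewrite -(pmulr_rge0 _ t0).
  have -> : g = fine (Phi w) - fine (Phi v) - c * (`|q - v| ^+ 2 + `|w - v| ^+ 2 - `|w - q| ^+ 2).
    rewrite /g -!ip_norm !(ipBl, ipBr) (ipC ip v q) (ipC ip w q) (ipC ip w v); ring.
  by move: Jv; rewrite /J (distrC q v); nra.
rewrite leNgt; apply/negP => g0; set K := c * `|w - v| ^+ 2 in small.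
have K0 : 0 <= K by rewrite /K mulr_ge0 ?sqr_ge0// ltW.
have n0 : 0 < - g + K + 1 by lra.
have t01 : 0 < - g / (- g + K + 1) < 1.
  by rewrite divr_gt0 ?oppr_gt0//= ltr_pdivrMr// mul1r; lra.
have := small _ t01; rewrite -(pmulr_rge0 _ n0).
have -> : (- g + K + 1) * (g + - g / (- g + K + 1) * K) = g * (- g + K + 1) - g * K.
  by field; rewrite gt_eqF.
by nra.
Qed.

End moreau.

Section minorants.
Variable d : nat -> U.
Hypothesis d_basis : orthonormal_basis ip d.

(** Finite rational combinations of the basis, enumerated. *)
Lemma dense_sequence : exists q : nat -> U, forall u e, 0 < e -> exists i, `|u - q i| < e.
Proof.
pose c (s : seq rat) k : R := ratr (nth 0%Q s k).
pose q i := let s := odflt [::] (unpickle i : option (seq rat)) in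
  \sum_(k < size s) c s k *: d k.
exists q => u e e0.
have [_ cl] := d_basis; have : closure (\bigcup_n basis_span d n) u by rewrite cl.
have e2 : 0 < e / 2 by rewrite divr_gt0.
move=> /(_ (ball u (e / 2)) (nbhsx_ballx _ _ e2))[z [[n _ [a ->]]]].
rewrite -ball_normE/= => uz.
have en : 0 < e / 2 / n.+1%:R by rewrite divr_gt0.
have [h hE] : exists h : R, e / 2 / n.+1%:R = h by eexists.
rewrite hE in en.
have rk k : exists r : rat, `|a k - ratr r| < h.
  have /rat_in_itvoo[r] : a k - h < a k + h by lra.
  rewrite in_itv/= => /andP[r1 r2]; exists r; rewrite ltr_norml; apply/andP; split; lra.
pose s := [seq sval (cid (rk k)) | k : 'I_n].
have sn : size s = n by rewrite size_map size_enum_ord.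
exists (pickle s); rewrite /q pickleK/= sn.
rewrite (_ : u - _ = (u - \sum_(i < n) a i *: d i) + \sum_(i < n) (a i - c s i) *: d i); last first.
  by rewrite (eq_bigr _ (fun i _ => scalerBl _ _ _)) sumrB addrA subrK.
rewrite (le_lt_trans (ler_normD _ _))// (splitr e) ltr_leD//.
rewrite (le_trans (ler_norm_sum _ _ _))//.
rewrite (@le_trans _ _ (\sum_(i < n) h))//.
  apply: ler_sum => i _; rewrite normrZ (basis_norm ip_norm d_basis) mulr1.
  rewrite /c /s (nth_map i) ?size_enum_ord// nth_ord_enum.
  by rewrite ltW//; case: cid.
rewrite sumr_const card_ord -[h *+ n]mulr_natr -hE -[leLHS]mulrA.
apply: ler_piMr; first exact: ltW.
by rewrite mulrC ler_pdivrMr// mul1r ler_nat.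
Qed.

(** [Phi] is the supremum of a sequence of affine functions: those supporting it
    at the Moreau minimizers for centres in a dense sequence and for all natural
    weights [c = k + 1]. *)
Lemma affine_minorants : exists (p : nat -> U) (a : nat -> R),
  (forall n u, ((a n + ip u (p n))%:E <= Phi u)%E) /\
  forall u b e, (b%:E < Phi u)%E -> 0 < e -> exists n, b - e < a n + ip u (p n).
Proof.
have [q qd] := dense_sequence.
pose S (x : nat * nat) := moreau_subgradient (q x.1) (ltr0Sn R x.2).
pose v x := sval (cid (S x)); pose r x := sval (cid (svalP (cid (S x)))).
have Sv x : Phi (v x) = (r x)%:E /\ forall w,
    ((r x + 2 * x.2.+1%:R * ip (q x.1 - v x) (w - v x))%:E <= Phi w)%E.
  exact: (svalP (cid (svalP (cid (S x))))).
pose p x := (2 * x.2.+1%:R) *: (q x.1 - v x).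
pose a x := r x - 2 * x.2.+1%:R * ip (q x.1 - v x) (v x).
have aE x u : a x + ip u (p x) = r x + 2 * x.2.+1%:R * ip (q x.1 - v x) (u - v x).
  rewrite /a /p ipZr (ipC ip u) (ipBr ip u); ring.
have low x u : r x + x.2.+1%:R * (`|u - v x| ^+ 2 - `|u - q x.1| ^+ 2) <= a x + ip u (p x).
  rewrite aE lerD2l -subr_ge0.
  have -> : 2 * x.2.+1%:R * ip (q x.1 - v x) (u - v x) - x.2.+1%:R *
      (`|u - v x| ^+ 2 - `|u - q x.1| ^+ 2) = x.2.+1%:R * `|q x.1 - v x| ^+ 2.
    rewrite -!ip_norm !(ipBl, ipBr) (ipC ip (v x) (q x.1)) (ipC ip u (q x.1)) (ipC ip u (v x)); ring.
  by rewrite mulr_ge0// sqr_ge0.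
pose x n := odflt (0, 0)%N (unpickle n : option (nat * nat)).
exists (p \o x), (a \o x); split => [n u|u b e bu e0].
  by rewrite /= aE; exact: (Sv (x n)).2.
have [V /nbhs_ballP[dl /= dl0 dlV] Vb] := Phi_lsc bu.
have d2 : 0 < dl ^+ 2 by rewrite exprn_gt0.
(* The weight is chosen so large that a minimizer [v] farther than [dl] from [u]
   makes the quadratic term alone exceed [b - M]; then the centre is chosen so
   close to [u] that the loss [c |u - q|^2] is less than [e]. *)
have [k kM] : exists k : nat, b - M < k.+1%:R * dl ^+ 2.
  exists (Num.truncn `|(b - M) / dl ^+ 2|); rewrite -ltr_pdivrMr//.
  by rewrite (le_lt_trans (ler_norm _))// truncnS_gt.
have c0 : 0 < e / k.+1%:R by rewrite divr_gt0.
have s0 : 0 < Num.sqrt (e / k.+1%:R) by rewrite sqrtr_gt0.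
have [i ui] := qd u _ s0.
exists (pickle (i, k)); rewrite /= /x pickleK/=.
apply: lt_le_trans (low (i, k) u); rewrite /=.
have uq : k.+1%:R * `|u - q i| ^+ 2 < e.
  rewrite -ltr_pdivlMl// mulrC -[ltRHS]sqr_sqrtr ?ltW//.
  by rewrite ltr_sqr ?nnegrE ?sqrtr_ge0.
have [Pv _] := Sv (i, k); have Mr : M <= r (i, k) by rewrite -lee_fin -Pv.
have [uv|uv] := ltP `|u - v (i, k)| dl.
  have /Vb : V (v (i, k)) by apply: dlV; rewrite -ball_normE.
  rewrite Pv lte_fin => br; have : 0 <= k.+1%:R * `|u - v (i, k)| ^+ 2 by rewrite mulr_ge0 ?sqr_ge0.
  by lra.
have : k.+1%:R * dl ^+ 2 <= k.+1%:R * `|u - v (i, k)| ^+ 2.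
  by rewrite ler_wpM2l// ler_sqr ?nnegrE// ltW.
by lra.
Qed.

End minorants.
End convex_functions.

(** * The log-sum-exp of finitely many affine functions *)

Section log_sum_exp.
Context {R : realType} {U : completeNormedModType R}.
Variable ip : {dot U for idfun}.
Hypothesis ip_norm : forall u, ip u u = `|u| ^+ 2.
Variables (N : nat) (beta : R) (p : 'I_N.+1 -> U) (a : 'I_N.+1 -> R).
Hypothesis beta_gt0 : 0 < beta.

Let l i u := a i + ip u (p i).
Let S u := \sum_i expR (beta * l i u).

(** A smooth and convex substitute for the maximum of the [l i], off by at most
    [(N + 1) / beta]. *)
Definition softmax u := beta^-1 * ln (S u).
Definition weight i u := expR (beta * l i u) * (S u)^-1.

(** The derivative of [softmax] along [v] is the mean of the slopes [ip v (p i)]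
    for the probability weights [weight i u]. *)
Definition slope v u := \sum_i weight i u * ip v (p i).

Let S_gt0 u : 0 < S u.
Proof.
by rewrite /S (bigD1 ord0)//= ltr_wpDr ?expR_gt0// sumr_ge0.
Qed.

Lemma weight_ge0 i u : 0 <= weight i u.
Proof. by rewrite mulr_ge0 ?expR_ge0// invr_ge0 ltW. Qed.

Lemma weight_sum1 u : \sum_i weight i u = 1.
Proof. by rewrite /weight -mulr_suml -/(S u) divff// gt_eqF. Qed.

Lemma softmax_ge i u : l i u <= softmax u.
Proof.
rewrite /softmax -ler_pdivrMl ?invr_gt0// invrK -[leLHS]expRK ler_ln ?posrE ?expR_gt0//.
by rewrite /S (bigD1 i)//= lerDl sumr_ge0.
Qed.

Lemma softmax_le u b : (forall i, l i u <= b) -> softmax u <= b + N.+1%:R / beta.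
Proof.
move=> lb; rewrite /softmax ler_pdivrMl// mulrDr [beta * (_ / _)]mulrCA divff ?gt_eqF// mulr1.
rewrite -[leRHS]expRK ler_ln ?posrE ?expR_gt0// expRD mulrC.
apply: (@le_trans _ _ (\sum_(i < N.+1) expR (beta * b))).
  by apply: ler_sum => i _; rewrite ler_expR ler_pM2l.
rewrite sumr_const card_ord -[leLHS]mulr_natl ler_wpM2r ?expR_ge0//.
by rewrite (le_trans _ (expR_ge1Dx _))// lerDr.
Qed.

Let dl v i : dd v (fun u => expR (beta * l i u)) (fun u => expR (beta * l i u) * (beta * ip v (p i))).
Proof.
apply: (dd_comp (fun u => is_derive_expR (beta * l i u))).
apply: ddZ; under eq_fun do rewrite -[ip v _]add0r.
exact: (ddD (dd_cst _ _) (dd_ip ip v (p i))).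
Qed.

Let dS v : dd v S (fun u => beta * (S u * slope v u)).
Proof.
have -> : (fun u => beta * (S u * slope v u)) =
    fun u => \sum_i expR (beta * l i u) * (beta * ip v (p i)).
  apply/funext => u; rewrite /slope !mulr_sumr; apply: eq_bigr => i _.
  by rewrite /weight; field; rewrite gt_eqF.
by apply: dd_sum => i; exact: dl.
Qed.

Lemma dd_softmax v : dd v softmax (slope v).
Proof.
move=> u; have := ddZ beta^-1 (dd_comp (fun u => is_derive1_ln (S_gt0 u)) (dS v)) u.
congr is_derive; field; rewrite ?gt_eqF//.
Qed.

Lemma dd_weight v i : dd v (weight i) (fun u => beta * (weight i u * (ip v (p i) - slope v u))).
Proof.
have dV : dd v (fun u => (S u)^-1) (fun u => - (S u) ^- 2 * (beta * (S u * slope v u))).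
  apply: (dd_comp (g := GRing.inv) (g' := fun x => - x ^- 2) _ (dS v)) => u.
  have := is_deriveV (f := id) (lt0r_neq0 (S_gt0 u)) (is_derive_id (S u) 1).
  by rewrite /GRing.scale/= mulr1.
move=> u; have := ddM (dl v i) dV u.
by congr is_derive; rewrite /weight; field; rewrite gt_eqF.
Qed.

Let P := \sum_i `|p i|.

Let ip_le v i : `|ip v (p i)| <= P * `|v|.
Proof.
rewrite (le_trans (ip_CS ip_norm _ _))// mulrC ler_wpM2r// /P (bigD1 i)//=.
by rewrite lerDl sumr_ge0.
Qed.

Let slope_le v u : `|slope v u| <= P * `|v|.
Proof.
rewrite (le_trans (ler_norm_sum _ _ _))// -[leRHS]mul1r -(weight_sum1 u) mulr_suml.
by apply: ler_sum => i _; rewrite normrM (ger0_norm (weight_ge0 _ _)) ler_wpM2l// weight_ge0.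
Qed.

Lemma softmax_lip u v : `|softmax u - softmax v| <= P * `|u - v|.
Proof. by apply: dd_lip => w; exists (slope w); [exact: dd_softmax|exact: slope_le]. Qed.

Let weight_le1 i u : `|weight i u| <= 1.
Proof.
rewrite ger0_norm ?weight_ge0// -(weight_sum1 u) (bigD1 i)//= lerDl sumr_ge0// => j _.
exact: weight_ge0.
Qed.

Variable d : nat -> U.

(** The derivatives of the weights are polynomials in the weights. *)
Lemma Cn_weight n i : Cn d n (weight i).
Proof.
elim: n i => [|n IHn] i.
  exists (1 + beta * (P + P)); split=> [u|u v].
    have P0 : 0 <= P by exact: sumr_ge0.
    by rewrite (le_trans (weight_le1 i u))// lerDl mulr_ge0 ?addr_ge0// ltW.
  apply: (@le_trans _ _ (beta * (P + P) * `|u - v|)); last by rewrite ler_wpM2r// lerDr.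
  apply: dd_lip => w; eexists; first exact: dd_weight.
  move=> x; rewrite normrM gtr0_norm// -[leRHS]mulrA ler_pM2l// normrM.
  rewrite (le_trans (ler_wpM2r _ (weight_le1 i x)))// mul1r mulrDl.
  by rewrite (le_trans (ler_normB _ _))// lerD.
apply: Cn_intro => [|k]; first exact: Cn_BL (IHn i).
eexists; first exact: dd_weight.
apply: CnZ; apply: CnM => //; apply: CnD; first exact: Cn_cst.
apply: CnN; rewrite /slope; elim: (index_enum _) => [|j s IHs].
  by under [X in Cn _ _ X]eq_fun do rewrite big_nil; exact: Cn_cst.
under [X in Cn _ _ X]eq_fun do rewrite big_cons; apply: CnD => //.
by apply: CnM => //; exact: Cn_cst.
Qed.

Lemma Cn_slope n v : Cn d n (slope v).
Proof.
rewrite /slope; elim: (index_enum _) => [|j s IHs].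
  by under [X in Cn _ _ X]eq_fun do rewrite big_nil; exact: Cn_cst.
under [X in Cn _ _ X]eq_fun do rewrite big_cons; apply: CnD => //.
by apply: CnM; [exact: Cn_weight|exact: Cn_cst].
Qed.

Lemma dd_slope v w : dd w (slope v) (fun u =>
  \sum_i beta * (weight i u * (ip w (p i) - slope w u)) * ip v (p i)).
Proof.
apply: dd_sum => i u; have := ddM (dd_weight w i) (dd_cst w (ip v (p i))) u.
by rewrite mulr0 add0r.
Qed.

(** The second derivative is [beta] times the variance of the slopes. *)
Lemma softmax_hessian_ge0 (s : seq nat) (V : nat -> R) u :
  0 <= \sum_(i <- s) \sum_(j <- s) 'D_(d i) (slope (d j)) u * (V i * V j).
Proof.
pose B k := \sum_(i <- s) V i * ip (d i) (p k).
pose m := \sum_k weight k u * B k.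
have mE : m = \sum_(i <- s) V i * slope (d i) u.
  rewrite /m; under eq_bigr do rewrite mulr_sumr; rewrite exchange_big/=.
  apply: eq_bigr => i _; rewrite /slope mulr_sumr; apply: eq_bigr => k _; ring.
have DE i j : 'D_(d i) (slope (d j)) u =
    \sum_k beta * (weight k u * (ip (d i) (p k) - slope (d i) u)) * ip (d j) (p k).
  exact: (congr1 (fun f : U -> R => f u) (pd_eq (dd_slope (d j) (d i)))).
rewrite [X in 0 <= X](_ : _ = \sum_k beta * (weight k u * (B k - m)) * B k); last first.
  under eq_bigr do under eq_bigr do rewrite DE mulr_suml.
  under eq_bigr do rewrite exchange_big/=; rewrite exchange_big/=.
  apply: eq_bigr => k _; rewrite mE /B -sumrB [RHS]mulrAC !mulr_sumr.
  apply: eq_bigr => i _.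
  rewrite mulr_suml; apply: eq_bigr => j _; ring.
have -> : \sum_k beta * (weight k u * (B k - m)) * B k =
    \sum_k beta * (weight k u * (B k - m) ^+ 2).
  apply/eqP; rewrite -subr_eq0 -sumrB; apply/eqP.
  transitivity (\sum_k (beta * m) * (weight k u * B k - m * weight k u)).
    by apply: eq_bigr => k _; ring.
  by rewrite -mulr_sumr sumrB -mulr_sumr weight_sum1 mulr1 subrr mulr0.
by apply: sumr_ge0 => k _; rewrite mulr_ge0 ?(ltW beta_gt0)// mulr_ge0 ?weight_ge0// sqr_ge0.
Qed.

End log_sum_exp.

(** * Weak convexity *)

Section weak_convexity.
Context {R : realType} {U : completeNormedModType R}.
Variable ip : {dot U for idfun}.
Hypothesis ip_norm : forall u, ip u u = `|u| ^+ 2.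
Variables (mu : probability (borel U) R) (Q : U -> U).
Hypothesis mu_gaussian : centered_gaussian ip mu.
Hypothesis mu_cov : covariance_operator ip mu Q.
Hypothesis Q_sym : forall u v, ip (Q u) v = ip u (Q v).
Variable d : nat -> U.
Hypothesis d_basis : orthonormal_basis ip d.
Variable lam : nat -> R.
Hypothesis lam_gt0 : forall i, 0 < lam i.
Hypothesis Q_eigen : forall i, Q (d i) = lam i *: d i.
Variables (Phi : borel U -> \bar R) (M : R).
Hypothesis Phi_measurable : measurable_fun setT Phi.
Hypothesis Phi_convex : convex_ereal (Phi : U -> \bar R).
Hypothesis Phi_lsc : lower_semicontinuous (Phi : U -> \bar R).
Hypothesis Phi_ge : forall u, (M%:E <= Phi u)%E.
Hypothesis Phi_finite : mu.-negligible [set u | Phi u = +oo%E].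

Notation E := (expect mu).
Local Notation D k F := ('D_(d k) F).

Let X (u : borel U) := fine (Phi u).
Hypothesis X_L2 : L2 mu X.

Lemma proper_ae : exists u : U, (Phi u < +oo)%E.
Proof.
apply: contrapT => /forallNP h.
have : mu.-negligible setT.
  by apply: negligibleS Phi_finite => u _ /=; apply/eqP; rewrite -leye_eq leNgt; apply/negP/h.
move=> /(negligibleP mu measurableT) h0; have := probability_setT mu.
by rewrite [X in X = _]h0 => /esym/eqP; rewrite onee_eq0.
Qed.

Section smooth_approximation.
Variables (p : nat -> U) (a : nat -> R).
Hypothesis minorant : forall n u, ((a n + ip u (p n))%:E <= Phi u)%E.
Hypothesis dense_minorant : forall u b e, (b%:E < Phi u)%E -> 0 < e ->
  exists n, b - e < a n + ip u (p n).

(* With [n + 1] functions this makes the error of [softmax] at most [1 / (n + 1)]. *)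
Let beta (n : nat) : R := n.+1%:R ^+ 2.
Let beta_gt0 n : 0 < beta n. Proof. by rewrite exprn_gt0. Qed.
Let Psi n (u : borel U) := @softmax R U ip n (beta n) (fun i => p i) (fun i => a i) u.
Let l k (u : borel U) := a k + ip u (p k).

Let L2l k : L2 mu (l k).
Proof. by apply: L2D; [exact/L2_Bm/Bm_cst|exact: (L2_ip ip_norm mu_gaussian)]. Qed.

Let mPsi n : measurable_fun setT (Psi n).
Proof. by apply: continuous_borel; apply: lip_continuous (softmax_lip ip_norm _ _ _). Qed.

Let beta_inv n : n.+1%:R / beta n = n.+1%:R^-1.
Proof. by rewrite /beta expr2 invfM mulrA divff// mul1r. Qed.

Let Psi_ge n k u : (k <= n)%N -> l k u <= Psi n u.
Proof.
rewrite -ltnS => kn.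
exact: (softmax_ge ip (fun i : 'I_n.+1 => p i) (fun i => a i) (beta_gt0 n) (Ordinal kn) u).
Qed.

Let Psi_le n u b : (forall k, l k u <= b) -> Psi n u <= b + n.+1%:R^-1.
Proof. by move=> lb; rewrite -beta_inv; apply: softmax_le => // i; exact: lb. Qed.

Let inv_le1 n : n.+1%:R^-1 <= 1 :> R.
Proof. by rewrite invf_le1// ler1n. Qed.

Let Psi_L2 n : L2 mu (Psi n).
Proof.
apply: (@L2_le _ _ _ mu _ (fun u : borel U => \sum_(k < n.+1) `|l k u| + 1)) => // [|u].
  by apply: L2D; [apply: L2_sum => k; exact: L2_norm|exact/L2_Bm/Bm_cst].
have lb k : (k < n.+1)%N -> `|l k u| <= \sum_(k < n.+1) `|l k u|.
  by move=> kn; rewrite (bigD1 (Ordinal kn))//= lerDl sumr_ge0.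
rewrite ler_norml; apply/andP; split.
  by have := Psi_ge u (leq0n n); have := lb 0%N isT; rewrite ler_norml => /andP[]; lra.
have := inv_le1 n; rewrite -beta_inv.
have : Psi n u <= \sum_(k < n.+1) `|l k u| + n.+1%:R / beta n.
  by apply: softmax_le => // i; rewrite (le_trans (ler_norm _))//; exact: lb.
by lra.
Qed.

Let l_le k u : (Phi u < +oo)%E -> l k u <= X u.
Proof.
move=> fu; rewrite -lee_fin /X fineK ?minorant// fin_numE -ltey fu andbT gt_eqF//.
by rewrite (lt_le_trans _ (Phi_ge u))// ltNyr.
Qed.

Let Psi_cvg u : (Phi u < +oo)%E -> Psi n u @[n --> \oo] --> X u.
Proof.
move=> fu; have XE : Phi u = (X u)%:E.
  rewrite /X fineK// fin_numE -ltey fu andbT gt_eqF//.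
  by rewrite (lt_le_trans _ (Phi_ge u))// ltNyr.
apply/cvgrPdist_le => e e0; have e2 : 0 < e / 2 by rewrite divr_gt0.
have [|k hk] := @dense_minorant u (X u - e / 2) (e / 2) _ e2.
  by rewrite XE lte_fin ltrBlDr ltrDl.
near=> n.
have h1 : l k u <= Psi n u by apply: Psi_ge; near: n; exact: nbhs_infty_ge.
have h2 := Psi_le n (fun k => l_le k fu).
have h3 : n.+1%:R^-1 < e by near: n; exact: (near_infty_natSinv_lt (PosNum e0)).
rewrite ler_norml; move: h2 h3; move: (n.+1%:R^-1) => x; rewrite /l in h1; lra.
Unshelve. all: end_near. Qed.

Let Psi_bound n u : (Phi u < +oo)%E -> `|Psi n u| <= `|l 0 u| + `|X u| + 1.
Proof.
move=> fu; have := Psi_ge u (leq0n n); have := Psi_le n (fun k => l_le k fu).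
have := inv_le1 n; move: (n.+1%:R^-1) => x.
have h : - l 0 u <= `|l 0 u| by rewrite -normrN ler_norm.
rewrite ler_norml; have := ler_norm (X u); have := normr_ge0 (X u).
have := normr_ge0 (l 0 u); lra.
Qed.

(** Dominated convergence, after multiplication by the indicator of the set where
    [Phi] is finite: elsewhere the approximations may diverge. *)
Let Psi_expect_cvg Z : L2 mu Z -> E (fun u => Psi n u * Z u) @[n --> \oo] --> E (fun u => X u * Z u).
Proof.
move=> Z2; have [mZ _] := Z2; have [mX _] := X_L2.
pose chi u : R := if Phi u == +oo%E then 0 else 1.
have mchi : measurable_fun setT chi.
  by apply: measurable_fun_ifT; [exact: measurable_fun_eqe|exact: measurable_cst..].
have ae (F : borel U -> R) : measurable_fun setT F ->
    E (fun u => F u * Z u) = E (fun u => chi u * (F u * Z u)).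
  move=> mF; apply: expect_ae.
  - exists [set u | Phi u = +oo%E] => // u /= /eqP/negbTE fu.
    by rewrite /chi fu mul1r.
  - exact: measurable_funM.
  - by apply: measurable_funM => //; exact: measurable_funM.
rewrite ae// (funext (fun n => ae _ (mPsi n))).
have L2G : L2 mu (fun u => `|l 0 u| + `|X u| + 1).
  apply: L2D; last exact/L2_Bm/Bm_cst.
  by apply: L2D; exact: L2_norm.
have [] // := @expect_dct _ _ _ mu (fun n u => chi u * (Psi n u * Z u))
  (fun u => chi u * (X u * Z u)) (fun u => (`|l 0 u| + `|X u| + 1) * `|Z u|).
- by move=> n; apply: measurable_funM => //; exact: measurable_funM.
- move=> u; rewrite /chi; case: eqP => [_|/eqP fu].
    by rewrite mul0r; under eq_fun do rewrite mul0r; exact: cvg_cst.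
  by apply: cvgMr; apply: cvgMl; apply: Psi_cvg; rewrite ltey.
- by apply: L2M => //; exact: L2_norm.
- move=> n u; rewrite /chi; case: eqP => [_|/eqP fu].
    by rewrite mul0r normr0 mulr_ge0// !addr_ge0.
  by rewrite mul1r normrM ler_wpM2r// Psi_bound// ltey.
Qed.

Let wPsi n j : weak_derivative ip mu d lam j (Psi n)
  (slope ip (beta n) (fun i : 'I_n.+1 => p i) (fun i => a i) (d j)).
Proof.
apply: (weak_derivative_lip ip_norm mu_gaussian mu_cov Q_sym d_basis lam_gt0 Q_eigen
  j (Y := Psi n) (Y' := fun j => slope ip (beta n) _ _ (d j))) => //.
  exact: (softmax_lip ip_norm).
by move=> k; split; [exact: dd_softmax|exact: (Cn_BL (Cn_slope ip_norm _ _ (beta_gt0 n) d 0 _))].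
Qed.

Variables (X_ : nat -> borel U -> R).
Hypothesis weak_X : forall k, weak_derivative ip mu d lam k X (X_ k).

(** Two integrations by parts move both derivatives to the test function, so
    that the smooth approximations, which only converge pointwise, can be used. *)
Lemma weak_convexity_approx (s : seq nat) (V : nat -> U -> R) eta :
  (forall i, Cn d 2 (V i)) -> Cn d 2 eta -> (forall u, 0 <= eta u) ->
  0 <= \sum_(i <- s) \sum_(j <- s) E (fun u => X_ j u *
      delta ip d lam i (fun u => eta u * (V i u * V j u))
        (D i (fun u => eta u * (V i u * V j u))) u).
Proof.
move=> CV Ceta eta0; pose W i j u := eta u * (V i u * V j u).
have CW i j : Cn d 2 (W i j) := CnM Ceta (CnM (CV i) (CV j)).
pose W1 i j := delta ip d lam i (W i j) (D i (W i j)).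
pose W2 i j u := (lam i)^-1 * (ip u (d i) * D j (W i j) u + (j == i)%:R * W i j u)
  + (-1) * D j (D i (W i j)) u.
have aW i j : admissible ip mu d j (W1 i j) (W2 i j).
  have W1E : W1 i j = fun u => (lam i)^-1 * (ip u (d i) * W i j u) + (-1) * D i (W i j) u.
    by apply/funext => u; rewrite /W1 /delta; ring.
  apply: (eq_ind_r (fun F => admissible ip mu d j F (W2 i j)) _ W1E).
  apply: admissibleD; apply: admissibleZ.
    exact: (admissible_ip ip_norm mu_gaussian d_basis j i (CnS (CW i j))).
  exact: (admissible_Cn ip_norm mu_gaussian j (Cn_pd i (CW i j))).
pose Z i j := delta ip d lam j (W1 i j) (W2 i j).
have bW i j : Bm (W i j : borel U -> R) := Cn_Bm (CW i j).
have bW' i j k : Bm (D k (W i j) : borel U -> R) := Cn_Bm (Cn_pd k (CW i j)).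
have bW'' i j k k' : Bm (D k (D k' (W i j)) : borel U -> R) :=
  Cn_Bm (Cn_pd k (Cn_pd k' (CW i j))).
have L2x h : L2 mu (fun u : borel U => ip u h) := L2_ip ip_norm mu_gaussian h.
have Z2 i j : L2 mu (Z i j).
  have ZE : Z i j = fun u : borel U =>
      ((lam i)^-1 * (lam j)^-1) * ((ip u (d i) * ip u (d j)) * W i j u)
      + (- (lam j)^-1 * (ip u (d j) * D i (W i j) u)
      + - ((lam i)^-1 * (ip u (d i) * D j (W i j) u + (j == i)%:R * W i j u)
          + (-1) * D j (D i (W i j)) u)).
    by apply/funext => u; rewrite /Z /W1 /W2 /delta; ring.
  apply: (eq_ind_r (L2 mu) _ ZE).
  apply: L2D.
    by apply: L2Z; apply: L2MB => //; exact: (L2_ip2 ip_norm mu_gaussian).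
  apply: L2D; first by apply: L2Z; apply: L2MB.
  apply: L2N; apply: L2D; last by apply: L2Z; exact: L2_Bm.
  by apply: L2Z; apply: L2D; [apply: L2MB|apply: L2Z; exact: L2_Bm].
have eX i j : E (fun u => X_ j u * W1 i j u) = E (fun u => X u * Z i j u).
  exact: (weak_derivative_admissible ip_norm lam_gt0 (weak_X j) (aW i j)).
rewrite (eq_bigr _ (fun i _ => eq_bigr _ (fun j _ => eX i j))).
apply: (@cvg_ge0 _ (fun n => \sum_(i <- s) \sum_(j <- s) E (fun u => Psi n u * Z i j u))).
  by apply: cvg_sumR => i; apply: cvg_sumR => j; exact: Psi_expect_cvg.
move=> n; pose b j := slope ip (beta n) (fun i : 'I_n.+1 => p i) (fun i => a i) (d j).
have Cb k j : Cn d k (b j) by exact: (Cn_slope ip_norm _ _ (beta_gt0 n) d k _).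
have iH i j : L1 mu (fun u => D i (b j) u * W i j u).
  by apply/L1_Bm/BmM => //; exact: Cn_Bm (Cn_pd i (Cb 1%N j)).
rewrite (_ : \sum_(i <- s) _ = E (fun u => \sum_(i <- s) \sum_(j <- s) D i (b j) u * W i j u)).
  apply: expect_ge0 => u; have := @softmax_hessian_ge0 _ _ ip n (beta n) (fun i => p i) (fun i => a i)
    (beta_gt0 n) d s (fun i => V i u) u.
  move=> /(mulr_ge0 (eta0 u)); rewrite mulr_sumr; congr (0 <= _).
  by apply: eq_bigr => i _; rewrite mulr_sumr; apply: eq_bigr => j _; rewrite /W mulrCA.
rewrite expect_sum => [|i]; last exact: L1_sum.
apply: eq_bigr => i _; rewrite expect_sum//; apply: eq_bigr => j _.
rewrite -(weak_derivative_admissible ip_norm lam_gt0 (wPsi n j) (aW i j)).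
have [_ _ w] := weak_derivative_Cn ip_norm mu_gaussian mu_cov Q_sym d_basis
  lam_gt0 Q_eigen i (Cb 1%N j).
by rewrite w//; exact: CnS (CW i j).
Qed.

End smooth_approximation.

(** What is summed is the weak second derivative of [Phi] along the field [V],
    integrated against [eta]: a limit of the same quantity for log-sum-exp
    functions, whose second derivative is nonnegative. *)
Lemma weak_convexity (X_ : nat -> borel U -> R) (s : seq nat) (V : nat -> U -> R) eta :
  (forall k, weak_derivative ip mu d lam k X (X_ k)) ->
  (forall i, Cn d 2 (V i)) -> Cn d 2 eta -> (forall u, 0 <= eta u) ->
  0 <= \sum_(i <- s) \sum_(j <- s) E (fun u => X_ j u *
      delta ip d lam i (fun u => eta u * (V i u * V j u))
        (D i (fun u => eta u * (V i u * V j u))) u).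
Proof.
have [p [a [h1 h2]]] :=
  affine_minorants ip_norm Phi_convex Phi_lsc Phi_ge proper_ae d_basis.
by move=> wX; exact: (weak_convexity_approx h1 h2 wX).
Qed.

End weak_convexity.

(** * Bochner's formula *)

Section second_order_estimate.
Context {R : realType} {U : completeNormedModType R}.
Variable ip : {dot U for idfun}.
Hypothesis ip_norm : forall u, ip u u = `|u| ^+ 2.
Variable mu : probability (borel U) R.
Hypothesis mu_gaussian : centered_gaussian ip mu.
Variable d : nat -> U.
Hypothesis d_basis : orthonormal_basis ip d.
Variable lam : nat -> R.
Hypothesis lam_gt0 : forall i, 0 < lam i.

Notation E := (expect mu).
Local Notation D k F := ('D_(d k) F).

Variables (rho : borel U -> R) (X_ : nat -> borel U -> R).
Hypothesis rho_Bm : Bm rho.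
Hypothesis X_L2 : forall k, L2 mu (X_ k).
Hypothesis rho_weak : forall k,
  weak_derivative ip mu d lam k rho (fun u => - (rho u * X_ k u)).

Let L2x h : L2 mu (fun u : borel U => ip u h) := L2_ip ip_norm mu_gaussian h.

(** The adjoint of the [k]-th derivative for the measure of density [rho]. *)
Definition adj k (W W' : U -> R) (u : borel U) : R := delta ip d lam k W W' u + X_ k u * W u.

(** An adjoint has mean zero, provided the test function is admissible. *)
Let ibp_rho k W W' : admissible ip mu d k W W' -> L2 mu (W : borel U -> R) ->
  L2 mu (delta ip d lam k W W' : borel U -> R) ->
  L1 mu (fun u => rho u * adj k W W' u) /\ E (fun u => rho u * adj k W W' u) = 0.
Proof.
move=> aW W2 dW2; have iXW := L2M (X_L2 k) W2; have idW := L2_L1 dW2.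
split; first by apply: L1BM => //; exact: L1D.
have w := weak_derivative_admissible ip_norm lam_gt0 (rho_weak k) aW.
transitivity (E (fun u => rho u * delta ip d lam k W W' u + - (- (rho u * X_ k u) * W u))).
  by congr expect; apply/funext => u; rewrite /adj; ring.
rewrite expectD; [|exact: L1BM|]; last first.
  by under [X in L1 _ X]eq_fun do rewrite mulNr opprK -mulrA; exact: L1BM.
rewrite -w expectN ?subrr//.
by under [X in L1 _ X]eq_fun do rewrite mulNr -mulrA; apply: L1N; exact: L1BM.
Qed.

Variables (V : nat -> U -> R).
Hypothesis V_smooth : forall i, Cn d 2 (V i).

Let CV1 i : Cn d 1 (V i) := CnS (V_smooth i).
Let CV1' i k : Cn d 1 (D k (V i)) := Cn_pd k (V_smooth i).

Let A i := adj i (V i) (D i (V i)).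

Let bV i : Bm (V i : borel U -> R) := Cn_Bm (V_smooth i).
Let bV' i k : Bm (D k (V i) : borel U -> R) := Cn_Bm (Cn_pd k (V_smooth i)).
Let bV'' i k l : Bm (D l (D k (V i)) : borel U -> R) := Cn_Bm (Cn_pd l (Cn_pd k (V_smooth i))).
Let d2V i : L2 mu (delta ip d lam i (V i) (D i (V i))) :=
  L2_delta ip_norm mu_gaussian lam i (CnS (V_smooth i)).

Let A2 i : L2 mu (A i).
Proof. by apply: L2D => //; exact: L2MB. Qed.

Let first_order i j u := X_ j u *
  (delta ip d lam i (fun u => V i u * V j u) (D i (fun u => V i u * V j u)) u
   + X_ i u * (V i u * V j u)).

Let DM k F G u : Cn d 1 F -> Cn d 1 G ->
  D k (fun u => F u * G u) u = F u * D k G u + D k F u * G u.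
Proof.
move=> CF CG; exact: (congr1 (fun f : U -> R => f u) (pd_eq (ddM (Cn_dd k CF) (Cn_dd k CG)))).
Qed.

Let second_order i j u := D j (V i) u * D i (V j) u + (i == j)%:R * (V i u ^+ 2 / lam i).

Let bsecond i j : Bm (second_order i j : borel U -> R).
Proof.
apply: BmD; first exact: BmM.
apply: BmZ; under [X in Bm X]eq_fun do rewrite mulrC expr2.
by apply: BmZ; exact: BmM.
Qed.

Let i_first i j : L1 mu (fun u => rho u * first_order i j u).
Proof.
apply: L1BM => //; apply: L2M => //; apply: L2D.
  by apply: (L2_delta ip_norm mu_gaussian); apply: CnM; exact: CnS.
by apply: L2MB => //; exact: BmM.
Qed.

(** The commutator of [adj j] and the [i]-th derivative is [(i == j) / lam i] plus
    the second derivative of the potential; the latter appears in the weak form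
    [first_order]. *)
Lemma bochner_pair i j : E (fun u => rho u * (A i u * A j u)) =
  E (fun u => rho u * first_order i j u) + E (fun u => rho u * second_order i j u).
Proof.
(* The identity is the sum of two integrations by parts: along [d i] against
   [W = V_i delta_j V_j] and along [d j] against [Z = V_i D_i V_j]. *)
pose W u := V i u * delta ip d lam j (V j) (D j (V j)) u.
pose Z u := V i u * D i (V j) u.
pose W' u := V i u * (ip u (d j) / lam j * D i (V j) u + (i == j)%:R / lam j * V j u
  - D i (D j (V j)) u) + D i (V i) u * delta ip d lam j (V j) (D j (V j)) u.
have CZ : Cn d 1 Z := CnM (CnS (V_smooth i)) (Cn_pd i (V_smooth j)).
have CVV : Cn d 1 (fun u => V i u * V j u) := CnM (CnS (V_smooth i)) (CnS (V_smooth j)).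
have CVD : Cn d 1 (fun u => V i u * D j (V j) u) := CnM (CnS (V_smooth i)) (Cn_pd j (V_smooth j)).
have aW : admissible ip mu d i W W'.
  have h := admissibleD (admissibleZ (lam j)^-1 (admissible_ip ip_norm mu_gaussian d_basis i j CVV))
    (admissibleZ (-1) (admissible_Cn ip_norm mu_gaussian i CVD)).
  have WE : W = fun u => (lam j)^-1 * (ip u (d j) * (V i u * V j u)) + -1 * (V i u * D j (V j) u).
    by apply/funext => u; rewrite /W /delta; ring.
  have WE' : W' = fun u => (lam j)^-1 *
      (ip u (d j) * D i (fun u => V i u * V j u) u + (i == j)%:R * (V i u * V j u))
      + -1 * D i (fun u => V i u * D j (V j) u) u.
    by apply/funext => u; rewrite !DM// /W' /delta; ring.
  exact: (eq_ind_r (fun F => admissible ip mu d i F W')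
    (eq_ind_r (fun F => admissible ip mu d i _ F) h WE') WE).
have W2 : L2 mu (W : borel U -> R) by exact: L2BM.
have dW2 : L2 mu (delta ip d lam i W W' : borel U -> R).
  have E1 : delta ip d lam i W W' = fun u : borel U =>
      (lam i * lam j)^-1 * ((ip u (d i) * ip u (d j)) * (V i u * V j u))
      + (- (lam i)^-1 * (ip u (d i) * (V i u * D j (V j) u))
      + (- (lam j)^-1 * (ip u (d j) * (V i u * D i (V j) u))
      + (- ((i == j)%:R / lam j) * (V i u * V j u) + (V i u * D i (D j (V j)) u
      + - (D i (V i) u * delta ip d lam j (V j) (D j (V j)) u))))).
    by apply/funext => u; rewrite /W /W' /delta; field; rewrite !gt_eqF.
  apply: (eq_ind_r (L2 mu) _ E1).
  apply: L2D; first by apply: L2Z; apply: L2MB; [exact: (L2_ip2 ip_norm mu_gaussian)|exact: BmM].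
  apply: L2D; first by apply: L2Z; apply: L2MB => //; exact: BmM.
  apply: L2D; first by apply: L2Z; apply: L2MB => //; exact: BmM.
  apply: L2D; first by apply: L2Z; exact/L2_Bm/BmM.
  by apply: L2D; [exact/L2_Bm/BmM|apply: L2N; exact: L2BM].
have [iW eW] := ibp_rho aW W2 dW2.
have [iZ eZ] := ibp_rho (admissible_Cn ip_norm mu_gaussian j CZ) (L2_Bm mu (Cn_Bm CZ))
  (L2_delta ip_norm mu_gaussian lam j CZ).
have dZ u : D j Z u = V i u * D j (D i (V j)) u + D j (V i) u * D i (V j) u by rewrite DM.
have sym u : D j (D i (V j)) u = D i (D j (V j)) u.
  exact: (congr1 (fun f : U -> R => f u) (pd_sym j i (V_smooth j))).
have i2 : L1 mu (fun u => rho u * second_order i j u) by exact/L1_Bm/BmM.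
rewrite -[RHS]addr0 -[X in _ + X]addr0 -{1}eW -eZ -!expectD//; first last.
- exact: L1D.
- exact: L1D.
congr expect; apply/funext => u.
rewrite /A /first_order /second_order /adj /delta dZ sym DM// /W /W' /Z /delta.
by have [->|_] := eqVneq i j; rewrite ?mulr1n ?mulr0n; field; rewrite !gt_eqF.
Qed.

Hypothesis rho_convex : forall s : seq nat, 0 <= \sum_(i <- s) \sum_(j <- s)
  E (fun u => rho u * first_order i j u).

Let i_AA i j : L1 mu (fun u => rho u * (A i u * A j u)).
Proof. by apply: L1BM => //; exact: L2M. Qed.

Let i_second i j : L1 mu (fun u => rho u * second_order i j u).
Proof. exact/L1_Bm/BmM. Qed.

(** Summed over all pairs, the first-order terms are the second derivative of the
    convex potential on the field [V], which can be dropped. *)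
Lemma bochner_ge (s : seq nat) : uniq s ->
  E (fun u => rho u * (\sum_(i <- s) \sum_(j <- s) D j (V i) u * D i (V j) u
    + \sum_(i <- s) V i u ^+ 2 / lam i)) <=
  E (fun u => rho u * (\sum_(i <- s) A i u) ^+ 2).
Proof.
move=> us; rewrite (_ : E (fun u => rho u * (\sum_(i <- s) A i u) ^+ 2) =
    \sum_(i <- s) \sum_(j <- s) E (fun u => rho u * (A i u * A j u))); last first.
  transitivity (E (fun u => \sum_(i <- s) \sum_(j <- s) rho u * (A i u * A j u))).
    congr expect; apply/funext => u; rewrite expr2 big_distrlr/= mulr_sumr.
    by apply: eq_bigr => i _; rewrite mulr_sumr.
  rewrite expect_sum => [|i]; last exact: L1_sum.
  by apply: eq_bigr => i _; rewrite expect_sum.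
rewrite (_ : E _ = \sum_(i <- s) \sum_(j <- s) E (fun u => rho u * second_order i j u)); last first.
  transitivity (E (fun u => \sum_(i <- s) \sum_(j <- s) rho u * second_order i j u)).
    congr expect; apply/funext => u; rewrite -big_split/= mulr_sumr.
    apply: eq_big_seq => i si; rewrite -mulr_sumr /second_order big_split/=; congr (_ * (_ + _)).
    rewrite (bigD1_seq i)//= eqxx mul1r big1 ?addr0// => j /negbTE.
    by rewrite eq_sym => ->; rewrite mul0r.
  rewrite expect_sum => [|i]; last exact: L1_sum.
  by apply: eq_bigr => i _; rewrite expect_sum.
rewrite -subr_ge0 -sumrB (le_trans (rho_convex s))// le_eqVlt; apply/orP; left; apply/eqP.
by apply: eq_bigr => i _; rewrite -sumrB; apply: eq_bigr => j _; rewrite bochner_pair addrK.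
Qed.

(** Integration by parts against [F V_i]. *)
Lemma dirichlet_form (s : seq nat) F : Cn d 1 F ->
  E (fun u => rho u * (F u * \sum_(i <- s) A i u)) =
  E (fun u => rho u * \sum_(i <- s) D i F u * V i u).
Proof.
move=> CF; have bF := Cn_Bm CF; have bF' i := Cn_Bm (Cn_pd i CF).
have CFV i : Cn d 1 (fun u => F u * V i u) := CnM CF (CnS (V_smooth i)).
have h i := ibp_rho (admissible_Cn ip_norm mu_gaussian i (CFV i)) (L2_Bm mu (Cn_Bm (CFV i)))
  (L2_delta ip_norm mu_gaussian lam i (CFV i)).
transitivity (\sum_(i <- s) E (fun u => rho u * (F u * A i u))).
  rewrite -expect_sum => [|i]; last by apply: L1BM => //; apply: L1BM => //; exact: L2_L1.
  by congr expect; apply/funext => u; rewrite !mulr_sumr.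
transitivity (\sum_(i <- s) E (fun u => rho u * (D i F u * V i u))); last first.
  rewrite -expect_sum => [|i]; last by apply/L1_Bm/BmM => //; exact: BmM.
  by congr expect; apply/funext => u; rewrite !mulr_sumr.
apply: eq_bigr => i _; have [i0 e0] := h i.
have iQ : L1 mu (fun u => rho u * (D i F u * V i u)) :=
  L1_Bm mu (BmM rho_Bm (BmM (bF' i) (bV i))).
rewrite -[RHS]addr0 -e0 -(expectD iQ i0).
congr expect; apply/funext => u.
by rewrite /A /adj /delta DM//; ring.
Qed.

End second_order_estimate.

(** * Cylinder functions and diagonal operators *)

Section cylinder_functions.
Context {R : realType} {U : completeNormedModType R}.
Variable ip : {dot U for idfun}.
Hypothesis ip_norm : forall u, ip u u = `|u| ^+ 2.
Variable d : nat -> U.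
Hypothesis d_basis : orthonormal_basis ip d.

Lemma ip_inj v w : (forall h, ip v h = ip w h) -> v = w.
Proof.
move=> vw; apply/eqP; rewrite -subr_eq0 -normr_eq0 -sqrf_eq0 -ip_norm ipBl vw.
by rewrite -ipBl subrr ip0l.
Qed.

Lemma differentiable_ip h x : differentiable (fun u => ip u h) x.
Proof.
have ip_lin : linear (fun u : U => ip u h : R).
  by move=> a u v; rewrite ipDl ipZl.
pose M := GRing.isLinear.Build _ _ _ _ _ ip_lin.
pose L : {linear U -> R} := HB.pack (fun u : U => ip u h : R) M.
apply: (@linear_differentiable _ _ _ L); exact: lip_continuous (ip_lip ip_norm h).
Qed.

Variables (m : nat) (phi : 'rV[R]_m -> R).
Hypothesis phi_smooth : Cb_infty phi.

Let coord := coordinates ip d m.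
Let cyl s := partials s phi \o coord.

Let coord_lin a u v : coord (a *: u + v) = a *: coord u + coord v.
Proof. by apply/rowP => i; rewrite !mxE ipDl ipZl. Qed.

Let coordE v : coord v = \sum_(i < m) ip v (d i) *: delta_mx 0 i.
Proof. by rewrite [LHS]row_sum_delta; apply: eq_bigr => i _; rewrite mxE. Qed.

Let differentiable_coordinates x : differentiable coord x.
Proof.
have -> : coord = \sum_(i < m) (fun u => ip u (d i) *: delta_mx 0 i).
  by apply/funext => u; rewrite coordE fct_sumE.
by apply: differentiable_sum => i; apply: differentiableZl; exact: differentiable_ip.
Qed.

Let differentiable_cyl s x : differentiable (cyl s) x.
Proof.
apply: differentiable_comp; first exact: differentiable_coordinates.
exact: (phi_smooth s).1.
Qed.

Let dd_cyl v s : dd v (cyl s) (fun u => \sum_(i < m) ip v (d i) * cyl (i :: s) u).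
Proof.
move=> u; apply: DeriveDef; first exact/diff_derivable/differentiable_cyl.
have -> : 'D_v (cyl s) u = 'D_(coord v) (partials s phi) (coord u).
  have eqf : (fun h : R => h^-1 *: ((cyl s \o shift u) (h *: v) - cyl s u)) =
      fun h => h^-1 *: ((partials s phi \o shift (coord u)) (h *: coord v) - partials s phi (coord u)).
    by apply/funext => h; rewrite /= /cyl /= coord_lin.
  by rewrite /derive eqf.
have ds := (phi_smooth s).1 (coord u).
rewrite deriveE// (coordE v) linear_sum; apply: eq_bigr => i _.
by rewrite linearZ -deriveE.
Qed.

Let pd_cyl (i : 'I_m) s : 'D_(d i) (cyl s) = cyl (i :: s).
Proof.
rewrite (pd_eq (dd_cyl (d i) s)); apply/funext => u.
rewrite (bigD1 i)//= (basis_ip d_basis) eqxx mul1r big1 ?addr0// => j ji.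
by rewrite (basis_ip d_basis) (inj_eq val_inj) eq_sym (negbTE ji) mul0r.
Qed.

(** A derivative of a cylinder function along any vector is a linear combination
    of the cylinder functions of the partial derivatives. *)
Lemma Cn_cylinder n : Cn d n (phi \o coord).
Proof.
suff : forall s, Cn d n (cyl s) by move=> /(_ [::]).
elim: n => [|n IHn] s.
  have [_ [M Ms]] := phi_smooth s.
  pose B i := sval (cid (phi_smooth (i :: s)).2).
  have Bi i x : `|partials (i :: s) phi x| <= B i by rewrite /B; case: cid.
  have B0 i : 0 <= B i by apply: le_trans (Bi i 0).
  have M0 : 0 <= M by apply: le_trans (Ms 0).
  exists (M + \sum_(i < m) B i); split => [u|u v].
    by rewrite (le_trans (Ms _))// lerDl sumr_ge0.
  apply: (@le_trans _ _ ((\sum_(i < m) B i) * `|u - v|)); last by rewrite ler_wpM2r// lerDr.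
  apply: dd_lip => w; eexists; first exact: dd_cyl.
  move=> x; rewrite (le_trans (ler_norm_sum _ _ _))// mulr_suml ler_sum// => i _.
  rewrite normrM mulrC ler_pM//; first exact: Bi.
  by rewrite (le_trans (ip_CS ip_norm _ _))// (basis_norm ip_norm d_basis) mulr1.
apply: Cn_intro => [|k]; first exact: Cn_BL (IHn s).
eexists; first exact: dd_cyl.
elim: (index_enum _) => [|i r IHr].
  by under [X in Cn _ _ X]eq_fun do rewrite big_nil; exact: Cn_cst.
by under [X in Cn _ _ X]eq_fun do rewrite big_cons; apply: CnD => //; exact: CnZ.
Qed.

Let pd_sum u h : 'D_h (phi \o coord) u = ip (\sum_(i < m) 'D_(d i) (phi \o coord) u *: d i) h.
Proof.
rewrite (congr1 (fun f : U -> R => f u) (pd_eq (dd_cyl h [::]))) ip_suml.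
apply: eq_bigr => i _.
by rewrite ipZl (congr1 (fun f : U -> R => f u) (pd_cyl i [::])) mulrC (ipC ip h).
Qed.

Lemma gradient_cylinder : gradient ip (phi \o coord) =
  fun u => \sum_(i < m) 'D_(d i) (phi \o coord) u *: d i.
Proof.
apply/funext => u; set W := RHS.
have WP h : 'd (phi \o coord) u h = ip W h.
  by rewrite -deriveE; [exact: pd_sum|exact: (differentiable_cyl [::])].
rewrite /gradient; case: xgetP => [w _ wE|/(_ W)]; last by case.
by apply: ip_inj => h; rewrite -wE.
Qed.

Lemma pd_gradient u h : 'D_h (phi \o coord) u = ip (gradient ip (phi \o coord) u) h.
Proof. by rewrite pd_sum gradient_cylinder. Qed.

Lemma hessian_cylinder u h : hessian ip (phi \o coord) u h =
  \sum_(i < m) (\sum_(j < m) ip h (d j) * 'D_(d j) ('D_(d i) (phi \o coord)) u) *: d i.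
Proof.
rewrite /hessian gradient_cylinder.
have -> : (fun u => \sum_(i < m) 'D_(d i) (phi \o coord) u *: d i) =
    \sum_(i < m) (fun u => cyl [:: i] u *: d i).
  apply/funext => x; rewrite fct_sumE; apply: eq_bigr => i _.
  by rewrite (congr1 (fun f : U -> R => f x) (pd_cyl i [::])).
have dc (i : 'I_m) : differentiable (fun u => cyl [:: i] u *: d i) u.
  by apply: differentiableZl; exact: differentiable_cyl.
rewrite -deriveE; last by apply: differentiable_sum.
rewrite derive_sum => [|i]; last exact: diff_derivable.
apply: eq_bigr => i _; rewrite deriveE// diffZl; last exact: differentiable_cyl.
rewrite -deriveE; last exact: differentiable_cyl.
apply: (congr1 (fun x => x *: d i)).
apply: etrans (congr1 (fun f : U -> R => f u) (pd_eq (dd_cyl h [:: i]))) _.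
apply: eq_bigr => j _; apply: (congr1 ( *%R (ip h (d j)))).
have e2 := etrans (congr1 (fun G : U -> R => 'D_(d j) G) (pd_cyl i [::])) (pd_cyl j [:: i]).
exact: esym (congr1 (fun f : U -> R => f u) e2).
Qed.

End cylinder_functions.

Lemma limn_series_fin (R : realType) (V : normedModType R) (a : nat -> V) m :
  (forall i, (m <= i)%N -> a i = 0) -> limn (series a) = \sum_(i < m) a i.
Proof.
move=> a0; apply: cvg_lim; first exact: norm_hausdorff.
rewrite -(cvg_shiftn m)/= (_ : (fun n => _) = fun=> \sum_(i < m) a i); first exact: cvg_cst.
apply/funext => n; rewrite seriesEnat/= (big_cat_nat (leq0n m) (leq_addl n m))/= big_mkord.
rewrite [X in _ + X](_ : _ = 0) ?addr0// big_nat big1// => i /andP[mi _]; exact: a0.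
Qed.

Section diagonal_operators.
Context {R : realType} {U : completeNormedModType R}.
Variable ip : {dot U for idfun}.
Hypothesis ip_norm : forall u, ip u u = `|u| ^+ 2.
Variable d : nat -> U.
Hypothesis d_basis : orthonormal_basis ip d.
Variable C : partial_op (U := U).
Hypothesis C_linear : linear_op C.
Hypothesis C_sym : symmetric_op ip C.
Hypothesis C_dom : forall n, basis_span d n `<=` dom C.
Hypothesis C_span : forall n, C @` basis_span d n `<=` basis_span d n.

Definition diag k := ip (C (d k)) (d k).

Let basis_span_d k : basis_span d k.+1 (d k).
Proof.
exists (fun i => (i == k :> nat)%:R); rewrite big_ord_recr/= eqxx scale1r big1 ?add0r// => i _.
by rewrite (ltn_eqF (ltn_ord i)) scale0r.
Qed.

Let dom_d k : dom C (d k). Proof. exact: C_dom (basis_span_d k). Qed.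

(** By symmetry the matrix of [C] is lower and upper triangular. *)
Lemma C_diag k : C (d k) = diag k *: d k.
Proof.
have [a aE] : basis_span d k.+1 (C (d k)) by apply: C_span; exists (d k).
have off j : (j < k)%N -> ip (C (d k)) (d j) = 0.
  move=> jk; rewrite C_sym//.
  have [b ->] : basis_span d j.+1 (C (d j)) by apply: C_span; exists (d j).
  rewrite ip_sumr big1// => i _; rewrite ipZr (basis_ip d_basis) (gtn_eqF _) ?mulr0//.
  exact: leq_trans (ltn_ord i) jk.
have aI (i : 'I_k.+1) : a i = ip (C (d k)) (d i).
  rewrite aE ip_suml (bigD1 i)//= ipZl (basis_ip d_basis) eqxx mulr1 big1 ?addr0// => j ji.
  by rewrite ipZl (basis_ip d_basis) (inj_eq val_inj) (negbTE ji) mulr0.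
rewrite [LHS]aE big_ord_recr/= big1 ?add0r ?aI// => i _.
by rewrite aI off ?scale0r//=.
Qed.

Lemma C_sum m (a : nat -> R) :
  C (\sum_(i < m) a i *: d i) = \sum_(i < m) (diag i * a i) *: d i.
Proof.
suff : dom C (\sum_(i < m) a i *: d i) /\
    C (\sum_(i < m) a i *: d i) = \sum_(i < m) (diag i * a i) *: d i by case.
have [d0 Clin] := C_linear.
elim: m => [|m [dm IHm]].
  rewrite !big_ord0; split => //.
  by have [_] := Clin (-1) 0 0 d0 d0; rewrite scaler0 addr0 scaleN1r addNr.
rewrite !big_ord_recr/= addrC; have [? ->] := Clin (a m) (d m) _ (dom_d m) dm; split => //.
by rewrite IHm addrC C_diag scalerA mulrC.
Qed.

Lemma trace_sum (T : U -> U) m : (forall k, (m <= k)%N -> ip (T (d k)) (d k) = 0) ->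
  trace ip d T = \sum_(k < m) ip (T (d k)) (d k).
Proof. exact: limn_series_fin. Qed.

Lemma norm_inv_sqrt_op (lam : nat -> R) m (a : nat -> R) : (forall i, 0 < lam i) ->
  `|inv_sqrt_op ip d lam (\sum_(i < m) a i *: d i)| ^+ 2 = \sum_(i < m) a i ^+ 2 / lam i.
Proof.
move=> lam0; rewrite /inv_sqrt_op/= (@limn_series_fin _ _ _ m) => [|i mi]; last first.
  by rewrite (ip_basis_sum d_basis) ltnNge mi/= mulr0 scale0r.
rewrite -ip_norm ip_suml; apply: eq_bigr => k _; rewrite ipZl.
rewrite (ip_basis_sum d_basis) ltn_ord (ipC ip (d k)).
rewrite (eq_bigr (fun i : 'I_m => ((Num.sqrt (lam i))^-1 * a i) *: d i)) => [|i _]; last first.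
  by rewrite (ip_basis_sum d_basis) ltn_ord.
rewrite (ip_basis_sum d_basis m (fun i => (Num.sqrt (lam i))^-1 * a i)) ltn_ord.
rewrite -{3}(sqr_sqrtr (ltW (lam0 k))) -exprVn; ring.
Qed.

Lemma inverse_op_sum (Q : {linear U -> U}) (lam : nat -> R) m (a : nat -> R) :
  injective Q -> (forall i, 0 < lam i) -> (forall i, Q (d i) = lam i *: d i) ->
  inverse_op Q (\sum_(i < m) a i *: d i) = \sum_(i < m) (a i / lam i) *: d i.
Proof.
move=> Qinj lam0 Qd; set W := RHS.
have QW : Q W = \sum_(i < m) a i *: d i.
  rewrite /W linear_sum; apply: eq_bigr => i _.
  by rewrite linearZ/= Qd scalerA divfK// gt_eqF.
rewrite /inverse_op/=; case: xgetP => [w _ wE|/(_ W)]; last by case.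
by apply: Qinj; rewrite wE QW.
Qed.

End diagonal_operators.

(** * Mean-square convergence and the Gibbs measure *)

Section mean_square_convergence.
Context d (T : measurableType d) (R : realType) (mu : probability T R).
Notation E := (expect mu).

(** Monotonicity without measurability: [g] will be the norm of a difference of
    two vector fields, and only its components are known to be Borel. *)
Let le_integral_nonmeas (f g : T -> \bar R) : (forall x, 0 <= f x)%E ->
  (forall x, f x <= g x)%E -> (\int[mu]_x f x <= \int[mu]_x g x)%E.
Proof.
move=> f0 fg; have g0 x : (0 <= g x)%E by exact: le_trans (fg x).
rewrite !ge0_integralTE//; apply: le_ereal_sup => _ [h hf <-]; exists h => // x.
exact: le_trans (hf x) (fg x).
Qed.

Let sqr_le (y : R) (z : \bar R) : (`|y|%:E <= `|z|)%E -> ((y ^+ 2)%:E <= `|z| `^ 2)%E.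
Proof.
case: z => [z| |] /=; rewrite ?pnatr_eq0 ?leey//.
rewrite !lee_fin powR_mulrn// => yz.
by rewrite -(real_normK (num_real y)) ler_sqr ?nnegrE.
Qed.

Section approximation.
Variable g : nat -> T -> \bar R.
Hypothesis g_cvg : ('N[mu]_2%:E[g n])%E @[n --> \oo] --> 0%E.

Let int_sqr : \forall n \near \oo,
  (\int[mu]_x (`|g n x| `^ 2) = ((fine ('N[mu]_2%:E[g n])) ^+ 2)%:E)%E.
Proof.
have /fine_cvgP[fin _] := g_cvg; apply: filterS fin => n fn.
rewrite -poweR_Lnorm// -[in LHS](fineK fn) poweR_EFin powR_mulrn//.
by rewrite fine_ge0// Lnorm_ge0.
Qed.

Lemma Lnorm_cvg_finite : (forall n, measurable_fun setT (g n)) ->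
  exists n, mu.-negligible [set x | g n x \isn't a fin_num].
Proof.
move=> mg; have [n gn] := filter_ex int_sqr; exists n.
have ig : mu.-integrable setT (fun x => `|g n x| `^ 2)%E.
  apply/integrableP; split; first by
    apply: (measurableT_comp (measurable_poweR _)); exact: measurableT_comp.
  under eq_integral do rewrite gee0_abs ?poweR_ge0//.
  by rewrite gn ltry.
apply: negligibleS (integrable_ae measurableT ig) => x /= gx fx.
by move: gx fx; case: (g n x) => [r| |]; rewrite //= pnatr_eq0 => _ /(_ I).
Qed.

Lemma Lnorm_cvg_expect (Y : nat -> T -> R) : (forall n, measurable_fun setT (Y n)) ->
  (forall n x, `|Y n x|%:E <= `|g n x|)%E ->
  (exists n, L2 mu (Y n)) /\ E (fun x => Y n x ^+ 2) @[n --> \oo] --> 0.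
Proof.
move=> mY Yg.
have Yint n : (0 <= \int[mu]_x (Y n x ^+ 2)%:E <= \int[mu]_x (`|g n x| `^ 2))%E.
  rewrite integral_ge0/=; last by move=> x _; rewrite lee_fin sqr_ge0.
  by apply: le_integral_nonmeas => x; [rewrite lee_fin sqr_ge0|exact: sqr_le].
split.
  have [n gn] := filter_ex int_sqr; exists n; split => //.
  apply/integrableP; split; first by apply/measurable_EFinP; exact: measurable_funX.
  under eq_integral do rewrite /= ger0_norm ?sqr_ge0//.
  by have /andP[_ h] := Yint n; rewrite (le_lt_trans h)// gn ltry.
have /fine_cvgP[_ c0] := g_cvg.
have c1 : (fine ('N[mu]_2%:E[g n])) ^+ 2 @[n --> \oo] --> 0.
  by rewrite -[X in _ --> X](expr0n R 2); apply: cvg_sqr.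
apply: (@squeeze_cvgr _ _ _ _ (cst 0) _ _ _ _ _ c1); last exact: cvg_cst.
apply: filterS int_sqr => n gn; have := Yint n; rewrite gn /expect /Rintegral.
by case: (\int[mu]_x _)%E => [r| |] => [|/andP[]|/andP[]] //; rewrite !lee_fin.
Qed.

End approximation.

(** Where [Phi] is infinite the Gibbs density vanishes, while [fine] turns the
    exponential into 1; that set is null. *)
Lemma integral_gibbs (Phi : {mfun T >-> \bar R}) (F : T -> R) :
  (forall x, -oo < Phi x)%E -> mu.-negligible [set x | Phi x = +oo%E] ->
  measurable_fun setT F -> L1 mu (fun x => F x * expR (- fine (Phi x))) ->
  (\int[gibbs mu Phi]_x (F x)%:E = ((fine (gibbs_const mu Phi))^-1 *
    E (fun x => F x * expR (- fine (Phi x))))%:E)%E.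
Proof.
move=> Phi_gt Phi_fin mF iF; set c := (fine _)^-1.
have c0 : 0 <= c.
  by rewrite invr_ge0 fine_ge0//; apply: integral_ge0 => x _; exact: expeR_ge0.
pose w x : R := c * if Phi x == +oo%E then 0 else expR (- fine (Phi x)).
have mrho : measurable_fun setT (fun x => expR (- fine (Phi x))).
  by apply: measurableT_comp => //; apply: measurable_funN; exact: measurableT_comp.
have mw : measurable_fun setT w.
  by apply: measurable_funM => //; apply: measurable_fun_ifT => //; exact: measurable_fun_eqe.
have w0 x : 0 <= w x by rewrite /w; case: ifP => _; rewrite mulr_ge0// expR_ge0.
have dE x : gibbs_density mu Phi x = (w x)%:E.
  rewrite /gibbs_density /w -/c EFinM; congr (_ * _)%E.
  by have := Phi_gt x; case: (Phi x).
have gE A : measurable A -> gibbs mu Phi A = (\int[mu]_(x in A) (w x)%:E)%E.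
  by move=> _; rewrite /gibbs; apply: eq_integral => x _; exact: dE.
rewrite (integral_density w0 mw gE mF).
rewrite EFinM /expect /Rintegral fineK; last exact: integrable_fin_num.
rewrite -integralZl//; apply: ae_eq_integral => //.
- by apply/measurable_EFinP; exact: measurable_funM.
- by apply: measurable_funeM; apply/measurable_EFinP; exact: measurable_funM.
- apply: negligibleS Phi_fin => x /= h; apply: contrapT => Phix; apply: h => _.
  rewrite /w (negbTE (introN eqP Phix)) -EFinM; congr (_%:E); ring.
Qed.

End mean_square_convergence.

(** * The resolvent estimates *)

(** With [g = alpha F + S], expanding [E (rho g^2)] gives three nonnegative terms:
    the mixed one is the Dirichlet form and the last one dominates [H]. *)
Lemma resolvent_estimates d (T : measurableType d) (R : realType) (mu : probability T R)
    (rho F S Q H : T -> R) (alpha : R) : 0 < alpha ->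
  Bm rho -> (forall u, 0 <= rho u) -> Bm F -> L2 mu S -> Bm Q -> (forall u, 0 <= Q u) ->
  expect mu (fun u => rho u * (F u * S u)) = expect mu (fun u => rho u * Q u) ->
  expect mu (fun u => rho u * H u) <= expect mu (fun u => rho u * S u ^+ 2) ->
  expect mu (fun u => rho u * (alpha * F u ^+ 2 + Q u)) <=
    alpha^-1 * expect mu (fun u => rho u * (alpha * F u + S u) ^+ 2) /\
  expect mu (fun u => rho u * H u) <=
    expect mu (fun u => rho u * (alpha * F u + S u) ^+ 2).
Proof.
move=> a0 brho rho0 bF S2 bQ Q0 FS HS.
have [mS iS] := S2.
have bF2 : Bm (fun u => F u ^+ 2) by under [X in Bm X]eq_fun do rewrite expr2; exact: BmM.
have i1 : L1 mu (fun u => rho u * F u ^+ 2) by exact/L1_Bm/BmM.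
have i2 : L1 mu (fun u => rho u * (F u * S u)) by apply: L1BM => //; apply: L1BM => //; exact: L2_L1.
have i3 : L1 mu (fun u => rho u * S u ^+ 2) by exact: L1BM.
have iQ : L1 mu (fun u => rho u * Q u) by exact/L1_Bm/BmM.
have -> : expect mu (fun u => rho u * (alpha * F u ^+ 2 + Q u)) =
    alpha * expect mu (fun u => rho u * F u ^+ 2) + expect mu (fun u => rho u * Q u).
  rewrite -expectZ// -expectD//; last exact: L1Z.
  by congr expect; apply/funext => u; ring.
have -> : expect mu (fun u => rho u * (alpha * F u + S u) ^+ 2) =
    alpha ^+ 2 * expect mu (fun u => rho u * F u ^+ 2)
    + (2 * alpha * expect mu (fun u => rho u * Q u) + expect mu (fun u => rho u * S u ^+ 2)).
  rewrite -FS -!expectZ// -!expectD//; try by [exact: L1Z|apply: L1D => //; exact: L1Z].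
  by congr expect; apply/funext => u; ring.
have h1 : 0 <= expect mu (fun u => rho u * F u ^+ 2).
  by apply: expect_ge0 => u; rewrite mulr_ge0 ?sqr_ge0.
have h2 : 0 <= expect mu (fun u => rho u * Q u).
  by apply: expect_ge0 => u; rewrite mulr_ge0.
have h3 : 0 <= expect mu (fun u => rho u * S u ^+ 2).
  by apply: expect_ge0 => u; rewrite mulr_ge0 ?sqr_ge0.
split; last first.
  by rewrite (le_trans HS)// addrA lerDr addr_ge0// !mulr_ge0 ?sqr_ge0// ltW.
rewrite ler_pdivlMl//; move: h1 h2 h3; set x := expect _ _; set y := expect _ _.
by set z := expect _ _ => x0 y0 z0; have := mulr_ge0 (ltW a0) y0; nra.
Qed.

(** * Proof of the theorem *)

Theorem theorem3p11 (R : realType) (U : completeNormedModType R)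
  (ip : {dot U for idfun}) (ip_norm : forall u, ip u u = `|u| ^+ 2)
  (mu1 : probability (borel U) R) (Q1 : {linear U -> U})
  (mu1_gaussian : centered_gaussian ip mu1)
  (mu1_cov : covariance_operator ip mu1 Q1)
  (d : nat -> U) (d_basis : orthonormal_basis ip d)
  (Q1_cont : continuous Q1)
  (Q1_sym : forall u v, ip (Q1 u) v = ip u (Q1 v))
  (Q1_ge0 : forall u, 0 <= ip (Q1 u) u)
  (Q1_trace : trace_class ip d Q1)
  (Q1_inj : injective Q1)
  (lam : nat -> R) (lam_gt0 : forall i, 0 < lam i)
  (lam_decr : nonincreasing_seq lam)
  (lam_cvg0 : lam i @[i --> \oo] --> (0 : R))
  (Q1_eigen : forall i, Q1 (d i) = lam i *: d i)
  (C : partial_op (U := U)) (C_linear : linear_op C)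
  (C_sym : symmetric_op ip C) (C_ge0 : nonneg_op ip C)
  (C_dom : forall n, basis_span d n `<=` dom C)
  (C_span : forall n, C @` basis_span d n `<=` basis_span d n)
  (C_dissip : exists2 tau1 : R, 0 < tau1 &
    forall u, dom (comp_op (inverse_op Q1) C) u ->
      ip (- comp_op (inverse_op Q1) C u) u <= - tau1 * `|u| ^+ 2)
  (Phi : {mfun borel U >-> \bar R}) (DPhi : borel U -> borel U)
  (Phi_W12 : W12_gradient ip d mu1 Phi DPhi)
  (Phi_convex : convex_ereal (Phi : U -> \bar R))
  (Phi_bounded : exists M : R, forall u, (M%:E <= Phi u)%E)
  (Phi_lsc : lower_semicontinuous (Phi : U -> \bar R))
  (DPhi_Lp : exists2 p : R, 2 < p &
    (\int[mu1]_u ((`|DPhi u : U| `^ p)%:E) < +oo)%E)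
  (f : U -> R) (f_FCb : FCb_infty ip d f)
  (alpha : R) (alpha_gt0 : 0 < alpha) :
  let N := kolmogorov ip d Q1 C DPhi in
  let muPhi := gibbs mu1 Phi in
  let D := gradient ip f in
  let D2 := hessian ip f in
  let g u := alpha * f u - N f u in
  (\int[muPhi]_u (alpha * f u ^+ 2 + ip (C (D u)) (D u))%:E
     <= (alpha^-1)%:E * \int[muPhi]_u (g u ^+ 2)%:E)%E /\
  (\int[muPhi]_u (trace ip d ((C \o D2 u) \o (C \o D2 u))
                  + `|inv_sqrt_op ip d lam (C (D u))| ^+ 2)%:E
     <= 4%:E * \int[muPhi]_u (g u ^+ 2)%:E)%E.
Proof.
move=> N muPhi D D2 g.
have [m [phi [Cphi fE]]] := f_FCb.
have [M Phi_ge] := Phi_bounded.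
have [mPhi mDPhi [fs [fsF fs_cvg dfs_cvg]]] := Phi_W12.
pose X (u : borel U) := fine (Phi u); pose X_ k (u : borel U) := ip (DPhi u : U) (d k).
have fsC n l : Cn d l (fs n).
  by have [? [? [? ->]]] := fsF n; exact: (Cn_cylinder ip_norm d_basis).
have mX : measurable_fun setT X by exact: measurableT_comp.
have mX_ k : measurable_fun setT (X_ k).
  exact: (measurableT_comp (ip_measurable ip_norm (d k)) mDPhi).
have mfs n : measurable_fun setT (fs n : borel U -> R) := (Cn_Bm (fsC n 0%N)).1.
have bfs' n k : Bm ('D_(d k) (fs n) : borel U -> R) := Cn_Bm (Cn_pd k (fsC n 1%N)).
have Phi_gt u : (-oo < Phi u)%E by rewrite (lt_le_trans _ (Phi_ge u))// ltNyr.
have [[n0 X0] X_cvg] : (exists n, L2 mu1 (fun u => fs n u - X u)) /\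
    expect mu1 (fun u => (fs n u - X u) ^+ 2) @[n --> \oo] --> 0.
  apply: (Lnorm_cvg_expect (Y := fun n u => fs n u - X u) fs_cvg) => [n|n u].
    exact: measurable_funB.
  by rewrite /X; case: (Phi u) => [r| |] //=; rewrite leey.
have X_conv k : (exists n, L2 mu1 (fun u => 'D_(d k) (fs n) u - X_ k u)) /\
    expect mu1 (fun u => ('D_(d k) (fs n) u - X_ k u) ^+ 2) @[n --> \oo] --> 0.
  apply: (Lnorm_cvg_expect (Y := fun n u => 'D_(d k) (fs n) u - X_ k u) dfs_cvg) => [n|n u].
    by apply: measurable_funB => //; case: (bfs' n k).
  rewrite /= lee_fin normr_id.
  have [? [? [Cp fsE]]] := fsF n.
  have -> : 'D_(d k) (fs n) u = ip (gradient ip (fs n) u) (d k).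
    by rewrite fsE; exact: (pd_gradient ip_norm d_basis).
  rewrite /X_ -ipBl (le_trans (ip_CS ip_norm _ _))//.
  by rewrite (basis_norm ip_norm d_basis) mulr1.
have X_L2 : L2 mu1 X.
  have -> : X = fun u => fs n0 u - (fs n0 u - X u) by apply/funext => u; ring.
  by apply: L2B => //; exact/L2_Bm/(Cn_Bm (fsC n0 0%N)).
have X_L2' k : L2 mu1 (X_ k).
  have [[n nk] _] := X_conv k.
  have -> : X_ k = fun u => 'D_(d k) (fs n) u - ('D_(d k) (fs n) u - X_ k u).
    by apply/funext => u; ring.
  by apply: L2B => //; exact: L2_Bm.
have Phi_fin : mu1.-negligible [set u | Phi u = +oo%E].
  have [n nN] : exists n, mu1.-negligible [set u | ((fs n u)%:E - Phi u)%E \isn't a fin_num].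
    apply: (Lnorm_cvg_finite fs_cvg) => n; apply: emeasurable_funB => //.
    exact/measurable_EFinP.
  by apply: negligibleS nN => u /= ->.
(* [fine] sends [+oo] to 0, hence the minimum. *)
have X_ge u : Num.min M 0 <= X u.
  rewrite /X ge_min; have := Phi_ge u; case: (Phi u) => [r| |] //=.
    by rewrite lee_fin => ->.
  by rewrite lexx orbT.
have X_'cvg k := (X_conv k).2.
have wX k := weak_derivative_X ip_norm mu1_gaussian mu1_cov Q1_sym d_basis lam_gt0 Q1_eigen
  fsC X_L2 X_L2' X_cvg X_'cvg k.
have wrho k := weak_derivative_rho ip_norm mu1_gaussian mu1_cov Q1_sym d_basis lam_gt0
  Q1_eigen fsC X_L2 X_L2' X_cvg X_'cvg X_ge k.
have brho : Bm (rho X) := Bm_rho X_L2 X_ge.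
have Cf n : Cn d n f by rewrite fE; exact: (Cn_cylinder ip_norm d_basis).
pose c := diag ip d C.
have c0 k : 0 <= c k.
  apply: C_ge0; apply: (C_dom k.+1); exists (fun i => (i == k :> nat)%:R).
  rewrite big_ord_recr/= eqxx scale1r big1 ?add0r// => i _.
  by rewrite (ltn_eqF (ltn_ord i)) scale0r.
pose V i u := c i * 'D_(d i) f u.
have CV i : Cn d 2 (V i) by apply: CnZ; exact: Cn_pd (Cf 3%N).
have DV i j u : 'D_(d j) (V i) u = c i * 'D_(d j) ('D_(d i) f) u.
  exact: (congr1 (fun F : U -> R => F u) (pd_eq (ddZ (c i) (Cn_dd j (Cn_pd i (Cf 2%N)))))).
pose s := index_iota 0 m; pose S u := \sum_(i <- s) adj ip d lam X_ i (V i) ('D_(d i) (V i)) u.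
have rho_convex (r : seq nat) : 0 <= \sum_(i <- r) \sum_(j <- r) expect mu1 (fun u => rho X u *
    (X_ j u * (delta ip d lam i (fun u => V i u * V j u) ('D_(d i) (fun u => V i u * V j u)) u
     + X_ i u * (V i u * V j u)))).
  have := convexity_rho ip_norm mu1_gaussian fsC X_L2 X_L2' X_cvg X_'cvg X_ge CV
    (fun eta Ceta eta0 => weak_convexity ip_norm mu1_gaussian mu1_cov Q1_sym d_basis lam_gt0
       Q1_eigen mPhi Phi_convex Phi_lsc Phi_ge Phi_fin X_L2 r wX CV Ceta eta0).
  congr (0 <= _); apply: eq_bigr => i _; apply: eq_bigr => j _.
  by congr expect; apply/funext => u; rewrite -[LHS]mulrA.
have bochner := bochner_ge ip_norm mu1_gaussian d_basis lam_gt0 brho X_L2' wrho CV rho_convex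
  (iota_uniq 0 (m - 0)).
have dirichlet := dirichlet_form ip_norm mu1_gaussian lam_gt0 brho X_L2' wrho CV s (Cf 1%N).
pose Q u := \sum_(i <- s) 'D_(d i) f u * V i u.
pose H u := \sum_(i <- s) \sum_(j <- s) 'D_(d j) (V i) u * 'D_(d i) (V j) u
  + \sum_(i <- s) V i u ^+ 2 / lam i.
have DE u : D u = \sum_(i < m) 'D_(d i) f u *: d i.
  by rewrite /D fE (gradient_cylinder ip_norm d_basis Cphi).
have D2E u h : D2 u h = \sum_(i < m) (\sum_(j < m) ip h (d j) * 'D_(d j) ('D_(d i) f) u) *: d i.
  by rewrite /D2 fE (hessian_cylinder ip_norm d_basis Cphi).
have Csum := C_sum d_basis C_linear C_sym C_dom C_span.
have CDE u : C (D u) = \sum_(i < m) V i u *: d i.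
  by rewrite DE (Csum m (fun i => 'D_(d i) f u)).
have CD2E u h : C (D2 u h) =
    \sum_(i < m) (\sum_(j < m) ip h (d j) * 'D_(d j) (V i) u) *: d i.
  rewrite D2E (Csum m (fun i => \sum_(j < m) ip h (d j) * 'D_(d j) ('D_(d i) f) u)).
  apply: eq_bigr => i _; congr (_ *: _); rewrite mulr_sumr; apply: eq_bigr => j _.
  by rewrite DV mulrCA.
have ip_CD2 u h k : ip (C (D2 u h)) (d k) =
    if (k < m)%N then \sum_(j < m) ip h (d j) * 'D_(d j) (V k) u else 0.
  by rewrite CD2E (ip_basis_sum d_basis m (fun i => \sum_(j < m) ip h (d j) * 'D_(d j) (V i) u)).
have single (F : nat -> R) k : (k < m)%N -> \sum_(j < m) ip (d k) (d j) * F j = F k.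
  move=> km; rewrite (bigD1 (Ordinal km))//= (basis_ip d_basis) eqxx mul1r big1 ?addr0// => j.
  by rewrite -(inj_eq val_inj)/= (basis_ip d_basis) eq_sym => /negbTE ->; rewrite mul0r.
(* [- N] is the sum of the adjoints applied to the components of [C D f]. *)
have NE u : N f u = - S u.
  rewrite /N /kolmogorov -/(D u) CDE.
  rewrite (trace_sum (m := m)) => [|k mk]; last by rewrite /= ip_CD2 ltnNge mk.
  rewrite (inverse_op_sum m (fun i => V i u) Q1_inj lam_gt0 Q1_eigen).
  rewrite !ip_sumr /S big_mkord -!sumrB -sumrN; apply: eq_bigr => i _.
  rewrite /= ip_CD2 ltn_ord (single (fun j => 'D_(d j) (V i) u))// !ipZr /adj /delta /X_; ring.
have gE u : g u = alpha * f u + S u by rewrite /g NE opprK.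
have QE u : ip (C (D u)) (D u) = Q u.
  rewrite /Q big_mkord DE ip_sumr; apply: eq_bigr => i _.
  by rewrite ipZr -DE CDE (ip_basis_sum d_basis m (fun i => V i u)) ltn_ord.
have HE u : trace ip d ((C \o D2 u) \o (C \o D2 u)) +
    `|inv_sqrt_op ip d lam (C (D u))| ^+ 2 = H u.
  rewrite CDE (norm_inv_sqrt_op ip_norm d_basis m (fun i => V i u) lam_gt0).
  rewrite (trace_sum (m := m)) => [|k mk]; last by rewrite /= ip_CD2 ltnNge mk.
  rewrite /H !big_mkord; congr (_ + _); apply: eq_bigr => i _; rewrite big_mkord /= ip_CD2 ltn_ord.
  apply: eq_bigr => j _; rewrite ip_CD2 ltn_ord mulrC.
  by rewrite (single (fun k => 'D_(d k) (V j) u)).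
have bV i : Bm (V i : borel U -> R) := Cn_Bm (CV i).
have bV' i j : Bm ('D_(d j) (V i) : borel U -> R) := Cn_Bm (Cn_pd j (CV i)).
have bf : Bm (f : borel U -> R) := Cn_Bm (Cf 0%N).
have bQ : Bm (Q : borel U -> R).
  by apply: Bm_sum => i; apply: BmM => //; exact: Cn_Bm (Cn_pd i (Cf 1%N)).
have bH : Bm (H : borel U -> R).
  apply: BmD; apply: Bm_sum => i; first by apply: Bm_sum => j; exact: BmM.
  by under [Y in Bm Y]eq_fun do rewrite mulrC expr2; apply: BmZ; exact: BmM.
have S2 : L2 mu1 (S : borel U -> R).
  apply: L2_sum => i; apply: L2D; last exact: L2MB.
  exact: (L2_delta ip_norm mu1_gaussian lam i (CnS (CV i))).
have [h1 h2] := resolvent_estimates alpha_gt0 brho (fun u => expR_ge0 (- X u)) bf S2 bQ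
  (fun u => sumr_ge0 _ (fun i _ => (eq_ind_r (fun x => 0 <= x)
     (mulr_ge0 (c0 i) (sqr_ge0 ('D_(d i) f u))) (mulrCA _ _ _)))) dirichlet bochner.
have gibbsE (F : borel U -> R) : measurable_fun setT F -> L1 mu1 (fun u => rho X u * F u) ->
    (\int[muPhi]_u (F u)%:E = ((fine (gibbs_const mu1 Phi))^-1 *
      expect mu1 (fun u => rho X u * F u))%:E)%E.
  have rhoC : (fun u => rho X u * F u) = fun u => F u * expR (- fine (Phi u)).
    by apply/funext => u; rewrite mulrC.
  by rewrite rhoC => mF iF; exact: integral_gibbs.
have k0 : 0 <= (fine (gibbs_const mu1 Phi))^-1.
  by rewrite invr_ge0 fine_ge0// integral_ge0// => u _; exact: expeR_ge0.
have L2g : L2 mu1 (fun u => alpha * f u + S u) by apply: L2D => //; apply: L2Z; exact: L2_Bm.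
have -> : (\int[muPhi]_u (g u ^+ 2)%:E = ((fine (gibbs_const mu1 Phi))^-1 *
    expect mu1 (fun u => rho X u * (alpha * f u + S u) ^+ 2))%:E)%E.
  under eq_integral do rewrite gE; have [mg ig] := L2g.
  by apply: gibbsE; [exact: measurable_funX|exact: L1BM].
have bf2 : Bm (fun u : borel U => alpha * f u ^+ 2 + Q u).
  by apply: BmD => //; apply: BmZ; under [Y in Bm Y]eq_fun do rewrite expr2; exact: BmM.
under eq_integral do rewrite QE.
under [X in _ /\ (X <= _)%E]eq_integral do rewrite HE.
rewrite !gibbsE; [|by case: bH|exact/L1_Bm/BmM|by case: bf2|exact/L1_Bm/BmM].
rewrite -!EFinM !lee_fin; split; first by rewrite mulrCA ler_wpM2l.
apply: (le_trans (ler_wpM2l k0 h2)); rewrite ler_peMl ?ler1n// mulr_ge0//.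
by apply: expect_ge0 => u; rewrite mulr_ge0 ?sqr_ge0// expR_ge0.
Qed.
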